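(* Let $k$ be an algebraically closed field of characteristic $\neq 2$. There exists a $3$-dimensional smooth affine scheme over the rational function field $k(T)$ and a non-trivial stably trivial rank $2$ vector bundle on it. Moreover (clearing denominators), there exists a $4$-dimensional smooth affine scheme over $k$ with a non-trivial stably free rank $2$ bundle over it.
   Context: A vector bundle is stably trivial (equivalently, stably free) if its direct sum with some trivial vector bundle of finite rank is trivial. *)

(* Defs.v *)
(* An affine scheme X = Spec A over a field F is represented by its coordinate
   algebra A, and a vector bundle on X by the A-module of its global
   sections.  *)
From HB Require Import structures.
From mathcomp Require Import all_boot all_algebra.
From mathcomp Require Import ring_quotient.
From mathcomp Require Import mpoly.

Set Implicit Arguments.
Unset Strict Implicit.
Unset Printing Implicit Defensive.

Import GRing.Theory.
Local Open Scope ring_scope.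

Definition surjective (S T : Type) (f : S -> T) : Prop :=
  forall y, exists x, f x = y.

Definition finite_type (F : fieldType) (A : comAlgType F) : Prop :=
  exists (n : nat) (g : {lrmorphism {mpoly F[n]} -> A}), surjective g.

(* The infinitesimal lifting property: algebra morphisms lift along
   surjections whose kernel has square zero.  *)
Definition formally_smooth (F : fieldType) (A : comAlgType F) : Prop :=
  forall (B C : comAlgType F) (p : {lrmorphism B -> C}),
    surjective p ->
    (forall x y : B, p x = 0 -> p y = 0 -> x * y = 0) ->
  forall g : {lrmorphism A -> C},
  exists h : {lrmorphism A -> B}, forall a, p (h a) = g a.

(* Over a field, finite type is the same as finite presentation.  *)
Definition smooth (F : fieldType) (A : comAlgType F) : Prop :=
  finite_type A /\ formally_smooth A.

(* [idealr_closed] includes properness.  *)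
Definition prime_ideal (A : comNzRingType) (p : {pred A}) : Prop :=
  idealr_closed p /\ prime_idealr_closed p.

Definition strict_subset (T : Type) (p q : {pred T}) : Prop :=
  {subset p <= q} /\ exists2 x, x \in q & x \notin p.

(* A chain p 0 < p 1 < ... < p n, of length n.  *)
Definition prime_chain (A : comNzRingType) (n : nat) (p : nat -> {pred A}) :
    Prop :=
  (forall i, (i <= n)%N -> prime_ideal (p i)) /\
  (forall i, (i < n)%N -> strict_subset (p i) (p i.+1)).

(* d is the supremum of the lengths of chains of primes; chains can be
   truncated, so every n <= d is the length of a chain.  *)
Definition krull_dim (A : comNzRingType) (d : nat) : Prop :=
  forall n : nat,
    (exists p : nat -> {pred A}, prime_chain n p) <-> (n <= d)%N.

Definition module_iso (A : comNzRingType) (M N : lmodType A) : Prop :=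
  exists f : {linear M -> N}, bijective f.

(* phi exhibits N as the localization of M at the powers of f.  *)
Definition is_localization (A : comNzRingType) (f : A) (M N : lmodType A)
    (phi : {linear M -> N}) : Prop :=
  [/\ bijective (fun y : N => f *: y),
      forall x : M, phi x = 0 -> exists n : nat, f ^+ n *: x = 0
    & forall y : N, exists (n : nat) (x : M), f ^+ n *: y = phi x].

(* On the basic open set D(f), the bundle is M_f; it is trivial of rank r there
   when M_f is isomorphic to (A_f)^r = (A^r)_f, i.e. when M and A^r have a
   common localization at f.  *)
Definition free_on_basic_open (A : comNzRingType) (r : nat) (M : lmodType A)
    (f : A) : Prop :=
  exists (N : lmodType A) (phi : {linear M -> N})
         (psi : {linear 'rV[A]_r -> N}),
    is_localization f phi /\ is_localization f psi.

(* The D(f i) cover Spec A exactly when the f i generate the unit ideal.  *)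
Definition vector_bundle (A : comNzRingType) (r : nat) (M : lmodType A) :
    Prop :=
  exists (m : nat) (f g : 'I_m -> A),
    \sum_i g i * f i = 1 /\ forall i, free_on_basic_open r M (f i).

Definition trivial_bundle (A : comNzRingType) (M : lmodType A) : Prop :=
  exists n : nat, module_iso M 'rV[A]_n.

Definition stably_trivial (A : comNzRingType) (M : lmodType A) : Prop :=
  exists n : nat, trivial_bundle (M * 'rV[A]_n)%type.

(* Main.v *)
(* Let T be a nonsquare in a field K with 2 <> 0, R = K[x, y, z], b = x^2 - T y^2,
   g = z^2 - T b^2 and A = R[1/g].  The row (x, y, z) is unimodular over A, since
   g = z z - T b x x + T^2 b y y, so the sum of its kernel P with A is A^3.  If P were
   free, the row could be completed to an invertible matrix over A, and clearing
   denominators would give a 3 x 3 matrix M over R with first column (x, y, z) and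
   determinant g^e.  A parity count rules this out.

   There are sigma and k with sigma^2 = T b^(2k) modulo g^e, and s and N with
   s^2 = T y^(2N) modulo b^(k+1); on the R-modules that occur, sigma / b^k and
   s / y^N are partially defined square roots of T.  The index of B / A is the
   dimension over K of B / A modulo the part on which s / y^N is defined.  A finite
   dimensional space with a square root of T has even dimension, so the parity of
   the index is additive.  Comparing M with its transpose through the Koszul complex
   of (x, y, z), where R / (x, y, z) contributes dimension 1, the indices attached
   to coker M and coker M^T have different parities.  On the other hand, the residue
   pairing v, p |-> lam (v^T adj(M) p) shows that these two indices are equal.

   For the first part K = k(T).  For the second, A is defined by the same formula
   over k[T, x, y, z], and a completion over k[T] would give one over k(T). *)
Require Import Defs.
From HB Require Import structures.
From mathcomp Require Import all_boot all_algebra.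
From mathcomp Require Import generic_quotient fraction ring_quotient mpoly ring.
From Stdlib Require Import ClassicalEpsilon.

Set Implicit Arguments.
Unset Strict Implicit.
Unset Printing Implicit Defensive.

Import GRing.Theory.
Local Open Scope ring_scope.

(** * Relative dimension *)

(** The shape of [g] comes from a descent in dimension. On the surface g = 0 the fraction z / b is a
    square root of T. What obstructs its action on a module is killed by a power of b, hence lives
    on the curve b = g = 0, where x / y is a square root of T. What obstructs that one is killed by
    a power of y and lives at the origin, with residue field K. Only there are dimensions finite, so
    that parity can detect the missing root of T. Since e is not under control, z / b and x / y are
    merely the starting points of a Newton iteration that yields roots modulo higher powers. The
    obstacle throughout is that these fractions act on no module as a whole: v is a value of s / t
    at u when s u - t v vanishes; a value need not exist, and it is unique only where t is regular.
    So roots are handled as relations, and a submodule is replaced by its y-saturation wherever t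
    would fail to be regular on the quotient; the finite-dimensional errors made in this way are
    counted as well. *)

Definition asb (P : Prop) : bool :=
  if excluded_middle_informative P then true else false.

Lemma asbP (P : Prop) : reflect P (asb P).
Proof. by rewrite /asb; case: excluded_middle_informative => H; constructor. Qed.

Section Subspace.
Variables (K : fieldType) (n : nat) (S : 'rV[K]_n -> Prop).
Hypotheses (S0 : S 0)
  (SD : forall (c : K) (u v : 'rV[K]_n), S u -> S v -> S (c *: u + v)).

Lemma subspace_mulmx m (B : 'M[K]_(m, n)) :
  (forall i, S (row i B)) -> forall w : 'rV[K]_m, S (w *m B).
Proof.
move=> SB w; rewrite mulmx_sum_row.
apply: (big_ind S) => //.
- by move=> u v Su Sv; rewrite -[u]scale1r; apply: SD.
- by move=> i _; rewrite -[_ *: _]addr0; apply: SD.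
Qed.

(** A row-free family in [S] of maximal size spans [S]. Membership in [S] is only a proposition,
    hence the classical boolean [asb] in the search for the maximum. *)
Lemma subspace_basis :
  exists (m : nat) (B : 'M[K]_(m, n)),
    row_free B /\ forall w, S w <-> (w <= B)%MS.
Proof.
pose P m := asb (exists B : 'M[K]_(m, n), row_free B /\ forall i, S (row i B)).
have P0 : exists m, P m.
  exists 0%N; apply/asbP; exists 0; split; first by rewrite /row_free mxrank0.
  by case.
have Pn m : P m -> (m <= n)%N.
  by move=> /asbP[B [/eqP Bm _]]; rewrite -Bm; apply: rank_leq_col.
have [m /asbP[B [freeB SB]] maxm] := ex_maxnP P0 Pn.
exists m, B; split=> // w; split=> [Sw|/submxP[D ->]]; last exact: subspace_mulmx.
case: (boolP (w <= B)%MS) => // wB.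
suff /maxm : P (1 + m)%N by rewrite add1n ltnn.
apply/asbP; exists (col_mx w B); split.
  rewrite /row_free eqn_leq rank_leq_row /=.
  rewrite -addsmxE add1n -[m in m.+1](eqP freeB).
  rewrite (ltn_leqif (mxrank_leqif_sup _)); last exact: addsmxSr.
  by rewrite addsmx_sub submx_refl andbT.
move=> i; case: (splitP i) => j ij.
- have -> : i = lshift m j by apply: val_inj.
  by rewrite rowKu; have -> : row j w = w by rewrite ord1; apply/rowP => k; rewrite mxE.
- have -> : i = rshift 1 j by apply: val_inj.
  by rewrite rowKd.
Qed.

End Subspace.

Section RelativeDimension.
Variables (K : fieldType) (R : comNzRingType) (iota : {rmorphism K -> R}).
Implicit Types V : lmodType R.

Definition ksub V (A : V -> Prop) :=
  A 0 /\ forall (c : K) u v, A u -> A v -> A (iota c *: u + v).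

Definition klin V (A : V -> Prop) n (f : V -> 'rV[K]_n) :=
  forall c u v, A u -> A v -> f (iota c *: u + v) = c *: f u + f v.

(* [B] is a subspace of [A] and the quotient [A / B] has dimension [n] over
   [K]; quotients are never formed, only coordinate maps on [A]. *)
Definition rdim V (A B : V -> Prop) (n : nat) :=
  (forall u, B u -> A u) /\
  exists f : V -> 'rV[K]_n,
    [/\ klin A f, forall u, A u -> (f u = 0 <-> B u)
      & forall w, exists2 u, A u & f u = w].

Definition fdim V (A B : V -> Prop) := exists n, rdim A B n.

Section One.
Variables (V : lmodType R).
Implicit Types A B C : V -> Prop.

Lemma ksubD A u v : ksub A -> A u -> A v -> A (u + v).
Proof.
by move=> [_ AD] Au Av; rewrite -[u]scale1r -(rmorph1 iota); apply: AD.
Qed.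

Lemma ksubZ A c u : ksub A -> A u -> A (iota c *: u).
Proof. by move=> [A0 AD] Au; rewrite -[_ *: _]addr0; apply: AD. Qed.

Lemma ksubN A u : ksub A -> A u -> A (- u).
Proof.
by move=> kA Au; rewrite -scaleN1r -(rmorph1 iota) -rmorphN; apply: ksubZ.
Qed.

Lemma ksubB A u v : ksub A -> A u -> A v -> A (u - v).
Proof. by move=> kA Au Av; apply: ksubD => //; apply: ksubN. Qed.

Lemma ksub_sum A n (c : 'I_n -> K) (a : 'I_n -> V) : ksub A ->
  (forall i, A (a i)) -> A (\sum_i iota (c i) *: a i).
Proof.
move=> kA Aa; apply: (big_ind A) => [|u v Au Av|i _]; first by case: kA.
- exact: ksubD.
- exact: ksubZ.
Qed.

Lemma klin0 A n (f : V -> 'rV[K]_n) : ksub A -> klin A f -> f 0 = 0.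
Proof.
move=> [A0 _] lf; have := lf 1 0 0 A0 A0.
rewrite scale1r scaler0 addr0 => /(congr1 (fun z => z - f 0)).
by rewrite subrr addrK.
Qed.

Lemma klinD A n (f : V -> 'rV[K]_n) u v : klin A f -> A u -> A v ->
  f (u + v) = f u + f v.
Proof.
move=> lf Au Av; have := lf 1 _ _ Au Av.
by rewrite rmorph1 !scale1r.
Qed.

Lemma klin_sum A n m (f : V -> 'rV[K]_n) (c : 'I_m -> K) (a : 'I_m -> V) :
  ksub A -> klin A f -> (forall i, A (a i)) ->
  f (\sum_i iota (c i) *: a i) = \sum_i c i *: f (a i).
Proof.
move=> kA lf Aa.
suff [] : A (\sum_i iota (c i) *: a i) /\
  f (\sum_i iota (c i) *: a i) = \sum_i c i *: f (a i) by [].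
apply: (big_ind2 (fun u w => A u /\ f u = w)).
- by split; [case: kA | apply: klin0 lf].
- move=> u w u' w' [Au <-] [Au' <-]; split; first exact: ksubD.
  exact: klinD lf _ _.
- move=> i _; split; first exact: ksubZ.
  have := lf (c i) (a i) 0 (Aa i) (proj1 kA).
  by rewrite addr0 (klin0 kA lf) addr0.
Qed.

Lemma rdim_lift A n (f : V -> 'rV[K]_n) :
  ksub A -> klin A f -> (forall w, exists2 u, A u & f u = w) ->
  exists a : 'I_n -> V, (forall i, A (a i)) /\
    forall w : 'rV[K]_n, f (\sum_i iota (w 0 i) *: a i) = w.
Proof.
move=> kA lf sf.
have [a Aa fa] := fin_all_exists2 (fun i => sf (delta_mx 0 i)).
exists a; split=> // w.
rewrite (klin_sum _ kA lf Aa) [RHS]row_sum_delta; apply: eq_bigr => i _.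
by rewrite fa.
Qed.

(** [f] gives coordinates on [A / B] and [h] descends to [A / B]; the rows of [G] are the values of
    [h] at lifts of the basis vectors. *)
Lemma klin_factor A B n m (f : V -> 'rV[K]_n) (h : V -> 'rV[K]_m) :
  ksub A -> klin A f -> (forall u, A u -> (f u = 0 <-> B u)) ->
  (forall w, exists2 u, A u & f u = w) ->
  klin A h -> (forall u, A u -> B u -> h u = 0) ->
  exists G : 'M[K]_(n, m), forall u, A u -> h u = f u *m G.
Proof.
move=> kA lf kf sf lh hB.
have [a [Aa fa]] := rdim_lift kA lf sf.
exists (\matrix_i h (a i)) => u Au.
pose s := \sum_i iota (f u 0 i) *: a i.
have As : A s by apply: ksub_sum.
have Aus : A (u - s) by apply: ksubB.
have us : u = (u - s) + s by rewrite subrK.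
have fus : f (u - s) = 0.
  apply: (addIr (f s)); rewrite add0r -(klinD lf) // -us.
  by rewrite /s fa.
rewrite {1}us (klinD lh) // hB ?add0r //; last by apply/kf.
rewrite /s (klin_sum _ kA lh Aa) mulmx_sum_row; apply: eq_bigr => i _.
by rewrite rowK.
Qed.

Lemma rdim_uniq A B n m : ksub A -> rdim A B n -> rdim A B m -> n = m.
Proof.
move=> kA [BA [f [lf kf sf]]] [_ [h [lh kh sh]]].
have [G hG] := klin_factor kA lf kf sf lh (fun u Au Bu => (kh u Au).2 Bu).
have [H fH] := klin_factor kA lh kh sh lf (fun u Au Bu => (kf u Au).2 Bu).
have GH : G *m H = 1%:M.
  apply/row_matrixP => i; rewrite rowE.
  by have [u Au fu] := sf (delta_mx 0 i); rewrite mulmxA -fu -hG // -fH // fu row1.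
have HG : H *m G = 1%:M.
  apply/row_matrixP => i; rewrite rowE.
  by have [u Au fu] := sh (delta_mx 0 i); rewrite mulmxA -fu -fH // -hG // fu row1.
by apply/eqP; rewrite eqn_leq (mulmx1_min GH) (mulmx1_min HG).
Qed.

Lemma rdim_ext A A' B B' n : (forall u, A u <-> A' u) -> (forall u, B u <-> B' u) ->
  rdim A B n -> rdim A' B' n.
Proof.
move=> AA BB [BA [f [lf kf sf]]]; split=> [u /BB /BA /AA //|].
exists f; split=> [c u v /AA Au /AA Av|u /AA Au|w]; first exact: lf.
- by rewrite kf // BB.
- by have [u /AA Au <-] := sf w; exists u.
Qed.

Lemma rdim_split A B C n : ksub A -> ksub B ->
  (forall u, C u -> B u) -> (forall u, B u -> A u) -> rdim A C n ->
  exists m1 m2, [/\ rdim A B m1, rdim B C m2 & n = (m1 + m2)%N].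
Proof.
move=> kA kB CB BA [CA [f [lf kf sf]]].
pose S (w : 'rV[K]_n) := exists2 u, B u & f u = w.
have S0 : S 0 by exists 0; [case: kB | apply: klin0 lf].
have SD c u v : S u -> S v -> S (c *: u + v).
  move=> [u' Bu <-] [v' Bv <-]; exists (iota c *: u' + v').
    by apply: kB.2.
  by rewrite lf //; apply: BA.
(* The rows of [M] are a basis of the image of [B] in [A / C]. Coordinates on [B / C] are taken with
   respect to [M], those on [A / B] from a full-rank factor of the cokernel of [M]. *)
have [m [M [freeM SM]]] := subspace_basis S0 SD.
pose q := cokermx M.
have q0 w : (w *m col_base q == 0) = (w <= M)%MS.
  rewrite submxE -/q -(mulmx_free_eq0 _ (row_base_free q)) -mulmxA.
  by rewrite mulmx_base.
have rq : \rank q = (n - m)%N by rewrite mxrank_coker (eqP freeM).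
have mn : (m <= n)%N by rewrite -(eqP freeM) rank_leq_col.
exists (\rank q), m; split; last by rewrite rq subnK.
- split=> //; exists (fun u => f u *m col_base q); split.
  + by move=> c u v Au Av; rewrite lf // mulmxDl scalemxAl.
  + move=> u Au; split=> [/eqP|Bu].
      rewrite q0 => /SM[u' Bu' fu].
      have -> : u = (u - u') + u' by rewrite subrK.
      apply: ksubD => //; apply/CB/kf; first by apply: ksubB => //; apply: BA.
      rewrite -scaleN1r -(rmorph1 iota) -rmorphN addrC lf ?fu //; last exact: BA.
      by rewrite scaleN1r addNr.
    by apply/eqP; rewrite q0; apply/SM; exists u.
  + move=> w; have /row_fullP[G Gq] : row_full (col_base q) by apply: col_base_full.
    have [u Au fu] := sf (w *m G); exists u => //.
    by rewrite fu -mulmxA Gq mulmx1.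
- split=> //; exists (fun u => f u *m pinvmx M).
  have fM u : B u -> (f u <= M)%MS by move=> Bu; apply/SM; exists u.
  split.
  + by move=> c u v Bu Bv; rewrite lf ?mulmxDl ?scalemxAl //; apply: BA.
  + move=> u Bu; rewrite -kf; last exact: BA.
    split=> [|->]; last by rewrite mul0mx.
    by move=> /(congr1 (mulmx^~ M)); rewrite mulmxKpV ?fM // mul0mx.
  + move=> w; have /SM[u Bu fu] : (w *m M <= M)%MS by apply: submxMl.
    exists u => //; apply: (row_free_inj freeM).
    by rewrite mulmxKpV fu // submxMl.
Qed.

Lemma rdim_add A B C m n : ksub A -> ksub B ->
  rdim A B m -> rdim B C n -> rdim A C (m + n).
Proof.
move=> kA kB [BA [f [lf kf sf]]] [CB [g [lg kg sg]]].
have [a [Aa fa]] := rdim_lift kA lf sf.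
pose s u := \sum_i iota (f u 0 i) *: a i.
have As u : A (s u) by apply: ksub_sum.
have sB u : A u -> B (u - s u).
  move=> Au; apply/kf; first exact: ksubB.
  apply: (addIr (f (s u))); rewrite add0r -(klinD lf) ?subrK ?fa //.
  exact: ksubB.
have sD c u v : A u -> A v -> s (iota c *: u + v) = iota c *: s u + s v.
  move=> Au Av; rewrite /s scaler_sumr -big_split /=; apply: eq_bigr => i _.
  by rewrite lf // !mxE rmorphD rmorphM scalerDl scalerA.
split=> [u /CB /BA //|].
exists (fun u => row_mx (f u) (g (u - s u))); split.
- move=> c u v Au Av.
  rewrite lf // sD // opprD addrACA -scalerBr lg; try exact: sB.
  by rewrite scale_row_mx add_row_mx.
- move=> u Au; split=> [|Cu].
    rewrite -[0]row_mx0 => /eq_row_mx[fu gu].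
    have su0 : s u = 0 by rewrite /s fu big1 // => i _; rewrite mxE rmorph0 scale0r.
    by move: gu; rewrite su0 subr0; apply: (kg u _).1; apply/kf.
  have Bu := CB _ Cu.
  have fu : f u = 0 by apply/kf.
  have su0 : s u = 0 by rewrite /s fu big1 // => i _; rewrite mxE rmorph0 scale0r.
  by rewrite su0 subr0 fu (kg u Bu).2 // row_mx0.
- move=> w; have [b Bb gb] := sg (rsubmx w).
  pose u1 := \sum_i iota (lsubmx w 0 i) *: a i.
  have Au1 : A u1 by apply: ksub_sum.
  have fu1 : f u1 = lsubmx w by apply: fa.
  have Ab := BA _ Bb.
  have fb : f b = 0 by apply/kf.
  exists (u1 + b); first exact: ksubD.
  have fub : f (u1 + b) = lsubmx w by rewrite (klinD lf) // fu1 fb addr0.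
  rewrite /s fub -/u1 addrC addKr gb; exact: hsubmxK.
Qed.

Lemma rdimxx A : ksub A -> rdim A A 0.
Proof.
move=> kA; split=> //; exists (fun _ => 0); split=> //.
- by move=> c u v _ _; rewrite scaler0 addr0.
- by move=> w; exists 0; [case: kA | apply/rowP; case].
Qed.

Lemma rdim0 A B : rdim A B 0 -> forall u, A u -> B u.
Proof.
by move=> [_ [f [_ kf _]]] u Au; apply/kf => //; apply/rowP; case.
Qed.

(** [rel] induces an operator on [A / B]. Its matrix [J] satisfies [J ^ 2 = T], so
    [(\det J) ^ 2 = T ^ n], and an odd [n] would make [T] a square. *)
Lemma rdim_even (T : K) A B n (rel : V -> V -> Prop) :
  (forall c, c ^+ 2 != T) -> ksub A -> ksub B ->
  (forall u, A u -> exists2 u', A u' & rel u u') ->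
  (forall c u u' v v', rel u u' -> rel v v' ->
     rel (iota c *: u + v) (iota c *: u' + v')) ->
  (forall u u', B u -> rel u u' -> A u' -> B u') ->
  (forall u u' u'', A u -> A u' -> A u'' -> rel u u' -> rel u' u'' ->
     B (u'' - iota T *: u)) ->
  rdim A B n -> ~~ odd n.
Proof.
move=> nsq kA kB tot lin relB sq [BA [f [lf kf sf]]].
have [a [Aa fa]] := rdim_lift kA lf sf.
have [a' Aa' raa'] := fin_all_exists2 (fun i => tot (a i) (Aa i)).
have r00 : rel 0 0.
  have [u' Au' ruu'] := tot 0 kA.1.
  have := lin (-1) 0 u' 0 u' ruu' ruu'.
  by rewrite rmorphN rmorph1 !scaleN1r !addNr.
pose J := \matrix_i f (a' i).
have fJ u u' : A u -> A u' -> rel u u' -> f u' = f u *m J.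
  move=> Au Au' ruu'.
  pose s := \sum_i iota (f u 0 i) *: a i.
  pose s' := \sum_i iota (f u 0 i) *: a' i.
  have rss : rel s s'.
    apply: (big_ind2 rel) => // [v1 w1 v2 w2 r1 r2|i _].
      by have := lin 1 _ _ _ _ r1 r2; rewrite rmorph1 !scale1r.
    by have := lin (f u 0 i) _ _ _ _ (raa' i) r00; rewrite !addr0.
  have As : A s by apply: ksub_sum.
  have As' : A s' by apply: ksub_sum.
  have fus : f (u' - s') = 0.
    apply/kf; first exact: ksubB.
    apply: (relB (u - s)); last exact: ksubB.
      apply/kf; first exact: ksubB.
      apply: (addIr (f s)); rewrite add0r -(klinD lf) ?subrK ?fa //.
      exact: ksubB.
    have := lin (-1) _ _ _ _ rss ruu'.
    by rewrite rmorphN rmorph1 !scaleN1r ![- _ + _]addrC.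
  rewrite -[u'](subrK s') (klinD lf) ?fus ?add0r; try by [|exact: ksubB].
  by rewrite /s' (klin_sum _ kA lf Aa') mulmx_sum_row; apply: eq_bigr => i _; rewrite rowK.
have JJ : J *m J = T%:M.
  apply/row_matrixP => i; rewrite rowE mulmxA.
  have [u Au fu] := sf (delta_mx 0 i).
  have [u' Au' r1] := tot u Au.
  have [u'' Au'' r2] := tot u' Au'.
  rewrite -fu -(fJ u u') // -(fJ u' u'') //.
  rewrite -[u''](subrK (iota T *: u)) (klinD lf); last 2 first.
  - by apply: ksubB => //; apply: ksubZ.
  - exact: ksubZ.
  rewrite (kf _ _).2 ?add0r; last 2 first.
  - by apply: ksubB => //; apply: ksubZ.
  - exact: sq r1 r2.
  rewrite -[_ *: u]addr0 lf //; last by case: kA.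
  by rewrite (klin0 kA lf) addr0 fu rowE mul_mx_scalar.
apply/negP => oddn; have /eqP := congr1 determinant JJ.
rewrite det_mulmx det_scalar; move: (\det J) => d.
rewrite -[n]odd_double_half oddn exprS -muln2 exprM; set q := T ^+ _.
have T0 : T != 0 by have := nsq 0; rewrite expr0n /= eq_sym.
move=> /eqP E; have /eqP := nsq (d / q); apply.
by rewrite exprMn exprVn [d ^+ 2]expr2 E mulfK // !expf_neq0.
Qed.

End One.

Section Two.
Variables V V' : lmodType R.

(** Only the induced map from [A / B] to [A' / B'] has to be bijective. To carry coordinates over to
    [A'], preimages are chosen classically; the coordinates do not depend on the choice. *)
Lemma rdim_iso (h : V -> V') (A B : V -> Prop) (A' B' : V' -> Prop) n :
  (forall a u v, h (a *: u + v) = a *: h u + h v) ->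
  ksub A -> ksub A' -> ksub B' ->
  (forall u, A u -> A' (h u)) ->
  (forall u, A u -> (B' (h u) <-> B u)) -> (forall u, B u -> A u) ->
  (forall v, B' v -> A' v) ->
  (forall v, A' v -> exists2 u, A u & B' (v - h u)) ->
  rdim A B n <-> rdim A' B' n.
Proof.
move=> lh kA kA' kB' hA hB BA BA' onto.
have hD u v : h (u + v) = h u + h v by rewrite -[u]scale1r lh !scale1r.
have hNB u v : h (u - v) = h u - h v.
  by rewrite addrC -scaleN1r lh scaleN1r addrC.
split=> [[_ [f [lf kf sf]]]|[_ [f [lf kf sf]]]]; split=> //.
- have ontot v : exists u, A' v -> A u /\ B' (v - h u).
    case: (excluded_middle_informative (A' v)) => [Av|nAv]; last by exists 0.
    by have [u Au Bu] := onto v Av; exists u.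
  pose p v := proj1_sig (constructive_indefinite_description _ (ontot v)).
  have pP v : A' v -> A (p v) /\ B' (v - h (p v)).
    exact: (proj2_sig (constructive_indefinite_description _ (ontot v))).
  have fp v u : A' v -> A u -> B' (v - h u) -> f (p v) = f u.
    move=> Av Au vu; have [Ap pv] := pP v Av.
    have -> : p v = (p v - u) + u by rewrite subrK.
    have Apu : A (p v - u) by apply: ksubB.
    rewrite (klinD lf) // (kf _ Apu).2 ?add0r //.
    apply/hB => //; rewrite hNB.
    have -> : h (p v) - h u = (v - h u) - (v - h (p v)).
      by rewrite opprB [RHS]addrC addrA subrK.
    exact: ksubB.
  exists (fun v => f (p v)); split.
  + move=> c v w Av Aw; have [Apv Bv] := pP v Av; have [Apw Bw] := pP w Aw.
    rewrite -lf //; apply: fp.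
    * by apply: kA'.2.
    * by apply: kA.2.
    * by rewrite lh opprD addrACA -scalerBr; apply: kB'.2.
  + move=> v Av; have [Apv Bv] := pP v Av.
    rewrite kf // -hB //; split=> Bh.
      by rewrite -[v](subrK (h (p v))); apply: ksubD.
    by rewrite -[h _](subKr v); apply: ksubB.
  + move=> w; have [u Au fu] := sf w; exists (h u); first exact: hA.
    rewrite -fu; apply: fp => //; first exact: hA.
    by rewrite subrr; case: kB'.
- exists (fun u => f (h u)); split.
  + by move=> c u v Au Av; rewrite lh lf //; apply: hA.
  + by move=> u Au; rewrite kf ?hB //; apply: hA.
  + move=> w; have [v Av fv] := sf w; have [u Au Bvu] := onto v Av.
    exists u => //; rewrite -fv -[v](subrK (h u)) (klinD lf); last 2 first.
    * exact: BA'.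
    * exact: hA.
    by rewrite (kf _ (BA' _ Bvu)).2 ?add0r.
Qed.

(** [B] and [B'] are the two radicals of [F], so [A / B] and [A' / B'] are dual. Pairing with lifts
    of a basis of [A / B] gives the coordinates on [A' / B']. *)
Lemma rdim_dual (F : V -> V' -> K) (A B : V -> Prop) (A' B' : V' -> Prop) n :
  (forall c u v w, F (iota c *: u + v) w = c * F u w + F v w) ->
  (forall c u v w, F w (iota c *: u + v) = c * F w u + F w v) ->
  ksub A -> ksub A' -> (forall u, B u <-> A u /\ forall v, A' v -> F u v = 0) ->
  (forall v, B' v <-> A' v /\ forall u, A u -> F u v = 0) ->
  rdim A B n -> rdim A' B' n.
Proof.
move=> Fl Fr kA kA' BP BP' [BA [f [lf kf sf]]].
have [a [Aa fa]] := rdim_lift kA lf sf.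
have F0 w : F 0 w = 0.
  have := Fl 1 0 0 w; rewrite scaler0 addr0 mul1r => /(congr1 (fun z => z - F 0 w)).
  by rewrite subrr addrK.
have FD u v w : F (u + v) w = F u w + F v w.
  by have := Fl 1 u v w; rewrite rmorph1 scale1r mul1r.
have Fsum (c : 'I_n -> K) w : F (\sum_i iota (c i) *: a i) w = \sum_i c i * F (a i) w.
  apply: (big_ind2 (fun u z => F u w = z)) => // [u z u' z' <- <-|i _].
    by rewrite FD.
  by rewrite -[_ *: _]addr0 Fl F0 addr0.
have Fu u v : A u -> A' v -> F u v = \sum_i f u 0 i * F (a i) v.
  move=> Au Av; rewrite -Fsum; set s := \sum_i _.
  have As : A s by apply: ksub_sum.
  have : B (u - s).
    apply/kf; first exact: ksubB.
    apply: (addIr (f s)); rewrite add0r -(klinD lf) ?subrK ?fa //.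
    exact: ksubB.
  by move=> /BP[_ /(_ v Av) E]; rewrite -[u](subrK s) FD E add0r.
pose f' v : 'rV[K]_n := \row_i F (a i) v.
have lf' : klin A' f'.
  by move=> c u v _ _; apply/rowP => i; rewrite !mxE Fr.
split=> [v /BP'[] //|]; exists f'; split=> //.
- move=> v Av; split=> [fv0|/BP'[_ E]].
    apply/BP'; split=> // u Au; rewrite Fu // big1 // => i _.
    by have := congr1 (fun w : 'rV_n => w 0 i) fv0; rewrite !mxE => ->; rewrite mulr0.
  by apply/rowP => i; rewrite !mxE E.
- pose S w := exists2 u, A' u & f' u = w.
  have S0 : S 0 by exists 0; [case: kA' | apply: klin0 lf'].
  have SD c u v : S u -> S v -> S (c *: u + v).
    move=> [u' Bu <-] [v' Bv <-]; exists (iota c *: u' + v'); first by apply: kA'.2.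
    by rewrite lf'.
  have [m [M [freeM SM]]] := subspace_basis S0 SD.
  (* Surjectivity of the new coordinates: a linear relation [z] among them is a combination of the
     [a i] that pairs to zero with [A'], hence lies in [B]. *)
  have kM0 : kermx M^T = 0.
    apply/row_matrixP => i; rewrite row0; set z := row i _.
    have zM : z *m M^T = 0 by rewrite -row_mul mulmx_ker row0.
    rewrite -(fa z); apply/kf; first exact: ksub_sum.
    apply/BP; split=> [|v Av]; first exact: ksub_sum.
    have /SM/submxP[D fD] : S (f' v) by exists v.
    rewrite Fsum; transitivity ((z *m (f' v)^T) 0 0).
      by rewrite mxE; apply: eq_bigr => j _; rewrite !mxE.
    by rewrite fD trmx_mul mulmxA zM mul0mx mxE.
  move=> w; apply/SM; apply: submx_full.
  by rewrite /row_full -mxrank_tr -[_ == _]/(row_free _) -kermx_eq0 kM0.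
Qed.

End Two.
End RelativeDimension.

(** * The index of a quotient module *)

Section Submodule.
Variables (R : comNzRingType) (V : lmodType R).
Implicit Types A B C : V -> Prop.

Definition rsub A := A 0 /\ forall a u v, A u -> A v -> A (a *: u + v).
Definition subm A B := forall u, A u -> B u.
Definition addm A B u := exists a b, [/\ A a, B b & u = a + b].

Lemma rsubD A u v : rsub A -> A u -> A v -> A (u + v).
Proof. by move=> [_ H] Au Av; rewrite -[u]scale1r; apply: H. Qed.

Lemma rsubZ A a u : rsub A -> A u -> A (a *: u).
Proof. by move=> [H0 H] Au; rewrite -[_ *: _]addr0; apply: H. Qed.

Lemma rsubN A u : rsub A -> A u -> A (- u).
Proof. by move=> sA Au; rewrite -scaleN1r; apply: rsubZ. Qed.

Lemma rsubB A u v : rsub A -> A u -> A v -> A (u - v).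
Proof. by move=> sA Au Av; apply: rsubD => //; apply: rsubN. Qed.

Lemma rsubBl A u v : rsub A -> A (u - v) -> A u -> A v.
Proof. by move=> sA H Au; rewrite -[v](subKr u); apply: rsubB. Qed.

Lemma rsub_ksub (K : fieldType) (iota : {rmorphism K -> R}) A :
  rsub A -> ksub iota A.
Proof. by move=> [H0 H]; split=> // c u v; apply: H. Qed.

Lemma addm_rsub A B : rsub A -> rsub B -> rsub (addm A B).
Proof.
move=> sA sB; split; first by exists 0, 0; rewrite addr0; split; [case: sA|case: sB|].
move=> a _ _ [u1 [u2 [Au1 Bu2 ->]]] [v1 [v2 [Av1 Bv2 ->]]].
exists (a *: u1 + v1), (a *: u2 + v2); split; [exact: sA.2|exact: sB.2|].
by rewrite scalerDr addrACA.
Qed.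

Lemma addml A B : rsub B -> subm A (addm A B).
Proof. by move=> [B0 _] u Au; exists u, 0; rewrite addr0. Qed.

Lemma addmr A B : rsub A -> subm B (addm A B).
Proof. by move=> [A0 _] u Bu; exists 0, u; rewrite add0r. Qed.

Lemma addm_min A B C : rsub C -> subm A C -> subm B C -> subm (addm A B) C.
Proof. by move=> sC AC BC _ [a [b [/AC ? /BC ? ->]]]; apply: rsubD. Qed.

End Submodule.

#[global] Hint Resolve rsub_ksub : core.

Section Index.
Variables (K : fieldType) (T : K) (R : comNzRingType) (iota : {rmorphism K -> R}).
Hypothesis nsq : forall c, c ^+ 2 != T.
Variables (s t : R).

Local Notation rdim := (rdim iota).

(* On [B / A], where [t] is regular and [s ^+ 2 = T t ^+ 2], the operator
   [s / t] is a square root of [T]; [heart A B] is the largest part of [B / A]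
   that it preserves. *)
Definition heart (V : lmodType R) (A B : V -> Prop) (u : V) :=
  B u /\ exists2 v, B v & A (s *: u - t *: v).

Definition rooted (V : lmodType R) (A B : V -> Prop) :=
  [/\ rsub A, rsub B, subm A B, forall u, B u -> A (t *: u) -> A u
    & forall u, B u -> A ((s ^+ 2 - iota T * t ^+ 2) *: u)].

Section OneModule.
Variable V : lmodType R.
Implicit Types A B C : V -> Prop.

Lemma heart_rsub A B : rsub A -> rsub B -> rsub (heart A B).
Proof.
move=> sA sB; split.
  split; first by case: sB.
  by exists 0; [case: sB | rewrite !scaler0 subrr; case: sA].
move=> a u v [Bu [u' Bu' uu']] [Bv [v' Bv' vv']]; split; first exact: sB.2.
exists (a *: u' + v'); first exact: sB.2.
have -> : s *: (a *: u + v) - t *: (a *: u' + v')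
        = a *: (s *: u - t *: u') + (s *: v - t *: v').
  by rewrite !scalerDr scalerN !scalerA [a * s]mulrC [a * t]mulrC opprD addrACA.
exact: sA.2.
Qed.

Lemma sub_heart A B : rsub A -> rsub B -> subm A B -> subm A (heart A B).
Proof.
move=> sA sB AB u Au; split; first exact: AB.
by exists 0; [case: sB | rewrite scaler0 subr0; apply: rsubZ].
Qed.

(** Applying [s / t] twice is multiplication by [T]: the difference is killed by [t ^ 2] modulo [A],
    and [t] is regular there. *)
Lemma root_sq A B u u' u'' : rooted A B -> B u -> B u' -> B u'' ->
  A (s *: u - t *: u') -> A (s *: u' - t *: u'') -> A (u'' - iota T *: u).
Proof.
move=> [sA sB AB reg quad] Bu Bu' Bu'' r1 r2.
have BTu : B (u'' - iota T *: u) by apply: rsubB => //; apply: rsubZ.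
apply: (reg _ BTu); apply: (reg); first exact: rsubZ.
have -> : t *: (t *: (u'' - iota T *: u)) =
  (s ^+ 2 - iota T * t ^+ 2) *: u - (s *: (s *: u - t *: u') + t *: (s *: u' - t *: u'')).
  rewrite !scalerBr !scalerA scalerBl !expr2 [s * t]mulrC subrKA opprB.
  by rewrite [RHS]addrC subrKA [iota T * _]mulrC.
apply: rsubB => //; first exact: quad.
by apply: rsubD => //; apply: rsubZ.
Qed.

(** If [v] is the value of [s / t] at [u], then [T u] is its value at [v]. *)
Lemma heart_root A B u v : rooted A B -> B u -> B v -> A (s *: u - t *: v) ->
  heart A B v.
Proof.
move=> [sA sB AB reg quad] Bu Bv uv; split=> //; exists (iota T *: u).
  exact: rsubZ.
apply: reg; first by apply: rsubB => //; do ?apply: rsubZ.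
have -> : t *: (s *: v - t *: (iota T *: u)) =
  (s ^+ 2 - iota T * t ^+ 2) *: u - s *: (s *: u - t *: v).
  rewrite !scalerBr !scalerA scalerBl opprB !expr2 [s * t]mulrC.
  by rewrite [RHS]addrC subrKA [iota T * (t * t)]mulrC -mulrA.
apply: rsubB => //; first exact: quad.
exact: rsubZ.
Qed.

Lemma rooted_sub A C B : rooted A B -> rsub C -> subm A C -> subm C B -> rooted A C.
Proof.
move=> [sA sB AB reg quad] sC AC CB; split=> // u Cu; [apply: reg|apply: quad];
  exact: CB.
Qed.

Lemma root_even A B D E n : rooted A B -> rsub D -> rsub E ->
  subm A E -> subm D B -> 
  (forall u, D u -> exists2 u', D u' & A (s *: u - t *: u')) ->
  (forall u u', E u -> D u' -> A (s *: u - t *: u') -> E u') ->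
  rdim D E n -> ~~ odd n.
Proof.
move=> rAB sD sE AE DB tot stab.
have [sA sB _ _ _] := rAB.
apply: (@rdim_even _ _ _ _ T _ _ _ (fun u u' => A (s *: u - t *: u'))) => //; auto.
- move=> c u u' v v' r1 r2.
  have -> : s *: (iota c *: u + v) - t *: (iota c *: u' + v')
          = iota c *: (s *: u - t *: u') + (s *: v - t *: v').
    by rewrite !scalerDr scalerN !scalerA [_ * s]mulrC [_ * t]mulrC opprD addrACA.
  exact: sA.2.
- by move=> u u' Eu r Du'; apply: stab r.
- move=> u u' u'' Du Du' Du'' r1 r2; apply: AE.
  by apply: root_sq rAB _ _ _ r1 r2; apply: DB.
Qed.

(** Let [E] be the sum of [C] and [heart A B]. Then [B / heart C B] carries the index of [B / C].
    The quotient [E / heart A B] carries that of [C / A], because regularity of [t] on [B / C] makes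
    [heart A C] the intersection of [C] with [heart A B]. On [heart C B / E] the root [s / t] acts,
    so its dimension is even. *)
Lemma index_add A C B n : rooted A B -> rsub C -> subm A C -> subm C B ->
  (forall u, B u -> C (t *: u) -> C u) ->
  rdim B (heart A B) n ->
  exists n1 n2, [/\ rdim B (heart C B) n1, rdim C (heart A C) n2
    & odd n = odd n1 (+) odd n2].
Proof.
move=> rAB sC AC CB regC dn.
have [sA sB AB reg quad] := rAB.
have rCB : rooted C B by split=> // u Bu; apply/AC/quad.
have sD := heart_rsub sC sB; have sH := heart_rsub sA sB.
have sHC := heart_rsub sA sC.
pose E := addm C (heart A B).
have sE : rsub E by apply: addm_rsub.
have CD : subm C (heart C B) by apply: sub_heart.
have HD : subm (heart A B) (heart C B).
  by move=> u [Bu [v Bv Auv]]; split=> //; exists v => //; apply: AC.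
have CE : subm C E by apply: addml.
have HE : subm (heart A B) E by apply: addmr.
have ED : subm E (heart C B) by apply: addm_min.
have [n1 [m [d1 dm nE]]] : exists m1 m2,
  [/\ rdim B (heart C B) m1, rdim (heart C B) (heart A B) m2 & n = (m1 + m2)%N].
  by apply: rdim_split dn; auto => u [].
have [m1 [n2 [dm1 d2 mE]]] : exists m1 m2,
  [/\ rdim (heart C B) E m1, rdim E (heart A B) m2 & m = (m1 + m2)%N].
  by apply: rdim_split dm; auto.
exists n1, n2; split=> //.
- apply/(@rdim_iso _ _ iota _ _ id C (heart A C) E (heart A B)); auto.
  + move=> u Cu; split=> [[Bu [v Bv Auv]]|[_ [v Cv Auv]]].
      split=> //; exists v => //; apply: regC => //.
      apply: (rsubBl sC) (AC _ Auv) _; exact: rsubZ.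
    by split; [apply: CB|exists v => //; apply: CB].
  + by move=> u [].
  + by move=> u [c [h [Cc Hh ->]]]; exists c => //; rewrite addrC addKr.
- rewrite nE mE !oddD addbA; suff /negbTE -> : ~~ odd m1 by rewrite addbF.
  apply: (root_even rCB sD sE CE _ _ _ dm1).
  + by move=> u [].
  + move=> u [Bu [v Bv Cuv]]; exists v => //.
    exact: heart_root rCB Bu Bv Cuv.
  + move=> _ u' [c [h [Cc [Bh [h' Bh' Ahh']] ->]]] [Bu' _] r.
    have Hh' := heart_root rAB Bh Bh' Ahh'.
    exists (u' - h'), h'; split=> //; last by rewrite subrK.
    apply: regC; first exact: rsubB.
    have -> : t *: (u' - h') = s *: c + (s *: h - t *: h') - (s *: (c + h) - t *: u').
      by rewrite scalerBr scalerDr opprB [s *: c + _]addrA [RHS]addrC subrKA.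
    apply: rsubB => //; apply: rsubD => //; [exact: rsubZ|exact: AC].
Qed.

(** The variant of additivity without regularity of [t] on [B / C]: the finite codimension of [C]
    takes the place of an index. The dimension of [B / heart A C] is counted through [C] and through
    [heart A B], and [s / t] acts on [heart A B / heart A C]. *)
Lemma index_fin A C B m d : rooted A B -> rsub C -> subm A C -> subm C B ->
  rdim C (heart A C) m -> rdim B C d ->
  exists2 n, rdim B (heart A B) n & odd n = odd m (+) odd d.
Proof.
move=> rAB sC AC CB dm dd.
have [sA sB AB reg quad] := rAB.
have rAC := rooted_sub rAB sC AC CB.
have sH := heart_rsub sA sB; have sHC := heart_rsub sA sC.
have dB : rdim B (heart A C) (d + m) by apply: rdim_add dd dm; auto.
have HH : subm (heart A C) (heart A B).
  by move=> u [Cu [v Cv Auv]]; split; [apply: CB | exists v => //; apply: CB].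
have [n [e [dn de E]]] : exists m1 m2,
  [/\ rdim B (heart A B) m1, rdim (heart A B) (heart A C) m2 & (d + m = m1 + m2)%N].
  by apply: rdim_split dB; auto => u [].
exists n => //.
suff /negbTE ee : ~~ odd e.
  by rewrite addbC -oddD E oddD ee addbF.
apply: (root_even rAB sH sHC _ _ _ _ de).
- exact: sub_heart.
- by move=> u [].
- by move=> u [Bu [v Bv Auv]]; exists v => //; apply: heart_root Auv.
- move=> u u' [Cu [v Cv Auv]] [Bu' _] r.
  suff -> : u' = v + (u' - v).
    have Auv' : A (u' - v).
      apply: reg; first by apply: rsubB => //; apply: CB.
      have -> : t *: (u' - v) = (s *: u - t *: v) - (s *: u - t *: u').
        by rewrite scalerBr opprB [RHS]addrC subrKA.
      exact: rsubB.
    apply: rsubD => //; last by apply: sub_heart.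
    exact: heart_root rAC Cu Cv Auv.
  by rewrite addrC subrK.
Qed.

(** A second square root of [T], linear over [R], commutes with [s] and [t]. It therefore preserves
    [heart A B] and acts on the quotient whose dimension is the index. *)
Lemma index_even A B n (rel : V -> V -> Prop) : rooted A B ->
  (forall u, B u -> exists2 u', B u' & rel u u') ->
  (forall a u u' v v', rel u u' -> rel v v' -> rel (a *: u + v) (a *: u' + v')) ->
  (forall u u', A u -> rel u u' -> B u' -> A u') ->
  (forall u u' u'', B u -> B u' -> B u'' -> rel u u' -> rel u' u'' ->
     A (u'' - iota T *: u)) ->
  rdim B (heart A B) n -> ~~ odd n.
Proof.
move=> rAB tot lin stab sq.
have [sA sB AB reg quad] := rAB.
have sH := heart_rsub sA sB.
apply: (@rdim_even _ _ _ _ T _ _ _ rel) => //; auto.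
- move=> u u' [Bu [v Bv Auv]] r Bu'; split=> //.
  have [v' Bv' r'] := tot v Bv; exists v' => //.
  have B0 : rel 0 0.
    have [z _ r0] := tot 0 sB.1.
    have := lin (-1) _ _ _ _ r0 r0; by rewrite !scaleN1r !addNr.
  have r1 := lin s _ _ _ _ r (lin (- t) _ _ _ _ r' B0).
  rewrite !addr0 !scaleNr in r1.
  apply: stab r1 _ => //; apply: rsubB => //; exact: rsubZ.
- by move=> u u' u'' Bu Bu' Bu'' r1 r2; apply: sub_heart => //; apply: sq r1 r2.
Qed.

End OneModule.

Lemma index_iso (V V' : lmodType R) (h : V -> V') (A B : V -> Prop) (A' B' : V' -> Prop) n :
  (forall a u v, h (a *: u + v) = a *: h u + h v) ->
  rsub A -> rsub B -> rsub A' -> rsub B' -> subm A' B' ->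
  (forall u, B u -> (A' (h u) <-> A u)) ->
  (forall u, B u -> B' (h u)) ->
  (forall v, B' v -> exists2 u, B u & A' (v - h u)) ->
  rdim B (heart A B) n <-> rdim B' (heart A' B') n.
Proof.
move=> lh sA sB sA' sB' AB' hA hB onto.
have sH' := heart_rsub sA' sB'.
have h0 : h 0 = 0.
  have := lh 1 0 0; rewrite scaler0 addr0 scale1r => /(congr1 (fun z => z - h 0)).
  by rewrite subrr addrK.
have hZ a u : h (a *: u) = a *: h u by rewrite -[a *: u]addr0 lh h0 addr0.
have hNB u v : h (u - v) = h u - h v.
  by rewrite addrC -scaleN1r lh scaleN1r addrC.
apply: (rdim_iso n lh); auto.
- move=> u Bu; split=> [[_ [v Bv Auv]]|[_ [v Bv Auv]]]; split; auto.
  + have [w Bw Avw] := onto v Bv; exists w => //; apply/hA.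
      by apply: rsubB => //; apply: rsubZ.
    rewrite hNB !hZ.
    have -> : s *: h u - t *: h w = (s *: h u - t *: v) + t *: (v - h w).
      by rewrite scalerBr subrKA.
    by apply: rsubD => //; apply: rsubZ.
  + exists (h v); first exact: hB.
    rewrite -!hZ -hNB; apply/hA => //.
    by apply: rsubB => //; apply: rsubZ.
- by move=> u [].
- by move=> u [].
- move=> v Bv; have [u Bu Auv] := onto v Bv; exists u => //.
  exact: sub_heart.
Qed.

End Index.

(** * The index and the Koszul complex *)

Section Saturation.
Variables (K : fieldType) (R : comNzRingType) (iota : {rmorphism K -> R}).
Variables (y : R) (V : lmodType R).
Implicit Types A B C : V -> Prop.

Definition top (_ : V) := True.
Definition scm (a : R) (u : V) := exists v, u = a *: v.
Definition sat A u := exists m, A (y ^+ m *: u).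

Lemma top_rsub : rsub top. Proof. by split. Qed.

Lemma scm_rsub a : rsub (scm a).
Proof.
split; first by exists 0; rewrite scaler0.
move=> c _ _ [u ->] [v ->]; exists (c *: u + v).
by rewrite scalerDr !scalerA mulrC.
Qed.

Lemma sat_rsub A : rsub A -> rsub (sat A).
Proof.
move=> sA; split; first by exists 0%N; rewrite scaler0; case: sA.
move=> a u v [m Am] [n An]; exists (m + n)%N.
rewrite scalerDr exprD; apply: rsubD => //.
  have -> : (y ^+ m * y ^+ n) *: (a *: u) = (y ^+ n * a) *: (y ^+ m *: u).
    by rewrite !scalerA -mulrA mulrC.
  exact: rsubZ.
by rewrite -scalerA; apply: rsubZ.
Qed.

Lemma sub_sat A : subm A (sat A).
Proof. by move=> u Au; exists 0%N; rewrite scale1r. Qed.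

Lemma satX A j u : sat A (y ^+ j *: u) -> sat A u.
Proof. by move=> [m]; rewrite scalerA -exprD; exists (m + j)%N. Qed.

Lemma regX A j : (forall u, A (y *: u) -> A u) -> forall u, A (y ^+ j *: u) -> A u.
Proof.
move=> reg; elim: j => [|j IH] u; first by rewrite scale1r.
by rewrite exprS -scalerA => /reg /IH.
Qed.

Lemma sat_min A B : subm A B -> (forall u, B (y *: u) -> B u) -> subm (sat A) B.
Proof. by move=> AB reg u [m /AB]; apply: regX. Qed.

Lemma fdim_mono A A' B B' : ksub iota A -> ksub iota A' -> ksub iota B' ->
  subm A' A -> subm B B' -> subm B' A' -> fdim iota A B -> fdim iota A' B'.
Proof.
move=> kA kA' kB' AA BB BA [n dn].
have [m1 [m2 [_ d2 _]]] := rdim_split kA kA' (fun u Bu => BA u (BB u Bu)) AA dn.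
have [m3 [m4 [d3 _ _]]] := rdim_split kA' kB' BB BA d2.
by exists m3.
Qed.

(** The two consequences that are needed of [V / A] being finitely generated over [K[y]]: its
    [y]-power torsion has bounded exponent, and it is finite-dimensional modulo each power of
    [y]. *)
Definition tame (G c : R) := forall A, rsub A ->
  (forall u, A (G *: u)) -> (forall u, A (c *: u)) ->
  (exists m, forall u, sat A u -> A (y ^+ m *: u)) /\
  forall j, fdim iota top (addm A (scm (y ^+ j))).

(** If [y ^ m] kills the torsion [sat A / A], this torsion meets [y ^ m V] trivially in [V / A], so
    it embeds into the finite-dimensional [V / (A + y ^ m V)]. *)
Lemma sat_fdim G c A : tame G c -> rsub A ->
  (forall u, A (G *: u)) -> (forall u, A (c *: u)) -> fdim iota (sat A) A.
Proof.
move=> tm sA AG Ac; have [[m bd] fd] := tm A sA AG Ac.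
have sS := sat_rsub sA; have sAm := addm_rsub sA (scm_rsub (y ^+ m)).
have [n dn] : fdim iota (addm (sat A) (scm (y ^+ m))) (addm A (scm (y ^+ m))).
  apply: fdim_mono (fd m); auto => //.
  - by apply/rsub_ksub; apply: addm_rsub => //; apply: scm_rsub.
  - apply: addm_min; first by apply: addm_rsub => //; apply: scm_rsub.
      by move=> u Au; apply: addml; [apply: scm_rsub | apply: sub_sat].
    exact: addmr.
exists n; apply/(@rdim_iso _ _ iota V V id (sat A) A (addm (sat A) (scm (y ^+ m))) (addm A (scm (y ^+ m))) n); auto.
- by apply/rsub_ksub; apply: addm_rsub => //; apply: scm_rsub.
- exact/addml/scm_rsub.
- move=> u Su; split=> [[a [_ [Aa [w ->] uE]]]|Au]; last by apply: addml => //; apply: scm_rsub.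
  have Sw : sat A w.
    apply: (@satX A m); rewrite -[_ *: w](addKr a) -uE.
    by apply: rsubD => //; apply: rsubN => //; apply: sub_sat.
  by rewrite uE; apply: rsubD => //; apply: bd.
- exact: sub_sat.
- apply: addm_min; first by apply: addm_rsub => //; apply: scm_rsub.
    by move=> u Au; apply: addml; [apply: scm_rsub | apply: sub_sat].
  exact: addmr.
- move=> _ [a [b [Sa Sb ->]]]; exists a => //.
  by rewrite addrC addKr; apply: addmr.
Qed.

End Saturation.

Section Parity.
Variables (K : fieldType) (T : K) (R : comNzRingType) (iota : {rmorphism K -> R}).
Hypothesis nsq : forall c, c ^+ 2 != T.
Variables (y s sigma beta b G : R) (N : nat).
Hypothesis sP : exists h, s ^+ 2 - iota T * (y ^+ N) ^+ 2 = h * (beta * b).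
Hypothesis sigmaP : exists h, sigma ^+ 2 - iota T * beta ^+ 2 = h * G.

Local Notation t := (y ^+ N).
Local Notation heart1 := (heart s t).
Local Notation heart2 := (heart sigma beta).
Local Notation rdim := (rdim iota).
Local Notation tame V := (@tame K R iota y V G (beta * b)).

Section OneModule.
Variable V : lmodType R.
Implicit Types A B C : V -> Prop.

Lemma rooted1 A B : rsub A -> rsub B -> subm A B ->
  (forall u, A (y *: u) -> A u) -> (forall u, A ((beta * b) *: u)) ->
  rooted T iota s t A B.
Proof.
move=> sA sB AB reg Ab; split=> // u Bu; first exact: regX.
by have [h ->] := sP; rewrite -scalerA; apply: rsubZ.
Qed.

Lemma rooted2 A : rsub A -> (forall u, A (beta *: u) -> A u) ->
  (forall u, A (G *: u)) -> rooted T iota sigma beta A (@top _ V).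
Proof.
move=> sA reg AG; split=> // u _; first exact: reg.
by have [h ->] := sigmaP; rewrite -scalerA; apply: rsubZ.
Qed.

(** The heart contains [A + t V], since [s / t] takes [t v] to [s v]. *)
Lemma heart1_fdim A : tame V -> rsub A ->
  (forall u, A (G *: u)) -> (forall u, A ((beta * b) *: u)) ->
  exists n, rdim (@top _ V) (heart1 A (@top _ V)) n.
Proof.
move=> tm sA AG Ab; have [_ /(_ N) fd] := tm A sA AG Ab.
have sT := @top_rsub R V.
apply: fdim_mono fd => //; auto.
- exact/rsub_ksub/heart_rsub.
- apply: addm_min; [exact: heart_rsub | exact: sub_heart |].
  move=> _ [v ->]; split=> //; exists (s *: v) => //.
  by rewrite !scalerA mulrC subrr; case: sA.
Qed.

Lemma heart2_beta A u : rsub A -> heart2 A (@top _ V) (beta *: u).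
Proof.
move=> sA; split=> //; exists (sigma *: u) => //.
by rewrite !scalerA mulrC subrr; case: sA.
Qed.

(** [u] lies in the heart exactly when [sigma u] lies in [A + beta V], and [y] is assumed regular
    modulo the latter. *)
Lemma heart2_reg A : rsub A ->
  (forall u, addm A (scm beta) (y *: u) -> addm A (scm beta) u) ->
  forall u, heart2 A (@top _ V) (y *: u) -> heart2 A (@top _ V) u.
Proof.
move=> sA reg u [_ [v _ Auv]].
have [a [_ [Aa [w ->] E]]] : addm A (scm beta) (sigma *: u).
  apply: reg; exists (sigma *: (y *: u) - beta *: v), (beta *: v); split=> //.
    by exists v.
  by rewrite subrK !scalerA mulrC.
by split=> //; exists w => //; rewrite E addrK.
Qed.

End OneModule.

Variables (U W : lmodType R) (psi : W -> U) (theta : U -> W) (j : W -> W).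
Hypothesis psi_lin : forall a u v, psi (a *: u + v) = a *: psi u + psi v.
Hypothesis theta_lin : forall a u v, theta (a *: u + v) = a *: theta u + theta v.
Hypothesis j_lin : forall a u v, j (a *: u + v) = a *: j u + j v.
Hypothesis jj : forall w, j (j w) = iota T *: w.
Variables (Mu Mv : U -> Prop).
Hypotheses (sMu : rsub Mu) (sMv : rsub Mv).
Hypothesis MvG : forall u, Mv (G *: u).
Hypothesis Mv_psi : forall w, Mv (psi w) <-> exists p, w = theta p.
Hypothesis G_theta : forall p, scm G (theta p) <-> Mu p.
Definition impsi u := exists w, u = psi w.
Hypothesis Mv_codim : rdim (@top _ U) (addm impsi Mv) 1.
Hypothesis Mv_b : forall u, addm impsi Mv (b *: u).
Hypothesis Mv_beta : forall u, Mv (beta *: u) -> Mv u.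
Hypothesis G_beta : forall w : W, scm G (beta *: w) -> scm G w.
Hypothesis Mv_y : forall u, addm Mv (scm beta) (y *: u) -> addm Mv (scm beta) u.
Hypothesis G_y : forall w : W,
  addm (scm G) (scm beta) (y *: w) -> addm (scm G) (scm beta) w.
Hypotheses (tameU : tame U) (tameW : tame W).

Local Notation topU := (@top R U).
Local Notation topW := (@top R W).
Local Notation Z0 := (heart2 Mu topU).
Local Notation Y := (heart2 Mv topU).
Local Notation W0 := (heart2 (@scm R W G) topW).

Lemma lin_sub (V V' : lmodType R) (h : V -> V') :
  (forall a u v, h (a *: u + v) = a *: h u + h v) ->
  [/\ h 0 = 0, forall u v, h (u + v) = h u + h v, forall u v, h (u - v) = h u - h v
    & forall a u, h (a *: u) = a *: h u].
Proof.
move=> lh.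
have h0 : h 0 = 0.
  have := lh 1 0 0; rewrite scaler0 addr0 scale1r => /(congr1 (fun z => z - h 0)).
  by rewrite subrr addrK.
split=> // [u v|u v|a u].
- by rewrite -[u]scale1r lh !scale1r.
- by rewrite addrC -scaleN1r lh scaleN1r addrC.
- by rewrite -[a *: u]addr0 lh h0 addr0.
Qed.

(** The hypotheses say that [theta] and [psi] form an exact sequence [0 -> U / Mu -> W / G W -> U /
    Mv -> K -> 0]. The middle term has even index, and the dimension of [K] at the end is the source
    of the odd parity. *)
Theorem index_parity n m :
  rdim topU (heart1 Z0 topU) n -> rdim topU (heart1 Y topU) m ->
  odd n (+) odd m.
Proof.
move=> dZ dY.
have [psi0 psiD psiB psiZ] := lin_sub psi_lin.
have [th0 thD thB thZ] := lin_sub theta_lin.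
have [j0 jD jB jZ] := lin_sub j_lin.
have sTU : rsub topU := top_rsub _; have sTW : rsub topW := top_rsub _.
have sG : rsub (@scm R W G) by apply: scm_rsub.
have sY : rsub Y by apply: heart_rsub.
have sZ0 : rsub Z0 by apply: heart_rsub.
have sW0 : rsub W0 by apply: heart_rsub.
pose Zt w := Mv (psi w).
have sZt : rsub Zt.
  split; first by rewrite /Zt psi0; case: sMv.
  by move=> a u v; rewrite /Zt psi_lin; apply: sMv.2.
have GZt w : Zt (G *: w) by rewrite /Zt psiZ.
(* [Zt] is the kernel of [W -> U / Mv], that is, the image of [theta]. Additivity of the index needs
   [y] to be regular on the quotient of [W], whence the saturation [Ws] of [E]; [Wb] and [Wh] play
   the same roles in [U]. *)
pose E := addm Zt W0; have sE : rsub E by apply: addm_rsub.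
have ZtE : subm Zt E by apply: addml.
have W0E : subm W0 E by apply: addmr.
pose Ws := sat y E; have sWs : rsub Ws by apply: sat_rsub.
have EWs : subm E Ws by apply: sub_sat.
pose imW0 u := exists2 w, W0 w & u = psi w.
have sim : rsub imW0.
  split; first by exists 0; [case: sW0|].
  move=> a _ _ [w1 w1P ->] [w2 w2P ->]; exists (a *: w1 + w2); first exact: sW0.2.
  by rewrite psi_lin.
pose Wb := addm imW0 Mv; have sWb : rsub Wb by apply: addm_rsub.
have MvWb : subm Mv Wb by apply: addmr.
pose Wh := sat y Wb; have sWh : rsub Wh by apply: sat_rsub.
have WbWh : subm Wb Wh by apply: sub_sat.
have simp : rsub impsi.
  split; first by exists 0.
  move=> a _ _ [w1 ->] [w2 ->]; exists (a *: w1 + w2); by rewrite psi_lin.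
have rG : rooted T iota sigma beta (@scm R W G) topW.
  by apply: rooted2 => // w; exists w.
have rMv : rooted T iota sigma beta Mv topU by apply: rooted2.
have W0beta w : W0 (beta *: w) by apply: heart2_beta.
have W0b w : W0 ((beta * b) *: w) by rewrite -scalerA; apply: W0beta.
have W0G w : W0 (G *: w) by apply: sub_heart => //; exists w.
have W0y w : W0 (y *: w) -> W0 w by apply: heart2_reg.
have EG w : E (G *: w) by apply: W0E.
have Eb w : E ((beta * b) *: w) by apply: W0E.
have Wb_b u : Wb ((beta * b) *: u).
  rewrite -scalerA; have [_ [v [[w ->] Mvv ->]]] := Mv_b u.
  rewrite scalerDr; exists (psi (beta *: w)), (beta *: v).
  by split; [exists (beta *: w)|apply: rsubZ|rewrite psiZ].
have WbG u : Wb (G *: u) by apply: MvWb.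
have psiW0 w : W0 w -> Y (psi w).
  move=> [_ [v _ [z zE]]]; split=> //; exists (psi v) => //.
  by rewrite -!psiZ -psiB zE psiZ.
have Yy u : Y (y *: u) -> Y u by apply: heart2_reg.
have WhY : subm Wh Y.
  apply: sat_min => //; apply: addm_min => //; last exact: sub_heart.
  by move=> _ [w wP ->]; apply: psiW0.
have Wb_psi w : Wb (psi w) <-> E w.
  split=> [[_ [v [[w0 w0P ->] Mvv wE]]]|[z [w0 [Ztz w0P ->]]]].
    exists (w - w0), w0; split=> //; last by rewrite subrK.
    by rewrite /Zt psiB wE addrC addKr.
  by rewrite addrC psiD; exists (psi w0), (psi z); split=> //; exists w0.
have Wh_psi w : Wh (psi w) <-> Ws w.
  by split=> -[i]; [rewrite -psiZ => /Wb_psi|move=> /Wb_psi; rewrite psiZ]; exists i.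
(* The index of [W / W0] is even because of [j]. Computed through [Ws] it is
   [n + dim Ws / E + n1], since [theta] identifies the index of [E / W0] with
   that of [U / Z0]. *)
have [n0 d0] := heart1_fdim tameW sW0 W0G W0b.
have rW0 : rooted T iota s t W0 topW by apply: rooted1.
have even0 : ~~ odd n0.
  apply: (index_even nsq (rel := fun w w' => w' = j w) rW0) d0.
  - by move=> u _; exists (j u).
  - by move=> a u u' v v' -> ->; rewrite j_lin.
  - move=> u _ [_ [v _ [z zE]]] -> _; split=> //; exists (j v) => //.
    by exists (j z); rewrite -!jZ -jB zE.
  - by move=> u _ _ _ _ _ -> ->; rewrite jj subrr; case: sW0.
have [n1 [n2 [d1 d2 E012]]] : exists n1 n2, [/\ rdim topW (heart1 Ws topW) n1,
    rdim Ws (heart1 W0 Ws) n2 & odd n0 = odd n1 (+) odd n2].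
  apply: index_add d0 => //; first by move=> u /W0E /EWs.
  by move=> u _; apply: satX.
have [t0 dt] : fdim iota Ws E by apply: sat_fdim tameW _ _ _.
have dZE : rdim E (heart1 W0 E) n.
  apply/(@index_iso K R iota s t U W theta Z0 topU W0 E n theta_lin) => //.
  - move=> p _; split=> [[_ [v _ [z zE]]]|[_ [v _ pv]]]; last first.
      split=> //; exists (theta v) => //; rewrite -!thZ -thB.
      exact/G_theta.
    have : Zt (beta *: v).
      have -> : beta *: v = sigma *: theta p - G *: z by rewrite -zE opprB addrC subrK.
      apply: rsubB => //; apply: rsubZ => //; apply/Mv_psi; by exists p.
    rewrite /Zt psiZ => /Mv_beta /Mv_psi [q vq].
    split=> //; exists q => //; apply/G_theta; exists z.
    by rewrite thB !thZ -vq.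
  - by move=> p _; apply/ZtE/Mv_psi; exists p.
  - move=> _ [z [w [/Mv_psi[p ->] w0P ->]]]; exists p => //.
    by rewrite addrC addKr.
have [n2' d2' E2] : exists2 n2', rdim Ws (heart1 W0 Ws) n2' & odd n2' = odd n (+) odd t0.
  apply: (index_fin nsq _ sE _ _ dZE dt) => //.
  by apply: rooted_sub rW0 sWs _ _ => // u /W0E /EWs.
have En2 : n2' = n2 by apply: rdim_uniq d2' d2; auto.
(* The index of [U / Wh] is [m] up to an even number, since [sigma / beta] acts
   on [Y / Wh]; computed through [C] it is [n1 + dim U / C]. *)
have [n3 d3] : exists n, rdim topU (heart1 Wh topU) n.
  by apply: heart1_fdim => // u; apply: WbWh.
have rWh : rooted T iota s t Wh topU.
  by apply: rooted1 => // u; [apply: (@satX _ _ _ _ 1)|apply: WbWh].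
have [m' [n4 [dY' d4 E3]]] : exists n1 n2, [/\ rdim topU (heart1 Y topU) n1,
    rdim Y (heart1 Wh Y) n2 & odd n3 = odd n1 (+) odd n2].
  apply: index_add d3 => //.
  by move=> u _; apply: regX.
have Em : m' = m by apply: rdim_uniq dY' dY; auto.
have Wbstab u u' : Wb u -> Mv (sigma *: u - beta *: u') -> Wb u'.
  move=> [_ [v [[w w0P ->] Mvv ->]]] r.
  have [_ [w' _ ww']] := w0P.
  have w0P' : W0 w' by apply: heart_root rG _ _ ww'.
  exists (psi w'), (u' - psi w'); split; [by exists w'| |by rewrite addrC subrK].
  apply: Mv_beta.
  have -> : beta *: (u' - psi w') =
    (psi (sigma *: w - beta *: w') + sigma *: v) - (sigma *: (psi w + v) - beta *: u').
    rewrite psiB !psiZ scalerBr scalerDr opprB [_ - _ + sigma *: v]addrAC.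
    by rewrite [RHS]addrC subrKA.
  apply: rsubB => //; apply: rsubD; [done| |exact: rsubZ].
  have [z ->] := ww'; exact: GZt.
have Whstab u u' : Wh u -> Mv (sigma *: u - beta *: u') -> Wh u'.
  move=> [i Wbu] r; exists i; apply: Wbstab Wbu _.
  have -> : sigma *: (y ^+ i *: u) - beta *: (y ^+ i *: u')
          = y ^+ i *: (sigma *: u - beta *: u').
    by rewrite scalerBr !scalerA ![_ * y ^+ i]mulrC.
  exact: rsubZ.
have even4 : ~~ odd n4.
  have rWhY : rooted T iota s t Wh Y by apply: rooted_sub rWh _ _ _.
  have stot u : Y u -> exists2 u', Y u' & Mv (sigma *: u - beta *: u').
    by move=> [_ [v _ r]]; exists v => //; apply: heart_root rMv _ _ r.
  apply: (index_even nsq (rel := fun u u' => Mv (sigma *: u - beta *: u')) rWhY) d4.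
  - exact: stot.
  - move=> a u u' v v' r1 r2.
    have -> : sigma *: (a *: u + v) - beta *: (a *: u' + v')
            = a *: (sigma *: u - beta *: u') + (sigma *: v - beta *: v').
      by rewrite !scalerDr scalerN !scalerA [_ * sigma]mulrC [_ * beta]mulrC opprD addrACA.
    exact: sMv.2.
  - by move=> u u' Whu r _; apply: Whstab Whu r.
  - move=> u u' u'' _ _ _ r1 r2; apply/WbWh/MvWb.
    by apply: root_sq rMv _ _ _ r1 r2.
pose C := addm impsi Wh; have sC : rsub C by apply: addm_rsub.
have WhC : subm Wh C by apply: addmr.
have sC3 : rsub (addm impsi Mv) by apply: addm_rsub.
have C3C : subm (addm impsi Mv) C.
  apply: addm_min => //; first exact: addml.
  by move=> u /MvWb /WbWh /WhC.
have [c [e [dc de E1]]] : exists m1 m2, [/\ rdim topU C m1,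
    rdim C (addm impsi Mv) m2 & 1%N = (m1 + m2)%N].
  by apply: rdim_split Mv_codim; auto.
have d5 : rdim C (heart1 Wh C) n1.
  apply/(@index_iso K R iota s t W U psi Ws topW Wh C n1 psi_lin) => //.
  - by move=> w _; apply: addml => //; exists w.
  - by move=> _ [_ [v [[w ->] Whv ->]]]; exists w => //; rewrite addrC addKr.
have [n3' d3' E3'] : exists2 n3', rdim topU (heart1 Wh topU) n3' & odd n3' = odd n1 (+) odd c.
  by apply: (index_fin nsq rWh sC _ _ d5 dc).
have En3 : n3' = n3 by apply: rdim_uniq d3' d3; auto.
(* [sigma / beta] also acts on [Wh / Wb], whose dimension differs from
   [dim Ws / E] by [e = 1 - dim U / C]. *)
pose D u := Wh u /\ addm impsi Mv u.
have sD : rsub D.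
  split; first by split; [case: sWh | case: sC3].
  by move=> a u v [? ?] [? ?]; split; [apply: sWh.2|apply: sC3.2].
have dt' : rdim D Wb t0.
  apply/(@rdim_iso _ _ iota _ _ psi Ws E D Wb t0 psi_lin); auto.
  - move=> w Wsw; split; first exact/Wh_psi.
    by apply: addml => //; exists w.
  - move=> u Wbu; split; first exact: WbWh.
    have [_ [v [[w _ ->] Mvv ->]]] := Wbu.
    by exists (psi w), v; split=> //; exists w.
  - move=> u [Whu [_ [v [[w ->] Mvv uE]]]]; exists w.
      apply/Wh_psi; rewrite -[psi w](addrK v) -uE; apply: rsubB => //.
      exact/WbWh/MvWb.
    by rewrite uE addrC addKr; apply: MvWb.
have de' : rdim Wh D e.
  apply/(@rdim_iso _ _ iota _ _ id Wh D C (addm impsi Mv) e); auto.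
  - by move=> u Whu; split=> [|[]].
  - by move=> u [].
  - move=> _ [_ [v [[w ->] Whv ->]]]; exists v => //; rewrite addrK.
    by apply: addml => //; exists w.
have dW : rdim Wh Wb (e + t0) by apply: rdim_add de' dt'; auto.
have evenW : ~~ odd (e + t0).
  apply: (root_even nsq rMv sWh sWb MvWb _ _ _ dW) => //.
  - move=> u Whu; have [_ [v _ r]] := WhY _ Whu; exists v => //.
    exact: Whstab Whu r.
  - by move=> u u' Wbu _ r; apply: Wbstab Wbu r.
(* Modulo 2: [n1 = n + t0], [m = n1 + c], [e = t0] and [c + e = 1], so [m = n + 1]. *)
move: even0 even4 evenW (congr1 odd E1); rewrite E012 !oddD -En2 E2.
move: E3 E3'; rewrite Em En3 => ->.
by case: (odd m) (odd n4) (odd n) (odd n1) (odd c) (odd e) (odd t0) => [] [] [] [] [] [] [].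
Qed.

End Parity.

(** * The index of the transpose *)

Section Image.
Variables (R : comNzRingType) (n : nat).
Implicit Types (M : 'M[R]_n) (a c : R).
Local Notation U := ('cV[R]_n).

Definition imM M (u : U) := exists w, u = M *m w.

Lemma imM_rsub M : rsub (imM M).
Proof.
split; first by exists 0; rewrite mulmx0.
by move=> a _ _ [u ->] [v ->]; exists (a *: u + v); rewrite mulmxDr -scalemxAr.
Qed.

Lemma imM_det M u : imM M (\det M *: u).
Proof. by exists (\adj M *m u); rewrite mulmxA mul_mx_adj mul_scalar_mx. Qed.

Lemma col_lift1 a (f : U) : (forall i, exists c, f i 0 = a * c) -> exists h, f = a *: h.
Proof.
move=> /fin_all_exists[h hP]; exists (\col_i h i).
by apply/colP => i; rewrite !mxE hP.
Qed.

Lemma col_lift2 a b (f : U) : (forall i, exists c d, f i 0 = a * c + b * d) ->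
  exists h k, f = a *: h + b *: k.
Proof.
move=> /fin_all_exists[h /fin_all_exists[k hP]]; exists (\col_i h i), (\col_i k i).
by apply/colP => i; rewrite !mxE hP.
Qed.

Lemma col_lift3 a b c (f : U) :
  (forall i, exists h k l, f i 0 = a * h + b * k + c * l) ->
  exists h k l, f = a *: h + b *: k + c *: l.
Proof.
move=> /fin_all_exists[h /fin_all_exists[k /fin_all_exists[l hP]]].
exists (\col_i h i), (\col_i k i), (\col_i l i).
by apply/colP => i; rewrite !mxE hP.
Qed.

End Image.

Section Duality.
Variables (K : fieldType) (T : K) (R : comNzRingType) (iota : {rmorphism K -> R}).
Hypothesis nsq : forall c, c ^+ 2 != T.
Variables (y s sigma beta b G : R) (N : nat) (lam : R -> K).
Hypothesis sP : exists h, s ^+ 2 - iota T * (y ^+ N) ^+ 2 = h * (beta * b).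
Hypothesis sigmaP : exists h, sigma ^+ 2 - iota T * beta ^+ 2 = h * G.

Local Notation t := (y ^+ N).
Local Notation heart1 := (heart s t).
Local Notation heart2 := (heart sigma beta).
Local Notation rdim := (rdim iota).
Local Notation tame V := (@tame K R iota y V G (beta * b)).

Hypothesis G_regular : forall f, G * f = 0 -> f = 0.
Hypothesis G_beta : forall f a, beta * f = G * a -> exists c, f = G * c.
Hypothesis beta_G : forall f a, G * f = beta * a -> exists c, f = beta * c.
Hypothesis beta_t_G : forall f a c, G * f = beta * a + t * c ->
  exists a' c', f = beta * a' + t * c'.
Hypothesis G_beta_y : forall f a c, y * f = G * a + beta * c ->
  exists a' c', f = G * a' + beta * c'.
(* [lam] is a Frobenius form on the finite algebra [R / (G, beta, t)]. *)
Hypothesis lamP : forall c f h, lam (iota c * f + h) = c * lam f + lam h.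
Hypothesis lamG : forall f, lam (G * f) = 0.
Hypothesis lambeta : forall f, lam (beta * f) = 0.
Hypothesis lamt : forall f, lam (t * f) = 0.
Hypothesis lam_nondeg : forall f, (forall r, lam (r * f) = 0) ->
  exists a c d, f = G * a + beta * c + t * d.

Variable n : nat.
Local Notation U := ('cV[R]_n).
Local Notation top := (@top R U).
Implicit Types (M : 'M[R]_n) (u v p : U).
Hypothesis tameU : tame U.

Lemma G_cancel u v : G *: u = G *: v -> u = v.
Proof.
move=> E; apply/colP => i; have := congr1 (fun w : U => w i 0) E; rewrite !mxE.
by move=> /eqP; rewrite -subr_eq0 -mulrBr => /eqP /G_regular /eqP; rewrite subr_eq0 => /eqP.
Qed.

Lemma lamD f h : lam (f + h) = lam f + lam h.
Proof. by rewrite -[f]mul1r -(rmorph1 iota) lamP mul1r rmorph1 !mul1r. Qed.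

Section OneMatrix.
Variable M : 'M[R]_n.
Hypothesis detM : \det M = G.

Lemma imM_adj p u : \adj M *m p = G *: u -> p = M *m u.
Proof.
move=> E; apply: G_cancel; rewrite scalemxAr -E mulmxA mul_mx_adj detM.
by rewrite mul_scalar_mx.
Qed.

Lemma adjK u : M *m (\adj M *m u) = G *: u.
Proof. by rewrite mulmxA mul_mx_adj detM mul_scalar_mx. Qed.

Lemma adjKl u : \adj M *m (M *m u) = G *: u.
Proof. by rewrite mulmxA mul_adj_mx detM mul_scalar_mx. Qed.

Lemma imM_G u : imM M (G *: u).
Proof. by rewrite -detM; apply: imM_det. Qed.

(** [u] lies in the image of [M] exactly when [G] divides [\adj M *m u], so regularity of [beta]
    modulo [G] passes to the cokernel coordinate by coordinate. *)
Lemma imM_beta u : imM M (beta *: u) -> imM M u.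
Proof.
move=> [w E]; have {}E : beta *: (\adj M *m u) = G *: w.
  by rewrite scalemxAr E mulmxA mul_adj_mx detM mul_scalar_mx.
have [h hE] : exists h, \adj M *m u = G *: h.
  apply: col_lift1 => i; apply: (G_beta (a := w i 0)).
  by have := congr1 (fun v : U => v i 0) E; rewrite !mxE.
by exists h; apply: imM_adj.
Qed.

Local Notation Q := (imM M).
Local Notation Qb := (addm Q (scm beta)).
Local Notation Qbt := (addm Qb (scm t)).

Lemma sub_Qb : subm Q Qb. Proof. by apply: addml; apply: scm_rsub. Qed.

(** Multiply by [\adj M], cancel [y] modulo [(G, beta)] in each coordinate, return by [M], and
    cancel the resulting factor [G] modulo [beta]. *)
Lemma imM_y u : Qb (y *: u) -> Qb u.
Proof.
move=> [_ [_ [[w ->] [v ->] E]]].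
have {}E : y *: (\adj M *m u) = G *: w + beta *: (\adj M *m v).
  rewrite scalemxAr E mulmxDr -scalemxAr mulmxA mul_adj_mx detM.
  by rewrite mul_scalar_mx.
have [h [k hE]] : exists h k, \adj M *m u = G *: h + beta *: k.
  apply: col_lift2 => i; apply: (G_beta_y (a := w i 0) (c := (\adj M *m v) i 0)).
  by have := congr1 (fun v : U => v i 0) E; rewrite !mxE.
have {}hE : G *: (u - M *m h) = beta *: (M *m k).
  by rewrite scalerBr -adjK hE mulmxDr -!scalemxAr addrC addKr.
have [l lE] : exists l, u - M *m h = beta *: l.
  apply: col_lift1 => i; apply: (beta_G (a := (M *m k) i 0)).
  by have := congr1 (fun v : U => v i 0) hE; rewrite !mxE.
exists (M *m h), (beta *: l); split; [by exists h|by exists l|].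
by rewrite -lE addrC subrK.
Qed.

Lemma rsub_Qb : rsub Qb. Proof. by apply: addm_rsub; [apply: imM_rsub|apply: scm_rsub]. Qed.
Lemma rsub_Qbt : rsub Qbt. Proof. by apply: addm_rsub; [apply: rsub_Qb|apply: scm_rsub]. Qed.

(** As [\adj M / G] is the inverse of [M], this is the canonical form [v^T M^-1 p] between the
    cokernels of [M] and [M^T], made [K]-valued by [lam]. *)
Definition pairing p v := lam ((v^T *m \adj M *m p) 0 0).

(** Testing against multiples of the basis vectors puts [\adj M *m p] into [(G, beta, t)] by
    nondegeneracy of [lam]. Applying [M] and cancelling [G] modulo [(beta, t)] then yields [p]. *)
Lemma pairing_radical p : (forall v, pairing p v = 0) <-> Qbt p.
Proof.
split=> [H|[_ [_ [[_ [_ [[w ->] [u ->] ->]]] [v ->] ->]]] z]; last first.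
  rewrite /pairing -mulmxA !mulmxDr adjKl -!scalemxAr.
  by rewrite !mxE !lamD lamG lambeta lamt !addr0.
have [h [k [l hE]]] : exists h k l, \adj M *m p = G *: h + beta *: k + t *: l.
  apply: col_lift3 => i; apply: lam_nondeg => r.
  have := H (r *: delta_mx i 0); rewrite /pairing -mulmxA linearZ /= -scalemxAl.
  by rewrite trmx_delta -rowE !mxE.
have {}hE : G *: (p - M *m h) = beta *: (M *m k) + t *: (M *m l).
  by rewrite scalerBr -adjK hE !mulmxDr -!scalemxAr addrC !addrA addNr add0r.
have [l1 [l2 lE]] : exists l1 l2, p - M *m h = beta *: l1 + t *: l2.
  apply: col_lift2 => i.
  apply: (beta_t_G (a := (M *m k) i 0) (c := (M *m l) i 0)).
  by have := congr1 (fun v : U => v i 0) hE; rewrite !mxE.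
exists (M *m h + beta *: l1), (t *: l2); split; [|by exists l2|].
  by exists (M *m h), (beta *: l1); split; [exists h|exists l1|].
by rewrite -addrA -lE addrC subrK.
Qed.

Lemma pairing_lin c u v p : pairing (iota c *: u + v) p = c * pairing u p + pairing v p.
Proof. by rewrite /pairing mulmxDr -scalemxAr !mxE lamP. Qed.

Lemma pairing_linr c u v p : pairing p (iota c *: u + v) = c * pairing p u + pairing p v.
Proof.
by rewrite /pairing linearP /= !mulmxDl -!scalemxAl !mxE lamP.
Qed.

Lemma pairingZ a p v : pairing (a *: p) v = pairing p (a *: v).
Proof.
by rewrite /pairing [(a *: v)^T]linearZ /= -!scalemxAl -scalemxAr.
Qed.

End OneMatrix.

Lemma pairing_tr M p v : pairing M^T p v = pairing M v p.
Proof.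
rewrite /pairing -trmx_adj.
have -> : v^T *m (\adj M)^T *m p = (p^T *m \adj M *m v)^T.
  by rewrite !trmx_mul trmxK mulmxA.
by rewrite mxE.
Qed.

Local Notation Qb M := (addm (imM M) (scm beta)).
Local Notation Qbt M := (addm (Qb M) (scm t)).
Local Notation Z0 M := (heart2 (imM M) top).
Local Notation L M := (addm (scm sigma) (Qb M)).
Local Notation P M := (sat y (L M)).

Section OneMatrix.
Variable M : 'M[R]_n.
Hypothesis detM : \det M = G.

Let sTop : rsub top. Proof. exact: top_rsub. Qed.
Let sQ : rsub (imM M). Proof. exact: imM_rsub. Qed.
Let sQb : rsub (Qb M). Proof. exact: rsub_Qb. Qed.
Let sQbt : rsub (Qbt M). Proof. exact: rsub_Qbt. Qed.
Let sZ0 : rsub (Z0 M). Proof. exact: heart_rsub. Qed.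
Let sL : rsub (L M). Proof. by apply: addm_rsub => //; apply: scm_rsub. Qed.
Let sPM : rsub (P M). Proof. exact: sat_rsub. Qed.
Let st : rsub (@scm R U t). Proof. exact: scm_rsub. Qed.

Lemma rootedQ : rooted T iota sigma beta (imM M) top.
Proof.
by apply: (rooted2 sigmaP) => // u; [apply: imM_beta | apply: imM_G].
Qed.

Lemma QbL : subm (Qb M) (L M). Proof. by apply: addmr; apply: scm_rsub. Qed.
Lemma LP : subm (L M) (P M). Proof. exact: sub_sat. Qed.
Lemma QbG u : Qb M (G *: u).
Proof. by apply: sub_Qb; apply: imM_G. Qed.

Lemma Qb_beta u : Qb M (beta *: u).
Proof. by apply: addmr => //; exists u. Qed.

Lemma Qb_betab u : Qb M ((beta * b) *: u).
Proof. by rewrite -scalerA; apply: Qb_beta. Qed.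

Lemma QbZ0 : subm (Qb M) (Z0 M).
Proof.
apply: addm_min => //; first exact: sub_heart.
by move=> _ [v ->]; apply: heart2_beta.
Qed.

Lemma Z0y u : Z0 M (y *: u) -> Z0 M u.
Proof. by apply: heart2_reg => // v; apply: imM_y. Qed.

Lemma LZ0 : subm (L M) (Z0 M).
Proof.
apply: addm_min => //; last exact: QbZ0.
(* [sigma / beta] takes [sigma v] to [sigma ^ 2 v / beta], which is [T beta v] modulo [G]. *)
move=> _ [v ->]; split=> //; exists ((iota T * beta) *: v) => //.
rewrite !scalerA -scalerBl.
have -> : sigma * sigma - beta * (iota T * beta) = sigma ^+ 2 - iota T * beta ^+ 2.
  by rewrite !expr2 mulrCA.
have [h ->] := sigmaP; rewrite mulrC -scalerA; exact: imM_G.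
Qed.

Lemma PZ0 : subm (P M) (Z0 M).
Proof. by apply: sat_min; [exact: LZ0 | exact: Z0y]. Qed.

Lemma PyX j u : P M (y ^+ j *: u) -> P M u. Proof. exact: satX. Qed.

Lemma Qb_yX j u : Qb M (y ^+ j *: u) -> Qb M u.
Proof. by apply: regX => v; apply: imM_y. Qed.

(** Hence multiplication by [sigma] identifies [U / Z0 M] with [L M / Qb M]. This turns a quotient
    of [U] into a subobject of [U / Qb M], whose orthogonal complement can be taken. *)
Lemma Qb_sigma u : Qb M (sigma *: u) <-> Z0 M u.
Proof.
split=> [[q [_ [Qq [w ->] E]]]|[_ [w _ H]]].
  by split=> //; exists w => //; rewrite E addrK.
exists (sigma *: u - beta *: w), (beta *: w); split=> //; first by exists w.
by rewrite subrK.
Qed.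

Lemma fdim_U A : rsub A -> subm (Qbt M) A -> fdim iota top A.
Proof.
move=> sA QA; have [_ /(_ N) fd] := tameU sQb QbG Qb_betab.
by apply: fdim_mono fd; auto.
Qed.

Lemma PL_fdim : fdim iota (P M) (L M).
Proof.
apply: (sat_fdim tameU) => // u; apply: QbL; [exact: QbG|exact: Qb_betab].
Qed.

(* [P / L] carries the square root [sigma / beta] of [T]. *)
Lemma PL_even d : rdim (P M) (L M) d -> ~~ odd d.
Proof.
have Lstab u u' : L M u -> imM M (sigma *: u - beta *: u') -> L M u'.
  move=> [_ [_ [[v ->] [q [_ [Qq [w ->] ->]]] ->]]] r.
  (* The value of [sigma / beta] term by term: [sigma v] goes to [T beta v], [beta w] to [sigma w],
     and [q] is zero in the cokernel. *)
  pose w' := sigma *: w + (iota T * beta) *: v.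
  have Qw' : imM M (u' - w').
    apply: (imM_beta detM).
    have [h hE] := sigmaP.
    have -> : beta *: (u' - w') = ((sigma ^+ 2 - iota T * beta ^+ 2) *: v + sigma *: q)
       - (sigma *: (sigma *: v + (q + beta *: w)) - beta *: u').
      rewrite /w' !scalerBr !scalerDr opprD !scalerA scalerBl !expr2.
      rewrite [beta * sigma]mulrC mulrCA.
      move: (beta *: u') ((sigma * sigma) *: v) (sigma *: q) => a1 a2 a3.
      move: ((sigma * beta) *: w) ((iota T * _) *: v) => a4 a5.
      apply: (addIr (a2 + (a3 + a4) - a1)); rewrite subrK -opprD addrC subrKA.
      by rewrite opprD !addrA addrK addrAC.
    apply: rsubB => //; apply: rsubD => //; last exact: rsubZ.
    rewrite hE mulrC -scalerA; exact: imM_G.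
  rewrite -[u'](subrK w'); apply: rsubD => //; first exact/QbL/sub_Qb.
  exists (sigma *: w), ((iota T * beta) *: v); split; [by exists w| |by []].
  by rewrite mulrC -scalerA; apply: Qb_beta.
have Pstab u u' : P M u -> imM M (sigma *: u - beta *: u') -> P M u'.
  move=> [i Lu] r; exists i; apply: Lstab Lu _.
  have -> : sigma *: (y ^+ i *: u) - beta *: (y ^+ i *: u')
          = y ^+ i *: (sigma *: u - beta *: u').
    by rewrite scalerBr !scalerA ![_ * y ^+ i]mulrC.
  exact: rsubZ.
move=> dd.
apply: (root_even nsq rootedQ sPM sL _ _ _ _ dd) => //.
- by move=> u Qu; apply/QbL/sub_Qb.
- move=> u Pu; have [_ [v _ r]] := PZ0 Pu; exists v => //.
  exact: Pstab Pu r.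
- by move=> u u' Lu _ r; apply: Lstab Lu r.
Qed.

Definition tim (A : U -> Prop) u := exists2 v, A v & u = t *: v.

Lemma tim_rsub A : rsub A -> rsub (tim A).
Proof.
move=> sA; split; first by exists 0; [case: sA|rewrite scaler0].
move=> a _ _ [u Au ->] [v Av ->]; exists (a *: u + v); first exact: sA.2.
by rewrite scalerDr !scalerA mulrC.
Qed.

(* [P / L] is finite, so [P / t P] and [L / t L] have the same dimension. *)
Lemma rdim_PL_t n1 n2 : rdim (L M) (addm (Qb M) (tim (L M))) n1 ->
  rdim (P M) (addm (Qb M) (tim (P M))) n2 -> n1 = n2.
Proof.
move=> d1 d2; have [d dd] := PL_fdim.
have stP : rsub (addm (Qb M) (tim (P M))) by apply/addm_rsub/tim_rsub.
have stL : rsub (addm (Qb M) (tim (L M))) by apply/addm_rsub/tim_rsub.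
have e1 : rdim (P M) (addm (Qb M) (tim (L M))) (d + n1).
  by apply: rdim_add dd d1; auto.
(* [t] is regular modulo [Qb M], so multiplication by it copies [P / L]. The dimension of [P] modulo
   [Qb M + t L] is then counted in two ways. *)
have e2 : rdim (addm (Qb M) (tim (P M))) (addm (Qb M) (tim (L M))) d.
  apply/(@rdim_iso _ _ iota _ _ (fun u => t *: u) (P M) (L M)).
  - by move=> a u v; rewrite scalerDr !scalerA mulrC.
  - exact/rsub_ksub.
  - exact/rsub_ksub.
  - exact/rsub_ksub.
  - by move=> u Pu; apply: addmr => //; exists u.
  - move=> u Pu; split=> [[q [_ [Qq [v Lv ->] E]]]|Lu].
      rewrite -[u](subrK v); apply: rsubD => //; apply: QbL.
      by apply: (@Qb_yX N); rewrite scalerBr E addrK.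
    by apply: addmr => //; exists u.
  - exact: LP.
  - apply: addm_min => //; first by apply: addml; apply: tim_rsub.
    move=> _ [v Lv ->]; apply: addmr => //; exists v => //; exact: LP.
  - move=> _ [q [_ [Qq [v Pv ->] ->]]]; exists v => //.
    by rewrite addrK; apply: addml => //; apply: tim_rsub.
  - exact: dd.
have e3 : rdim (P M) (addm (Qb M) (tim (L M))) (n2 + d).
  by apply: rdim_add d2 e2; auto.
have := rdim_uniq (rsub_ksub iota sPM) e1 e3.
by rewrite addnC => /addIn.
Qed.

(** [P M] is saturated, so it meets [Qb M + t U] in [Qb M + t P] only. *)
Lemma rdim_P_t m : rdim (P M) (addm (Qb M) (tim (P M))) m <->
  rdim (addm (P M) (scm t)) (Qbt M) m.
Proof.
apply: (@rdim_iso _ _ iota _ _ id) => //; auto.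
- exact/rsub_ksub/addm_rsub.
- exact: addml.
- move=> u Pu; split=> [[q [_ [Qq [w ->] E]]]|[q [_ [Qq [v Pv ->] ->]]]].
    exists q, (t *: w); split=> //; exists w => //; apply: (@PyX N).
    rewrite -[_ *: w](addKr q) -E; apply: rsubD => //.
    by apply: rsubN => //; apply/LP/QbL.
  by exists q, (t *: v); split=> //; exists v.
- apply: addm_min => //; first by move=> u Qu; apply/LP/QbL.
  by move=> _ [v Pv ->]; apply: rsubZ.
- apply: addm_min; [exact/addm_rsub| |exact: addmr].
  by move=> u Qu; apply: addml => //; apply/LP/QbL.
- move=> _ [p [_ [Pp [w ->] ->]]]; exists p => //.
  by rewrite addrC addKr; apply: addmr => //; exists w.
Qed.

(** Multiplication by [sigma] identifies [U / (Z0 M + t U)] with [L / (Qb M + t L)], which has the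
    dimension of [P / (Qb M + t P)], that is, of [(P + t U) / Qbt M]. *)
Lemma rdim_balance a dP dB : rdim top (Qbt M) a ->
  rdim (addm (P M) (scm t)) (Qbt M) dP ->
  rdim (addm (Z0 M) (scm t)) (Qbt M) dB -> a = (dP + dB)%N.
Proof.
move=> da dp db.
have sZt : rsub (addm (Z0 M) (scm t)) by apply: addm_rsub.
have QZ : subm (Qbt M) (addm (Z0 M) (scm t)).
  apply: addm_min => //; last exact: addmr.
  by move=> u Qu; apply: addml => //; apply: QbZ0.
have [m1 [m2 [d1 d2 ->]]] := rdim_split (rsub_ksub iota sTop) (rsub_ksub iota sZt) QZ (fun _ _ => I) da.
rewrite (rdim_uniq (rsub_ksub iota sZt) d2 db); congr (_ + _)%N.
apply: rdim_PL_t; last exact/rdim_P_t.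
apply/(@rdim_iso _ _ iota _ _ (fun u => sigma *: u) top (addm (Z0 M) (scm t))).
- by move=> a' u v; rewrite scalerDr !scalerA mulrC.
- exact/rsub_ksub.
- exact/rsub_ksub.
- exact/rsub_ksub/addm_rsub/tim_rsub.
- by move=> u _; apply: addml => //; exists u.
- move=> u _; split=> [[q [_ [Qq [_ [_ [q' [[v ->] Qq' ->]]] ->] E]]]|].
    exists (u - t *: v), (t *: v); split; [|by exists v|by rewrite subrK].
    apply/Qb_sigma; rewrite scalerBr E scalerDr !scalerA [sigma * t]mulrC.
    by rewrite addrA addrAC addrK; apply: rsubD => //; apply: rsubZ.
  move=> [z [_ [/Qb_sigma Qz [w ->] ->]]]; rewrite scalerDr.
  exists (sigma *: z), (sigma *: (t *: w)); split=> //; exists (sigma *: w).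
    by apply: addml => //; exists w.
  by rewrite !scalerA mulrC.
- by [].
- apply: addm_min => //; first exact: QbL.
  by move=> _ [v Lv ->]; apply: rsubZ.
- move=> _ [_ [q [[v ->] Qq ->]]]; exists v => //.
  by rewrite addrC addKr; apply: addml => //; apply: tim_rsub.
- exact: d1.
Qed.

End OneMatrix.

Section Transpose.
Variable M : 'M[R]_n.
Hypothesis detM : \det M = G.

Let detMT : \det M^T = G. Proof. by rewrite det_tr. Qed.

Definition perp v := forall p, P M p -> pairing M p v = 0.

Lemma G_beta_yX i f a c : y ^+ i * f = G * a + beta * c ->
  exists a' c', f = G * a' + beta * c'.
Proof.
elim: i f a c => [|i IH] f a c; first by rewrite mul1r => ->; exists a, c.
by rewrite exprS -mulrA => /G_beta_y [a' [c' /IH]].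
Qed.

Lemma pairing_rad0 p v : Qbt M^T v -> pairing M p v = 0.
Proof.
move=> /(pairing_radical detMT) /(_ p).
by rewrite pairing_tr.
Qed.

(** For [y ^ i p] in [L M] and [v] in [Z0 M^T], moving [sigma] from the one to the other shows that
    [y ^ i v^T \adj M p] lies in [(G, beta)]. As [y] is regular modulo this ideal, already
    [v^T \adj M p] lies in it, and [lam] kills it. *)
Lemma perp_heart : subm (addm (Z0 M^T) (scm t)) perp.
Proof.
move=> _ [v [_ [Zv [w ->] ->]]] p Pp.
have lin := pairing_linr M 1 v (t *: w) p; rewrite rmorph1 scale1r mul1r in lin.
rewrite lin {lin} [X in _ + X]pairing_rad0 ?addr0; last first.
  by apply: addmr; [apply: rsub_Qb | exists w].
have [_ [v' _ [w0 w0E]]] := Zv.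
have vE : sigma *: v = M^T *m w0 + beta *: v' by rewrite -w0E subrK.
have [i [_ [_ [[a ->] [_ [_ [[c ->] [c' ->] ->]]] pE]]]] := Pp.
rewrite /pairing.
set x := (_ *m p) 0 0.
suff [a' [c1 ->]] : exists a' c', x = G * a' + beta * c'.
  by rewrite lamD lamG lambeta addr0.
apply: (@G_beta_yX i _ ((w0^T *m a) 0 0 + (v^T *m c) 0 0)
  ((v'^T *m \adj M *m a) 0 0 + (v^T *m \adj M *m c') 0 0)).
have vT : sigma *: v^T = w0^T *m M + beta *: v'^T.
  by rewrite -linearZ /= vE linearD linearZ /= trmx_mul trmxK.
have -> : y ^+ i * x = (v^T *m \adj M *m (y ^+ i *: p)) 0 0.
  by rewrite -scalemxAr mxE.
rewrite pE !mulmxDr -!scalemxAr -[v^T *m \adj M *m (M *m c)]mulmxA (adjKl detM).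
rewrite -scalemxAr !scalemxAl vT !mulmxDl -!scalemxAl -[w0^T *m M *m _]mulmxA.
rewrite mul_mx_adj detM mul_mx_scalar -!scalemxAl !mxE.
by rewrite !mulrDr addrACA.
Qed.

Lemma perp_rsub : rsub perp.
Proof.
split.
  by move=> p _; rewrite /pairing trmx0 !mul0mx mxE -(mulr0 G) lamG.
move=> a u v Hu Hv p Pp.
have -> : a *: u + v = iota 1 *: (a *: u) + v by rewrite rmorph1 scale1r.
rewrite pairing_linr -pairingZ Hu ?Hv ?mulr0 ?addr0 //.
by apply: rsubZ => //; apply: sat_rsub; apply: addm_rsub; [apply: scm_rsub|apply: rsub_Qb].
Qed.

Let sPM : rsub (P M).
Proof. by apply: sat_rsub; apply: addm_rsub; [apply: scm_rsub|apply: rsub_Qb]. Qed.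
Let sZt (M' : 'M[R]_n) : rsub (addm (Z0 M') (scm t)).
Proof.
by apply: addm_rsub; [apply: heart_rsub; [apply: imM_rsub|]|apply: scm_rsub].
Qed.
Let sPt : rsub (addm (P M) (scm t)).
Proof. by apply: addm_rsub => //; apply: scm_rsub. Qed.

(** Restricted to [P M], the pairing has left radical [P M] intersected with [Qbt M] and right
    radical [perp], so [U / perp] is dual to [(P M + t U) / Qbt M]. *)
Lemma perp_dim a dP : rdim top (Qbt M) a -> rdim (addm (P M) (scm t)) (Qbt M) dP ->
  exists m, [/\ rdim top (Qbt M^T) a, rdim perp (Qbt M^T) m & a = (dP + m)%N].
Proof.
move=> da dp.
have kT : ksub iota top by apply/rsub_ksub.
have daT : rdim top (Qbt M^T) a.
  apply: (rdim_dual (F := pairing M)) da => //; last first.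
  - move=> v; rewrite -(pairing_radical detMT); split=> [H|[_ H]].
      by split=> // u _; rewrite -pairing_tr.
    by move=> p; rewrite pairing_tr H.
  - by move=> u; rewrite -(pairing_radical detM); split=> [H|[_ H]]; [split|] => // v; apply: H.
  - by move=> c u v w; rewrite pairing_linr.
  - by move=> c u v w; rewrite pairing_lin.
have dperp : rdim top perp dP.
  apply: (rdim_dual (F := pairing M) (A := P M) (B := fun u => P M u /\ Qbt M u)) => //; last first.
  - apply/(@rdim_iso _ _ iota _ _ id (P M) _ (addm (P M) (scm t)) (Qbt M)) => //; auto.
    + by apply/rsub_ksub/rsub_Qbt.
    + by apply: addml; apply: scm_rsub.
    + by move=> u Pu; split=> [|[]].
    + by move=> u [].
    + apply: addm_min => //; last by apply: addmr.
      move=> u Qu; apply: addml; first exact: scm_rsub.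
      by apply/sub_sat/QbL.
    + move=> _ [p [_ [Pp [w ->] ->]]]; exists p => //.
      by rewrite addrC addKr; apply: addmr; [apply: rsub_Qb|exists w].
  - by move=> v; split=> [H|[_ H]] //; split.
  - by move=> u; rewrite -(pairing_radical detM); split=> -[Pu H]; split=> // v; apply: H.
  - exact/rsub_ksub.
  - by move=> c u v w; rewrite pairing_linr.
  - by move=> c u v w; rewrite pairing_lin.
have [|m1 [m2 [d1 d2 E]]] := rdim_split kT (rsub_ksub iota perp_rsub) _ (fun _ _ => I) daT.
  by move=> v Qv p _; apply: pairing_rad0.
by exists m2; split=> //; rewrite E (rdim_uniq kT d1 dperp).
Qed.

End Transpose.

(** The balance for [M] gives [perp M] the dimension [a - dP = dB], and [perp M] contains the heart
    of [M^T]. *)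
Lemma heart_le M a dB dB' : \det M = G -> rdim top (Qbt M) a ->
  rdim (addm (Z0 M) (scm t)) (Qbt M) dB ->
  rdim (addm (Z0 M^T) (scm t)) (Qbt M^T) dB' ->
  [/\ rdim (perp M) (Qbt M^T) dB, rdim top (Qbt M^T) a & (dB' <= dB)%N].
Proof.
move=> detM da db db'.
have detMT : \det M^T = G by rewrite det_tr.
have kT : ksub iota top by apply/rsub_ksub/top_rsub.
have sPM : rsub (P M).
  by apply: sat_rsub; apply: addm_rsub; [apply: scm_rsub|apply: rsub_Qb].
have sPt : rsub (addm (P M) (scm t)) by apply: addm_rsub => //; apply: scm_rsub.
have [dP dp] : fdim iota (addm (P M) (scm t)) (Qbt M).
  apply: fdim_mono (ex_intro _ a da) => //; auto.
    by apply/rsub_ksub/rsub_Qbt.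
  apply: addm_min => //; last by apply: addmr.
  move=> u Qu; apply: addml; first exact: scm_rsub.
  by apply/sub_sat/QbL.
have [m [daT dm E]] := perp_dim detM da dp.
have E' := rdim_balance detM da dp db.
have Em : m = dB by apply/eqP; rewrite -(eqn_add2l dP) -E -E'.
rewrite -Em; split=> //.
have sZ : rsub (addm (Z0 M^T) (scm t)).
  apply: addm_rsub; last exact: scm_rsub.
  by apply: heart_rsub; [apply: imM_rsub|apply: top_rsub].
have [|m1 [m2 [_ d2 ->]]] := rdim_split (rsub_ksub iota (perp_rsub M))
  (rsub_ksub iota sZ) _ (perp_heart detM) dm.
  apply: addm_min => //; last first.
    by apply: addmr; apply: heart_rsub; [apply: imM_rsub|apply: top_rsub].
  move=> u Qu; apply: addml; first exact: scm_rsub.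
  exact: QbZ0.
by rewrite (rdim_uniq (rsub_ksub iota sZ) db' d2) leq_addl.
Qed.

(* The inclusion [perp_heart] is an equality by [rdim_balance]: what the two sides
   lose for [M] and for [M^T] adds up to the same number. *)
Lemma perpE M : \det M = G -> forall v, perp M v <-> addm (Z0 M^T) (scm t) v.
Proof.
move=> detM v; have detMT : \det M^T = G by rewrite det_tr.
have sZ M' : rsub (addm (Z0 M') (scm t)).
  apply: addm_rsub; last exact: scm_rsub.
  by apply: heart_rsub; [apply: imM_rsub|apply: top_rsub].
have QZ M' : \det M' = G -> subm (Qbt M') (addm (Z0 M') (scm t)).
  move=> detM'; apply: addm_min => //; last first.
    by apply: addmr; apply: heart_rsub; [apply: imM_rsub|apply: top_rsub].
  move=> u Qu; apply: addml; first exact: scm_rsub.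
  exact: QbZ0.
have fin M' : \det M' = G -> fdim iota (addm (Z0 M') (scm t)) (Qbt M').
  move=> detM'; have [a da] := fdim_U detM' (rsub_Qbt M') (fun _ H => H).
  apply: fdim_mono (ex_intro _ a da) => //; auto.
  exact/rsub_ksub/rsub_Qbt.
have [a da] := fdim_U detM (rsub_Qbt M) (fun _ H => H).
have [dB db] := fin M detM; have [dB' db'] := fin _ detMT.
have [dm daT le1] := heart_le detM da db db'.
have [_ _ le2] : [/\ rdim (perp M^T) (Qbt M^T^T) dB', rdim top (Qbt M^T^T) a & (dB <= dB')%N].
  by apply: heart_le daT db' _ => //; rewrite trmxK.
have EB : dB' = dB by apply/eqP; rewrite eqn_leq le1.
split; last exact: perp_heart.
move: v; rewrite EB in db'.
have sp := perp_rsub M.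
have [m1 [m2 [d1 d2 E]]] := rdim_split (rsub_ksub iota sp)
  (rsub_ksub iota (sZ M^T)) (QZ _ detMT) (perp_heart detM) dm.
have : m1 = 0%N.
  by apply/eqP; rewrite -(eqn_add2r m2) add0n -E (rdim_uniq (rsub_ksub iota (sZ _)) db' d2).
by move=> m10; rewrite m10 in d1; apply: rdim0 d1.
Qed.

(** Up to the even dimension of [P / L], the index of [U / Z0 M] is that of [P / Qb M]. The form
    [pairing M (s p) v] on [P] and [U] has left radical the heart of [P / Qb M], because [P] is
    saturated, and right radical the heart of [U / Z0 M^T], because [perp M] is [Z0 M^T + t U]. *)
Theorem index_transpose M nM nT : \det M = G ->
  rdim top (heart1 (Z0 M) top) nM -> rdim top (heart1 (Z0 M^T) top) nT ->
  odd nM = odd nT.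
Proof.
move=> detM dM dT; have detMT : \det M^T = G by rewrite det_tr.
have sTop : rsub top by apply: top_rsub.
have sQ := imM_rsub M; have sQb := rsub_Qb M.
have sL : rsub (L M) by apply: addm_rsub => //; apply: scm_rsub.
have sPM : rsub (P M) by apply: sat_rsub.
have sZ0 : rsub (Z0 M) by apply: heart_rsub.
have dL : rdim (L M) (heart1 (Qb M) (L M)) nM.
  apply/(@index_iso K R iota s t _ _ (fun u => sigma *: u) (Z0 M) top (Qb M) (L M)) => //.
  - by move=> a u v; rewrite scalerDr !scalerA mulrC.
  - exact: QbL.
  - by move=> u _; apply: Qb_sigma.
  - by move=> u _; apply: addml => //; exists u.
  - by move=> _ [_ [q [[v ->] Qq ->]]]; exists v => //; rewrite addrC addKr.
have [d dPL] := PL_fdim detM.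
have rP : rooted T iota s t (Qb M) (P M).
  apply: (rooted1 sP) => //.
  - by move=> u Qu; apply/sub_sat/QbL.
  - exact: imM_y.
  - exact: Qb_betab.
have [n' dP E] : exists2 n', rdim (P M) (heart1 (Qb M) (P M)) n' & odd n' = odd nM (+) odd d.
  apply: (index_fin nsq rP sL _ _ dL dPL); [exact: QbL|exact: sub_sat].
have -> : odd nM = odd n' by rewrite E (negbTE (PL_even detM dPL)) addbF.
have d' : rdim top (heart1 (Z0 M^T) top) n'.
  apply: (rdim_dual (F := fun p v => pairing M (s *: p) v) (A := P M)) dP => //; last first.
  - move=> v; split=> [[_ [w _ Zw]]|[_ H]].
      split=> // p Pp; rewrite pairingZ; apply: perp_heart => //.
      exists (s *: v - t *: w), (t *: w); split=> //; last by rewrite subrK.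
      by exists w.
    have /(perpE detM) [z [_ [Zz [w ->] vE]]] : perp M (s *: v).
      by move=> p Pp; rewrite -pairingZ H.
    by split=> //; exists w => //; rewrite vE addrK.
  - move=> p; split=> [[Pp [w Pw Qw]]|[Pp H]].
      split=> // v _; move: v; apply/(pairing_radical detM).
      exists (s *: p - t *: w), (t *: w); split=> //; last by rewrite subrK.
      by exists w.
    split=> //; have : Qbt M (s *: p) by apply/(pairing_radical detM) => v; apply: H.
    move=> [q [_ [Qq [w ->] E1]]]; exists w; last by rewrite E1 addrK.
    apply: (@satX _ _ _ _ N); rewrite -[_ *: w](addKr q) -E1.
    apply: rsubD => //; last exact: rsubZ.
    by apply: rsubN => //; apply/sub_sat/QbL.
  - exact/rsub_ksub.
  - by move=> c u v w; rewrite pairing_linr.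
  - move=> c u v w; rewrite -pairing_lin; congr pairing.
    by rewrite scalerDr !scalerA mulrC.
by rewrite (rdim_uniq (rsub_ksub iota sTop) d' dT).
Qed.

End Duality.

(** * Division by monic polynomials *)

Import Pdiv.Ring Pdiv.CommonRing Pdiv.RingMonic.

Section MonicDivision.
Variable S : comNzRingType.
Implicit Types (I : S -> Prop) (q f h : {poly S}).

Definition ideal I := I 0 /\ forall a u v, I u -> I v -> I (a * u + v).
Definition coefI I f := forall i, I f`_i.

Lemma idealD I u v : ideal I -> I u -> I v -> I (u + v).
Proof. by move=> [_ H] Iu Iv; rewrite -[u]mul1r; apply: H. Qed.

Lemma idealM I a u : ideal I -> I u -> I (a * u).
Proof. by move=> [H0 H] Iu; rewrite -[_ * _]addr0; apply: H. Qed.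

Lemma idealN I u : ideal I -> I u -> I (- u).
Proof. by move=> idI Iu; rewrite -mulN1r; apply: idealM. Qed.

Lemma idealB I u v : ideal I -> I u -> I v -> I (u - v).
Proof. by move=> idI Iu Iv; apply: idealD => //; apply: idealN. Qed.

(** A monic polynomial is regular over the quotient by [I]. No quotient ring is formed: the leading
    coefficient of [q * f] is that of [f], and the leading term is split off. *)
Lemma coefI_monic I q f : ideal I -> q \is monic -> coefI I (q * f) -> coefI I f.
Proof.
move=> idI mq; have [n] := ubnP (size f); elim: n f => // n IH f szf Iqf.
have [->|f0] := eqVneq f 0; first by move=> i; rewrite coef0; case: idI.
have Il : I (lead_coef f).
  by have := Iqf (size (q * f)).-1; rewrite -lead_coefE lead_coef_monicM.
pose f' := f - lead_coef f *: 'X^((size f).-1).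
have If' : coefI I f'.
  apply: IH.
    rewrite -ltnS (leq_trans _ szf) // ltnS.
    have sf : (0 < size f)%N by rewrite size_poly_gt0.
    rewrite -[X in (_ < X)%N]prednK // ltnS; apply/leq_sizeP => j.
    rewrite leq_eqVlt /f' coefB coefZ coefXn => /orP[/eqP <-|lt].
      by rewrite eqxx mulr1 -lead_coefE subrr.
    rewrite (gtn_eqF lt) mulr0 subr0 nth_default //.
    by rewrite -[size f]prednK.
  move=> i; rewrite mulrBr coefB -scalerAr coefZ; apply: idealB => //.
  by rewrite mulrC; apply: idealM.
move=> i; rewrite -[f](subrK (lead_coef f *: 'X^((size f).-1))) coefD coefZ.
by apply: idealD => //; rewrite mulrC; apply: idealM.
Qed.

(** For monic [q] this is the residue of [f dX / q]: the coefficient of the remainder in degree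
    [deg q - 1]. *)
Definition topc q f := (rmodp f q)`_(size q).-2.

Lemma topcD q f h : q \is monic -> topc q (f + h) = topc q f + topc q h.
Proof. by move=> mq; rewrite /topc rmodpD // coefD. Qed.

Lemma topcZ q a f : q \is monic -> topc q (a *: f) = a * topc q f.
Proof. by move=> mq; rewrite /topc rmodpZ // coefZ. Qed.

Lemma topcM q f : q \is monic -> topc q (q * f) = 0.
Proof. by move=> mq; rewrite /topc mulrC rmodp_mull // coef0. Qed.

Lemma rmodpX_step q f j : q \is monic -> (1 < size q)%N ->
  rmodp ('X^(j.+1) * f) q = 'X * rmodp ('X^j * f) q - topc q ('X^j * f) *: q.
Proof.
move=> mq szq; rewrite exprS -mulrA -rmodp_mulmr //.
set r := rmodp ('X^j * f) q; set c := topc q _.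
have cE : c = r`_(size q).-2 by [].
have szr : (size r < size q)%N by rewrite ltn_rmodpN0 // monic_neq0.
have E : 'X * r = c%:P * q + ('X * r - c *: q) by rewrite mul_polyC addrC subrK.
rewrite {1}E rmodp_addl_mul_small //.
have sq1 : size q = (size q).-2.+2 by rewrite -subn2 -addn2 subnK.
rewrite [X in (_ < X)%N]sq1 ltnS; apply/leq_sizeP => i.
rewrite leq_eqVlt coefB coefZ coefXM => /orP[/eqP <-|lt].
  have -> : q`_(size q).-2.+1 = 1.
    by rewrite -(monicP mq) lead_coefE; congr (q`_ _); rewrite [in RHS]sq1.
  by rewrite /= mulr1 subrr.
have li : (size q <= i)%N by rewrite sq1.
have i0 : (0 < i)%N by apply: leq_trans li; apply: ltnW.
rewrite (gtn_eqF i0) [r`_ _]nth_default; last first.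
  by rewrite -ltnS prednK // (leq_trans szr).
by rewrite [q`_ _]nth_default // mulr0 subr0.
Qed.

(** Modulo [I], multiplication by [X] merely shifts the remainder, the correction being a multiple
    of a top coefficient, which lies in [I]. So every coefficient of the remainder is moved to the
    top by some power of [X]. *)
Lemma topc_nondeg I q f : ideal I -> q \is monic ->
  (forall j, I (topc q ('X^j * f))) -> coefI I (rmodp f q).
Proof.
move=> idI mq H i.
have szr : (size (rmodp f q) < size q)%N by rewrite ltn_rmodpN0 // monic_neq0.
have [li|lt] := leqP (size q).-1 i.
  rewrite nth_default; first by case: idI.
  by rewrite (leq_trans _ li) // -ltnS prednK // (leq_trans _ szr).
have szq : (1 < size q)%N by move: lt; case: (size q) => // -[].
have key j : forall l, (l + j < (size q).-1)%N ->
    I ((rmodp ('X^j * f) q)`_(l + j) - (rmodp f q)`_l).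
  elim: j => [|j IH] l lt'; first by rewrite mul1r addn0 subrr; case: idI.
  rewrite rmodpX_step // coefB coefXM coefZ addnS /= addrAC.
  apply: idealB => //; first by apply: IH; apply: ltn_trans lt'; rewrite addnS.
  by rewrite mulrC; apply: idealM.
have lti : (i <= (size q).-2)%N by rewrite -ltnS; move: lt; case: (size q) szq => // -[].
have := key ((size q).-2 - i)%N i; rewrite subnKC // => /(_ _) Hk.
have {}Hk : I (topc q ('X^((size q).-2 - i) * f) - (rmodp f q)`_i).
  by apply: Hk; case: (size q) szq => // -[].
rewrite -[_`_i](subKr (topc q ('X^((size q).-2 - i) * f))).
exact: idealB.
Qed.

Lemma coefI_mul c f : coefI (fun u => exists a, u = c * a) f ->
  exists h, f = c%:P * h.
Proof.
move=> H; have [h hP] := fin_all_exists (fun i : 'I_(size f) => H i).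
exists (\poly_(i < size f) (if insub i is Some j then h j else 0)).
apply/polyP => i; rewrite coefCM coef_poly; case: ltnP => [lt|le].
  by rewrite insubT /= -hP.
by rewrite mulr0 nth_default.
Qed.

Lemma coefI_mul2 c d f : coefI (fun u => exists a e, u = c * a + d * e) f ->
  exists h k, f = c%:P * h + d%:P * k.
Proof.
move=> H; have [h hP] := fin_all_exists (fun i : 'I_(size f) => H i).
have [k kP] := fin_all_exists hP.
exists (\poly_(i < size f) (if insub i is Some j then h j else 0)).
exists (\poly_(i < size f) (if insub i is Some j then k j else 0)).
apply/polyP => i; rewrite coefD !coefCM !coef_poly; case: ltnP => [lt|le].
  by rewrite insubT /= -kP.
by rewrite !mulr0 addr0 nth_default.
Qed.

Lemma ideal1 c : ideal (fun u => exists a, u = c * a).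
Proof.
split; first by exists 0; rewrite mulr0.
by move=> a _ _ [u ->] [v ->]; exists (a * u + v); rewrite mulrDr mulrCA.
Qed.

Lemma ideal2 c d : ideal (fun u => exists a e, u = c * a + d * e).
Proof.
split; first by exists 0, 0; rewrite !mulr0 addr0.
move=> a _ _ [u [u' ->]] [v [v' ->]]; exists (a * u + v), (a * u' + v'); ring.
Qed.

End MonicDivision.

Lemma monic_dvd_const (S : idomainType) (q f a : {poly S}) c : q \is monic -> c != 0 ->
  c%:P * f = q * a -> exists h, f = q * h.
Proof.
move=> mq c0 /(congr1 (fun p => rmodp p q)).
rewrite mul_polyC rmodpZ // mulrC rmodp_mull // => /eqP.
rewrite -mul_polyC mulf_eq0 polyC_eq0 (negPf c0) /= => /eqP r0.
by exists (rdivp f q); rewrite mulrC {1}(rdivp_eq mq f) r0 addr0.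
Qed.

(* Newton iteration for the square root of [T]; it doubles the order of
   vanishing of the error at each step. *)
Lemma sqrt_lift (K : fieldType) (R : comNzRingType) (iota : {rmorphism K -> R})
    (T : K) (u v : R) n : T != 0 -> (2%:R : K) != 0 ->
  exists s h, s ^+ 2 - iota T * (v ^+ (3 ^ n)) ^+ 2
            = h * (u ^+ 2 - iota T * v ^+ 2) ^+ (2 ^ n).
Proof.
move=> T0 two0; elim: n => [|n [s [h E]]].
  by exists u, 1; rewrite mul1r !expn0 !expr1.
pose w := v ^+ (3 ^ n); pose t := iota T * w ^+ 2; pose d := s ^+ 2 - t.
(* With [r = s / w] this is [r (3 T - r ^ 2) / (2 T)], a form of the iteration that never divides by
   [r]; its denominator [w ^ 3] explains the exponent [3 ^ n]. *)
exists (iota (2 * T)^-1 * s * (3%:R * t - s ^+ 2)).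
exists (iota (2 * T)^-1 ^+ 2 * h ^+ 2 * (d - 3%:R * t)).
rewrite expnS mulnC exprM expnS mulnC exprM -/w.
have inv : iota (2 * T)^-1 * (2%:R * iota T) = 1.
  by rewrite -(rmorph_nat iota 2) -!rmorphM mulVf ?rmorph1 // mulf_neq0.
have Ed : d = h * (u ^+ 2 - iota T * v ^+ 2) ^+ (2 ^ n) by [].
transitivity (iota (2 * T)^-1 ^+ 2 * (d - 3%:R * t) * d ^+ 2).
  have -> : iota T * (w ^+ 3) ^+ 2
          = iota (2 * T)^-1 ^+ 2 * (4%:R * t ^+ 3).
    transitivity ((iota (2 * T)^-1 * (2%:R * iota T)) ^+ 2 * (iota T * (w ^+ 3) ^+ 2)).
      by rewrite inv expr1n mul1r.
    by rewrite /t; ring.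
  by rewrite /d; ring.
rewrite Ed; ring.
Qed.

(** * The polynomials b and g *)

Section Iterated.
Variable K : fieldType.
Local Notation A1 := {poly K}.
Local Notation A2 := {poly A1}.
Local Notation R := {poly A2}.

Definition iota3 : {rmorphism K -> R} := (polyC \o polyC \o polyC)%FUN.
(** The variables are adjoined in the order [y], [x], [z], which makes [g] monic in [z] over
    [K[y][x]] and [b] monic in [x] over [K[y]]. *)
Definition yv : R := ('X%:P)%:P.
Definition xv : R := 'X%:P.
Definition zv : R := 'X.

Variable T : K.
Definition b2 : A2 := 'X ^+ 2 - (T *: 'X ^+ 2)%:P.
Definition bv : R := xv ^+ 2 - iota3 T * yv ^+ 2.
Definition gv : R := zv ^+ 2 - iota3 T * bv ^+ 2.

Lemma bvE : bv = b2%:P.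
Proof.
rewrite /bv /b2 rmorphB rmorphXn /=; congr (_ - _).
by rewrite -mul_polyC !polyCM expr2.

Qed.

Lemma monic_b2 : b2 \is monic.
Proof. exact: monicXnsubC. Qed.

Lemma monic_gv : gv \is monic.
Proof.
rewrite /gv bvE; have -> : iota3 T * b2%:P ^+ 2 = ((T%:P)%:P * b2 ^+ 2)%:P.
  by rewrite rmorphM rmorphXn.
exact: monicXnsubC.
Qed.

Variables (e k N : nat).
Hypothesis N0 : (0 < N)%N.
Local Notation G := (gv ^+ e).
Local Notation beta := (bv ^+ k).

Lemma monic_G : G \is monic. Proof. exact/monic_exp/monic_gv. Qed.
Lemma monic_beta2 : b2 ^+ k \is monic. Proof. exact/monic_exp/monic_b2. Qed.
Lemma betaE : beta = (b2 ^+ k)%:P. Proof. by rewrite bvE rmorphXn. Qed.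

(** The iterated residue of [f / (G beta y ^ N)] in [z], then [x], then [y]. *)
Definition lam3 (f : R) : K := (topc (b2 ^+ k) (topc G f))`_N.-1.

Lemma lam3P c f h : lam3 (iota3 c * f + h) = c * lam3 f + lam3 h.
Proof.
rewrite /lam3 mul_polyC topcD ?topcZ ?monic_G //.
by rewrite mul_polyC topcD ?topcZ ?monic_beta2 // coefD coefCM.
Qed.

Lemma lam3_G f : lam3 (G * f) = 0.
Proof. by rewrite /lam3 topcM ?monic_G // /topc rmod0p !coef0. Qed.

Lemma lam3_beta f : lam3 (beta * f) = 0.
Proof. by rewrite /lam3 betaE mul_polyC topcZ ?monic_G // topcM ?monic_beta2 // coef0. Qed.

Lemma lam3_t f : lam3 (yv ^+ N * f) = 0.
Proof.
rewrite /lam3 /yv -!rmorphXn /= mul_polyC topcZ ?monic_G // mul_polyC.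
by rewrite topcZ ?monic_beta2 // coefXnM prednK // leqnn.
Qed.

Lemma lam3_nondeg f : (forall r, lam3 (r * f) = 0) ->
  exists a c d, f = G * a + beta * c + yv ^+ N * d.
Proof.
move=> H.
pose I0 (u : A1) := exists a, u = 'X^N * a.
pose I1 (u : A2) := exists a c, u = b2 ^+ k * a + 'X^N%:P * c.
have idI0 : ideal I0 by apply: ideal1.
have idI1 : ideal I1 by apply: ideal2.
have H1 : coefI I1 (rmodp f G).
  apply: topc_nondeg => // [|j]; first exact: monic_G.
  set s := topc G _.
  have : coefI I0 (rmodp s (b2 ^+ k)).
    apply: topc_nondeg => // [|i]; first exact: monic_beta2.
    set w := topc _ _.
    exists (drop_poly N w); rewrite mulrC -{1}(poly_take_drop N w).
    suff -> : take_poly N w = 0 by rewrite add0r.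
    apply/polyP => m; rewrite coef_take_poly coef0; case: ltnP => // ltm.
    (* The powers of [x] and [z] are those under test, and the power of [y] moves the coefficient of
       degree [m] of [w] to degree [N - 1], which [lam3] reads off. *)
    have := H (yv ^+ (N.-1 - m) * xv ^+ i * zv ^+ j).
    rewrite /lam3 /yv /xv /zv -!polyC_exp -!mulrA mul_polyC topcZ ?monic_G //.
    rewrite [('X^i)%:P * _]mul_polyC topcZ ?monic_G // -/s mul_polyC topcZ ?monic_beta2 //.
    rewrite -/w coefXnM ltnNge leq_subr /= subKn //.
    by rewrite -ltnS prednK.
  move=> /coefI_mul[h hE].
  exists (rdivp s (b2 ^+ k)), h.
  by rewrite {1}(rdivp_eq monic_beta2 s) hE mulrC.
have [h [l hE]] := coefI_mul2 H1.
exists (rdivp f G), h, l.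
by rewrite {1}(rdivp_eq monic_G f) hE mulrC -addrA betaE /yv -!rmorphXn.
Qed.

Lemma G_regular f : G * f = 0 -> f = 0.
Proof.
by move=> /eqP; rewrite mulf_eq0 (negPf (monic_neq0 monic_G)) => /eqP.
Qed.

Lemma b2k_neq0 : b2 ^+ k != 0. Proof. exact/monic_neq0/monic_beta2. Qed.

Lemma G_dvd_beta f a : beta * f = G * a -> exists c, f = G * c.
Proof. by rewrite betaE; apply: monic_dvd_const; [exact: monic_G|exact: b2k_neq0]. Qed.

Lemma G_dvd_x f a : xv * f = G * a -> exists c, f = G * c.
Proof. by apply: monic_dvd_const; [exact: monic_G|rewrite polyX_eq0]. Qed.

Lemma beta_dvd_G f a : G * f = beta * a -> exists c, f = beta * c.
Proof.
rewrite betaE => E; apply: coefI_mul.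
apply: (coefI_monic (q := G)); [exact: ideal1|exact: monic_G|].
by rewrite E => i; exists a`_i; rewrite coefCM.
Qed.

Lemma beta_t_dvd_G f a c : G * f = beta * a + yv ^+ N * c ->
  exists a' c', f = beta * a' + yv ^+ N * c'.
Proof.
have -> : yv ^+ N = (('X^N)%:P)%:P by rewrite /yv -!rmorphXn.
rewrite betaE => E; apply: coefI_mul2.
apply: (coefI_monic (q := G)); [exact: ideal2|exact: monic_G|].
by rewrite E => i; exists a`_i, c`_i; rewrite coefD !coefCM.
Qed.

(** After reduction modulo [G] in [z], the coefficients satisfy a divisibility in [K[y][x]], where
    [y] is a nonzero constant and [b ^ k] is monic in [x]. *)
Lemma G_beta_dvd_y f a c : yv * f = G * a + beta * c ->
  exists a' c', f = G * a' + beta * c'.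
Proof.
move=> /(congr1 (fun p => rmodp p G)).
rewrite rmodpD ?monic_G // [G * a]mulrC rmodp_mull ?monic_G // add0r.
rewrite betaE /yv !mul_polyC !rmodpZ ?monic_G // => E.
have [h hE] : exists h, rmodp f G = (b2 ^+ k)%:P * h.
  apply: coefI_mul => i; apply: (@monic_dvd_const _ _ _ (rmodp c G)`_i 'X).
  - exact: monic_beta2.
  - by rewrite polyX_eq0.
  - by have := congr1 (fun p : R => p`_i) E; rewrite !coefZ.
by exists (rdivp f G), h; rewrite {1}(rdivp_eq monic_G f) hE mulrC.
Qed.

Lemma sigma_exists : T != 0 -> (2%:R : K) != 0 -> exists k' s h, 
   s ^+ 2 - iota3 T * (bv ^+ k') ^+ 2 = h * G.
Proof.
move=> T0 two0; have [s [h E]] := sqrt_lift iota3 zv bv e T0 two0.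
(* [e] doublings suffice, as [2 ^ e] is at least [e]. *)
exists (3 ^ e)%N, s, (h * gv ^+ (2 ^ e - e)).
by rewrite E -/gv -mulrA -exprD subnK // ltnW // ltn_expl.
Qed.

Lemma s_exists m : T != 0 -> (2%:R : K) != 0 -> exists N' s h, 
   (0 < N')%N /\ s ^+ 2 - iota3 T * (yv ^+ N') ^+ 2 = h * bv ^+ m.
Proof.
move=> T0 two0; have [s [h E]] := sqrt_lift iota3 xv yv m T0 two0.
exists (3 ^ m)%N, s, (h * bv ^+ (2 ^ m - m)); split; first by rewrite expn_gt0.
by rewrite E -/bv -mulrA -exprD subnK // ltnW // ltn_expl.
Qed.

End Iterated.

(** * Saturation with respect to y *)

Section Filtration.
Variables (K : fieldType) (R : comNzRingType) (iota : {rmorphism K -> R}).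
Variable V : lmodType R.
Implicit Types A : V -> Prop.

(** Each layer of the filtration by powers of [c] is the image of [V / (A + c V)] under
    multiplication by such a power. *)
Lemma fdim_pow A c m : rsub A -> fdim iota (@top R V) (addm A (scm c)) ->
  fdim iota (@top R V) (addm A (scm (c ^+ m))).
Proof.
move=> sA fd; have sT : rsub (@top R V) by apply: top_rsub.
have ss a : rsub (@scm R V a) by apply: scm_rsub.
have sAs a : rsub (addm A (scm a)) by apply: addm_rsub.
elim: m => [|m [n dn]].
  exists 0%N; apply: (rdim_ext _ _ (rdimxx (rsub_ksub iota sT))) => //.
  by move=> u; split=> // _; apply: addmr => //; exists u; rewrite scale1r.
pose B u := addm A (scm (c ^+ m.+1)) (c ^+ m *: u).
have sB : rsub B.
  split; first by rewrite /B scaler0; case: (sAs (c ^+ m.+1)).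
  move=> a u v Bu Bv; rewrite /B scalerDr scalerA mulrC -scalerA.
  by apply: (sAs _).2.
have [d dB] : fdim iota (@top R V) B.
  apply: fdim_mono fd; auto => //; apply: addm_min => //.
    by move=> u Au; apply: addml => //; apply: rsubZ.
  move=> _ [v ->]; apply: addmr => //; exists v.
  by rewrite scalerA exprSr.
have dm : rdim iota (addm A (scm (c ^+ m))) (addm A (scm (c ^+ m.+1))) d.
  apply/(@rdim_iso _ _ iota _ _ (fun u => c ^+ m *: u) (@top R V) B) => //; auto.
  - by move=> a u v; rewrite scalerDr !scalerA mulrC.
  - by move=> u _; apply: addmr => //; exists u.
  - apply: addm_min => //; first exact: addml.
    move=> _ [v ->]; apply: addmr => //; exists (c *: v).
    by rewrite scalerA exprSr.
  - move=> _ [a [_ [Aa [w ->] ->]]]; exists w => //.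
    by rewrite addrK; apply: addml.
by exists (n + d)%N; apply: rdim_add dn dm; auto.
Qed.

End Filtration.

Lemma origin_dec (K : fieldType) (p : {poly {poly {poly K}}}) : p`_0`_0`_0 = 0 ->
  exists h1 h2 h3, p = yv K * h1 + xv K * h2 + zv K * h3.
Proof.
move=> p0.
have dec (S : comNzRingType) (q : {poly S}) : q = (q`_0)%:P + 'X * drop_poly 1 q.
  apply/polyP => -[|m]; rewrite coefD coefC coefXM ?addr0 //=.
  by rewrite coef_drop_poly add0r addn1.
rewrite [p]dec [p`_0]dec [p`_0`_0]dec p0 polyC0 add0r !polyCD !polyCM.
by eexists; eexists; eexists; reflexivity.
Qed.

Section Tame.
Variables (K : fieldType) (T : K) (e k n : nat).
Local Notation A1 := {poly K}.
Local Notation A2 := {poly A1}.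
Local Notation R := {poly A2}.
Local Notation G := (gv T ^+ e).
Local Notation c := (bv T ^+ k).
Local Notation U := ('cV[R]_n).
Local Notation top := (@top R U).
Variable A : U -> Prop.
Hypotheses (sA : rsub A) (AG : forall u, A (G *: u)) (Ac : forall u, A (c *: u)).

Let ss a : rsub (@scm R U a). Proof. exact: scm_rsub. Qed.

Lemma fdim_origin : fdim (iota3 K) top
  (addm (addm (addm A (scm (yv K))) (scm (xv K))) (scm (zv K))).
Proof.
pose B := addm (addm (@scm R U (yv K)) (scm (xv K))) (scm (zv K)).
have sB : rsub B by do 2?apply: addm_rsub.
have sAB : rsub (addm (addm (addm A (scm (yv K))) (scm (xv K))) (scm (zv K))).
  by do 3?apply: addm_rsub.
have BA : subm B (addm (addm (addm A (scm (yv K))) (scm (xv K))) (scm (zv K))).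
  apply: addm_min => //; last by apply: addmr; do 2?apply: addm_rsub.
  apply: addm_min => //; last first.
    by move=> u Bu; apply: addml => //; apply: addmr => //; apply: addm_rsub.
  move=> u Bu; apply: addml => //; apply: addml => //; exact: addmr.
have st : rsub top by apply: top_rsub.
apply: (@fdim_mono _ _ _ _ top _ B) => //; auto.
pose f (u : U) : 'rV[K]_n := \row_i (u i 0)`_0`_0`_0.
exists n; split=> //; exists f; split.
- by move=> a u v _ _; apply/rowP => i; rewrite !mxE coefD coefCM coefD coefCM coefD coefCM.
- move=> u _; split=> [fu|].
    have [h1 [h2 [h3 ->]]] : exists h1 h2 h3, u = yv K *: h1 + xv K *: h2 + zv K *: h3.
      apply: col_lift3 => i.
      have fi : (u i 0)`_0`_0`_0 = 0.
        by have := congr1 (fun w : 'rV_n => w 0 i) fu; rewrite !mxE.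
      exact: origin_dec fi.
    exists (yv K *: h1 + xv K *: h2), (zv K *: h3); split=> //; last by exists h3.
    by exists (yv K *: h1), (xv K *: h2); split; [exists h1|exists h2|].
  move=> [_ [_ [[_ [_ [[u1 ->] [u2 ->] ->]]] [u3 ->] ->]]].
  apply/rowP => i; rewrite !mxE !coefD /yv /xv /zv.
  by rewrite !(coefCM, coefXM) /= !coef0 !addr0.
- move=> w; exists (\col_i iota3 K (w 0 i)) => //.
  by apply/rowP => i; rewrite !mxE !coefC.
Qed.

(** Modulo [y] the polynomial [b ^ k] becomes [x ^ (2 k)], and modulo [x] and [y] the polynomial [G]
    becomes [z ^ (2 e)]. Powers being harmless, all reduces to the quotient by [x], [y] and [z]. *)
Lemma tame_fdim j : fdim (iota3 K) top (addm A (scm (yv K ^+ j))).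
Proof.
pose A1' := addm A (scm (yv K)); pose A2' := addm A1' (scm (xv K)).
have sA1 : rsub A1' by apply: addm_rsub.
have sA2 : rsub A2' by apply: addm_rsub.
have st : rsub top by apply: top_rsub.
have AA1 : subm A A1' by apply: addml.
have A12 : subm A1' A2' by apply: addml.
have y1 u : A1' (yv K *: u) by apply: addmr => //; exists u.
have x2 u : A2' (xv K *: u) by apply: addmr => //; exists u.
have b_A2 u : A2' (bv T *: u).
  rewrite /bv !expr2 scalerBl -!scalerA; apply: rsubB => //.
  by apply: rsubZ => //; apply: A12.
apply: fdim_pow => //.
suff : fdim (iota3 K) top (addm A1' (scm (xv K ^+ (2 * k)))).
  apply: fdim_mono => //; auto; apply: addm_min => // _ [u ->].
  have E : xv K ^+ (2 * k) = c + (xv K ^+ (2 * k) - c) by rewrite addrC subrK.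
  rewrite E scalerDl; apply: rsubD => //; first exact/AA1/Ac.
  have -> : xv K ^+ (2 * k) - c
     = yv K * (iota3 K T * yv K * \sum_(i < k) (xv K ^+ 2) ^+ (k.-1 - i) * bv T ^+ i).
    rewrite exprM subrXX /bv subKr [RHS]mulrA; congr (_ * _).
      by rewrite expr2; ring.
  by rewrite -scalerA; apply: y1.
apply: fdim_pow => //.
suff : fdim (iota3 K) top (addm A2' (scm (zv K ^+ (2 * e)))).
  apply: fdim_mono => //; auto; apply: addm_min => // _ [u ->].
  have E : zv K ^+ (2 * e) = G + (zv K ^+ (2 * e) - G) by rewrite addrC subrK.
  rewrite E scalerDl; apply: rsubD => //; first exact/A12/AA1/AG.
  have -> : zv K ^+ (2 * e) - G
     = bv T * (iota3 K T * bv T * \sum_(i < e) (zv K ^+ 2) ^+ (e.-1 - i) * gv T ^+ i).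
    rewrite exprM subrXX /gv subKr [RHS]mulrA; congr (_ * _).
      by rewrite expr2; ring.
  by rewrite -scalerA; apply: b_A2.
by apply: fdim_pow => //; apply: fdim_origin.
Qed.

(* [U / A] is finitely generated over [K[y]], so its [y]-torsion is bounded. *)
Definition ysub (B : U -> Prop) :=
  B 0 /\ forall (p : A1) u v, B u -> B v -> B (p%:P%:P *: u + v).

Definition bounded (B : U -> Prop) :=
  exists m, forall u, B u -> sat (yv K) A u -> A (yv K ^+ m *: u).

Lemma ysubD B u v : ysub B -> B u -> B v -> B (u + v).
Proof. by move=> [_ H] Bu Bv; have := H 1 u v Bu Bv; rewrite !polyC1 scale1r. Qed.

Lemma ysubZ B p u : ysub B -> B u -> B (p%:P%:P *: u).
Proof. by move=> [B0 H] Bu; rewrite -[_ *: _]addr0; apply: H. Qed.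

Lemma yvX m : yv K ^+ m = ('X^m)%:P%:P.
Proof. by rewrite /yv -!polyC_exp. Qed.

(** Adjoining one generator [w] adds at most the torsion of [K[y] / I], where [I] is the ideal of
    those [p] with [p w] in [B]. *)
Lemma bounded_step B w : ysub B -> subm A B -> bounded B ->
  bounded (fun u => exists p : A1, B (u - p%:P%:P *: w)).
Proof.
move=> yB AB [m bd].
pose I (p : A1) := B (p%:P%:P *: w).
have yBB u v : B u -> B v -> B (u - v).
  move=> Bu Bv; rewrite addrC.
  by have := yB.2 (-1) v u Bv Bu; rewrite !polyCN !polyC1 scaleN1r.
have ID p q : I p -> I q -> I (p + q).
  by move=> Ip Iq; rewrite /I !polyCD scalerDl; apply: ysubD.
have IM p q : I q -> I (p * q).
  by move=> Iq; rewrite /I !polyCM -scalerA; apply: ysubZ.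
have [m' bI] : exists m', forall p i, I ('X^i * p) -> I ('X^m' * p).
  case: (excluded_middle_informative (exists2 q, q != 0 & I q)) => [[q q0 Iq]|no].
    (* The gcd of [y ^ i] and [q] is a power of [y], up to a unit, of degree at most that of [q];
       this bounds the exponent independently of [i]. *)
    exists (size q) => p i Ip.
    pose d := gcdp 'X^i q.
    have [[u v] /eqpP[[c1 c2] /andP[/= c10 c20] uvE]] := Bezoutp ('X^i) q.
    have Id : I (d * p).
      have -> : d * p = c2^-1 *: ((c1 *: (u * 'X^i + v * q)) * p).
        by rewrite uvE -scalerAl scalerA mulVf // scale1r.
      rewrite -[c2^-1 *: _]mul_polyC; apply: (IM); rewrite -scalerAl -[c1 *: _]mul_polyC; apply: (IM).
      rewrite mulrDl -!mulrA [q * p]mulrC; apply: ID; first exact: IM.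
      by do 2!apply: (IM).
    have : d %| 'X^(size q).
      have /dvdp_exp_XsubCP[j ji dj] : (d %| ('X - 0%:P) ^+ i)%R by rewrite subr0 dvdp_gcdl.
      rewrite subr0 in dj; rewrite (eqp_dvdl _ dj) dvdp_exp2l // ltnW //.
      have := dvdp_leq q0 (dvdp_gcdr 'X^i q).
      by rewrite (eqp_size dj) size_polyXn.
    move=> /dvdpP[r ->]; rewrite -mulrA; exact: IM.
  exists 0%N => p i Ip; rewrite mul1r.
  case: (eqVneq ('X^i * p) 0) => [/eqP|nz]; last by case: no; exists ('X^i * p).
  rewrite mulf_eq0 expf_eq0 polyX_eq0 andbF /= => /eqP ->.
  by rewrite /I !polyC0 scale0r; case: yB.
exists (m' + m)%N => u [p Bup] [i Au].
have Bu' : I ('X^i * p).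
  rewrite /I !polyCM -scalerA -yvX.
  have -> : yv K ^+ i *: (p%:P%:P *: w)
    = yv K ^+ i *: u - yv K ^+ i *: (u - p%:P%:P *: w) by rewrite scalerBr subKr.
  by apply: yBB; [apply: AB|rewrite yvX; apply: ysubZ].
have {}Bu' := bI _ _ Bu'.
have Bm : B (yv K ^+ m' *: u).
  rewrite -[u](subrK (p%:P%:P *: w)) scalerDr; apply: ysubD => //.
    by rewrite yvX; apply: ysubZ.
  by move: Bu'; rewrite /I !polyCM -scalerA yvX.
rewrite addnC exprD -scalerA; apply: bd => //.
exists i; rewrite scalerA mulrC -scalerA; exact: rsubZ.
Qed.

Fixpoint spanl (l : seq U) : U -> Prop :=
  if l is w :: l' then fun u => exists p : A1, spanl l' (u - p%:P%:P *: w)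
  else A.

Lemma spanl_ysub l : ysub (spanl l).
Proof.
elim: l => [|w l IH] /=; first by split=> [|p u v Au Av]; [case: sA|apply: sA.2].
split; first by exists 0; rewrite !polyC0 scale0r subr0; case: IH.
move=> p u v [q Hq] [r Hr]; exists (p * q + r).
have -> : p%:P%:P *: u + v - (p * q + r)%:P%:P *: w
  = p%:P%:P *: (u - q%:P%:P *: w) + (v - r%:P%:P *: w).
  by rewrite !polyCD !polyCM scalerDl opprD scalerBr scalerA addrACA.
exact: IH.2.
Qed.

Lemma spanl_sub l : subm A (spanl l).
Proof.
elim: l => [|w l IH] u Au //=; exists 0; rewrite !polyC0 scale0r subr0.
exact: IH.
Qed.

Lemma spanl_bounded l : bounded (spanl l).
Proof.
elim: l => [|w l IH]; first by exists 0%N => u Au _; rewrite scale1r.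
by apply: bounded_step => //; [apply: spanl_ysub|apply: spanl_sub].
Qed.

Lemma spanl_mem l w : w \in l -> spanl l w.
Proof.
elim: l => //= w' l IH; rewrite inE => /orP[/eqP <-|/IH H].
  by exists 1; rewrite !polyC1 scale1r subrr; case: (spanl_ysub l).
by exists 0; rewrite !polyC0 scale0r subr0.
Qed.

Definition ygens : seq U :=
  [seq (('X^(ij.1))%:P * 'X^(ij.2)) *: (delta_mx r 0 : U) |
     r <- enum 'I_n,
     ij <- [seq (i, j) | i <- iota 0 (size (b2 T ^+ k)), j <- iota 0 (size G)]].

Lemma spanl_sum l m (F : 'I_m -> U) : (forall i, spanl l (F i)) ->
  spanl l (\sum_i F i).
Proof.
move=> H; apply: (big_ind (spanl l)) => //; first by case: (spanl_ysub l).
by move=> u v; apply: ysubD; apply: spanl_ysub.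
Qed.

Lemma poly_sum_coef (S : nzRingType) (p : {poly S}) m : (size p <= m)%N ->
  p = \sum_(i < m) (p`_i)%:P * 'X^i.
Proof.
move=> szp; rewrite -[LHS](coefK p) poly_def (big_ord_widen m (fun i => p`_i *: 'X^i)) //.
rewrite big_mkcond; apply: eq_bigr => i _; rewrite mul_polyC.
by case: ltnP => // le; rewrite nth_default ?scale0r.
Qed.

(** Dividing each coordinate by [G] in [z], and the coefficients of the remainder by [b ^ k] in [x],
    leaves finitely many monomials with coefficients in [K[y]]. *)
Lemma ygens_span u : spanl ygens u.
Proof.
have -> : u = \sum_r u r 0 *: delta_mx r 0.
  apply/colP => i; rewrite summxE (bigD1 i) //= !mxE !eqxx mulr1.
  by rewrite big1 ?addr0 // => j /negPf ji; rewrite !mxE eq_sym ji mulr0.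
apply: spanl_sum => r; move: (u r 0) => f.
have yS := spanl_ysub ygens.
rewrite (rdivp_eq (monic_G T e) f) scalerDl; apply: (ysubD yS).
  by apply: spanl_sub; rewrite mulrC -scalerA; apply: AG.
have szr : (size (rmodp f G) <= size G)%N.
  by rewrite ltnW // ltn_rmodpN0 // monic_neq0 // monic_G.
rewrite (poly_sum_coef szr) scaler_suml; apply: spanl_sum => l.
move: (_`_l) => h.
rewrite {1}(rdivp_eq (monic_beta2 T k) h) polyCD mulrDl scalerDl; apply: (ysubD yS).
  apply: spanl_sub; rewrite polyCM -betaE mulrAC mulrC -scalerA; exact: Ac.
have szh : (size (rmodp h (b2 T ^+ k)) <= size (b2 T ^+ k))%N.
  by rewrite ltnW // ltn_rmodpN0 // monic_neq0 // monic_beta2.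
rewrite (poly_sum_coef szh) rmorph_sum /= mulr_suml scaler_suml.
apply: spanl_sum => i; rewrite polyCM -mulrA -scalerA; apply: (ysubZ _ yS).
apply: spanl_mem; apply/allpairsP; exists (r, (val i, val l)).
rewrite mem_enum; split=> //; apply/allpairsP; exists (val i, val l).
by rewrite !mem_iota !ltn_ord.
Qed.

Lemma tame_bounded : exists m, forall u, sat (yv K) A u -> A (yv K ^+ m *: u).
Proof.
have [m bd] := spanl_bounded ygens; exists m => u; apply: bd.
exact: ygens_span.
Qed.

End Tame.

(** * The row (x, y, z) is not completable *)

Section ThreeByThree.
Variable R : comNzRingType.

Definition i0 : 'I_3 := ord0.
Definition i1 : 'I_3 := lift ord0 ord0.
Definition i2 : 'I_3 := lift ord0 (lift ord0 ord0).

Lemma sum3 (V : nmodType) (F : 'I_3 -> V) : \sum_i F i = F i0 + F i1 + F i2.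
Proof. by rewrite !big_ord_recl big_ord0 addr0 addrA. Qed.

Lemma ord3 (P : 'I_3 -> Prop) : P i0 -> P i1 -> P i2 -> forall i, P i.
Proof.
move=> P0 P1 P2 i; case: (unliftP ord0 i) => [j|] -> //.
case: (unliftP ord0 j) => [l|] -> //.
by have -> : l = ord0 by apply: val_inj; case: l => -[].
Qed.

Lemma det3 (M : 'M[R]_3) : \det M =
  M i0 i0 * (M i1 i1 * M i2 i2 - M i2 i1 * M i1 i2)
  - M i1 i0 * (M i0 i1 * M i2 i2 - M i2 i1 * M i0 i2)
  + M i2 i0 * (M i0 i1 * M i1 i2 - M i1 i1 * M i0 i2).
Proof.
rewrite (expand_det_col _ ord0) sum3 /cofactor.
do 3!rewrite (expand_det_col _ ord0) !big_ord_recl big_ord0 /cofactor !det_mx11 !mxE /=.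
have e1 : lift i1 ord0 = i0 by apply: val_inj.
have e2 : lift i1 (lift ord0 ord0 : 'I_2) = i2 by apply: val_inj.
have e3 : lift i2 ord0 = i0 by apply: val_inj.
have e4 : lift i2 (lift ord0 ord0 : 'I_2) = i1 by apply: val_inj.
have e5 : lift (lift ord0 ord0 : 'I_2) ord0 = ord0 :> 'I_2 by apply: val_inj.
rewrite !e5 e1 e2 e3 e4.
by rewrite -/i0 -/i1 -/i2 /bump /=; ring.
Qed.

Definition cross (r p : 'cV[R]_3) : 'cV[R]_3 := \col_i
  [:: r i1 0 * p i2 0 - r i2 0 * p i1 0;
      r i2 0 * p i0 0 - r i0 0 * p i2 0;
      r i0 0 * p i1 0 - r i1 0 * p i0 0]`_i.

Lemma crossP r a u v : cross r (a *: u + v) = a *: cross r u + cross r v.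
Proof. by apply/colP; apply: ord3; rewrite !mxE /=; ring. Qed.

Definition psi (w : 'cV[R]_2) : 'cV[R]_3 :=
  \col_i (if unlift ord0 i is Some j then w j 0 else 0).

Lemma psiP a u v : psi (a *: u + v) = a *: psi u + psi v.
Proof.
by apply/colP => i; rewrite !mxE; case: unlift => [j|]; rewrite ?mxE // mulr0 addr0.
Qed.

Lemma psi0 w : psi w ord0 0 = 0. Proof. by rewrite mxE unlift_none. Qed.
Lemma psi_lift w j : psi w (lift ord0 j) 0 = w j 0.
Proof. by rewrite mxE liftK. Qed.

Variable M : 'M[R]_3.

(** With [r] the first column of [M], these are the last two coordinates of [M^T (r x p)]; the first
    one vanishes, as [r] is orthogonal to the cross product [r x p]. *)
Definition theta (p : 'cV[R]_3) : 'cV[R]_2 :=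
  \col_j \sum_i M i (lift ord0 j) * cross (col ord0 M) p i 0.

Lemma thetaP a u v : theta (a *: u + v) = a *: theta u + theta v.
Proof.
apply/colP => j; rewrite !mxE mulr_sumr -big_split /=; apply: eq_bigr => i _.
by rewrite crossP mxE [X in _ * (X + _)]mxE; ring.
Qed.

Lemma trmul_ord0 (u : 'cV[R]_3) : (M^T *m u) ord0 0 = \sum_i M i ord0 * u i 0.
Proof. by rewrite mxE; apply: eq_bigr => i _; rewrite mxE. Qed.

Lemma trmul_lift (u : 'cV[R]_3) (j : 'I_2) : (M^T *m u) (lift ord0 j) 0 = \sum_i M i (lift ord0 j) * u i 0.
Proof. by rewrite mxE; apply: eq_bigr => i _; rewrite mxE. Qed.

Lemma tr_cross (p : 'cV[R]_3) : M^T *m cross (col ord0 M) p = psi (theta p).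
Proof.
apply/colP => i; case: (unliftP ord0 i) => [j|] ->.
  by rewrite trmul_lift psi_lift mxE.
by rewrite trmul_ord0 psi0 sum3 !mxE /=; ring.
Qed.

(** The rule [M^T (M u x M v) = \det M (u x v)] for cross products, with [u] the first basis
    vector. *)
Lemma theta_mul (c : 'cV[R]_3) : theta (M *m c) =
  \det M *: (\col_j [:: - c i2 0; c i1 0]`_j).
Proof.
have l1 : lift ord0 (lift ord0 (ord0 : 'I_1) : 'I_2) = i2 by [].
apply/colP => j; rewrite !mxE sum3 !mxE !sum3 det3 /=.
case: (unliftP ord0 j) => [l|] ->; last by rewrite -/i0 -/i1 /=; ring.
have -> : l = ord0 by apply: val_inj; case: l => -[].
by rewrite l1 -/i0 -/i1 /=; ring.
Qed.

Definition swap (a : R) (w : 'cV[R]_2) : 'cV[R]_2 :=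
  \col_j (if j == ord0 then a * w (lift ord0 ord0) 0 else w ord0 0).

Lemma swapP a c u v : swap a (c *: u + v) = c *: swap a u + swap a v.
Proof. by apply/colP => j; rewrite !mxE; case: ifP => _; ring. Qed.

Lemma swapK a w : swap a (swap a w) = a *: w.
Proof.
apply/colP => j; rewrite !mxE eqxx /=; case: (unliftP ord0 j) => [l|] -> //=.
by have -> : l = ord0 by apply: val_inj; case: l => -[].
Qed.

End ThreeByThree.

Section Core.
Variables (K : fieldType) (T : K).
Hypotheses (nsq : forall c, c ^+ 2 != T) (two0 : (2%:R : K) != 0).
Local Notation R := {poly {poly {poly K}}}.
Local Notation x := (xv K).
Local Notation y := (yv K).
Local Notation z := (zv K).

(** Exactness in the middle of the Koszul complex: [z] is regular modulo [(x, y)], and [y] modulo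
    [x]. *)
Lemma koszul_xyz u0 u1 u2 : x * u0 + y * u1 + z * u2 = 0 ->
  exists p0 p1 p2, [/\ u0 = y * p2 - z * p1, u1 = z * p0 - x * p2
    & u2 = x * p1 - y * p0].
Proof.
move=> E.
have [h [k u2E]] : exists h k, u2 = x * h + y * k.
  apply: coefI_mul2; apply: (coefI_monic (q := z)); [exact: ideal2|exact: monicX|].
  have -> : z * u2 = x * (- u0) + y * (- u1).
    by apply/eqP; rewrite -subr_eq0; apply/eqP; rewrite -[RHS]E; ring.
  by move=> i; exists (- u0)`_i, (- u1)`_i; rewrite coefD !coefCM.
have E1 : y * (u1 + z * k) = x * (- (u0 + z * h)).
  by apply/eqP; rewrite -subr_eq0; apply/eqP; rewrite -[RHS]E u2E; ring.
have [m mE] : exists m, u1 + z * k = x * m.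
  apply: coefI_mul => i; apply: (@monic_dvd_const _ _ _ (- (u0 + z * h))`_i 'X).
  - exact: monicX.
  - by rewrite polyX_eq0.
  - by have := congr1 (fun p : R => p`_i) E1; rewrite !coefCM.
have u0E : u0 + z * h = - (y * m).
  apply: (@mulfI _ x); first by rewrite polyC_eq0 polyX_eq0.
  by rewrite mE in E1; rewrite mulrN [x * (y * m)]mulrCA E1 mulrN opprK.
exists (- k), h, (- m); split.
- by rewrite mulrN -u0E addrK.
- by rewrite !mulrN opprK addrC -mE addrK.
- by rewrite u2E; ring.
Qed.

Lemma tame_col e k n : @tame K R (iota3 K) y ('cV[R]_n) (gv T ^+ e) (bv T ^+ k * bv T).
Proof.
move=> A sA AG Ab; rewrite -exprSr in Ab; split; first exact: tame_bounded AG Ab.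
by move=> j; apply: tame_fdim AG Ab j.
Qed.

Section Completion.
Variables (e : nat) (M : 'M[R]_3).
Hypotheses (M0 : M i0 ord0 = x) (M1 : M i1 ord0 = y) (M2 : M i2 ord0 = z).
Hypothesis detM : \det M = gv T ^+ e.
Local Notation G := (gv T ^+ e).

Lemma imM_psi w : imM M^T (psi w) <-> exists p, w = theta M p.
Proof.
split=> [[u uE]|[p ->]]; last by exists (cross (col ord0 M) p); rewrite tr_cross.
have := congr1 (fun v : 'cV_3 => v ord0 0) uE.
rewrite psi0 trmul_ord0 sum3 M0 M1 M2 => /esym /koszul_xyz [p0 [p1 [p2 [E0 E1 E2]]]].
pose p : 'cV[R]_3 := \col_i [:: p0; p1; p2]`_i.
have uc : u = cross (col ord0 M) p.
  by apply/colP; apply: ord3; rewrite !mxE /= ?M0 ?M1 ?M2.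
exists p; apply/colP => j; rewrite -psi_lift uE trmul_lift mxE uc.
by [].
Qed.

(** Cancelling [G] in the formula for [theta (M q)], with [q = \adj M *m p], shows that [theta p]
    consists of the last two coordinates of [q], exchanged and up to sign. If [G] divides these, it
    divides [x] times the first one by the first row of [M q = G p], hence the first one too. *)
Lemma theta_scm p : scm G (theta M p) <-> imM M p.
Proof.
split=> [[w wE]|[c ->]]; last by rewrite theta_mul detM; eexists.
have Mq : M *m (\adj M *m p) = G *: p by rewrite (adjK detM).
have := theta_mul M (\adj M *m p).
have thZ a v : theta M (a *: v) = a *: theta M v.
  by have [_ _ _] := lin_sub (thetaP M).
rewrite Mq thZ detM => /(G_cancel (@G_regular K T e)) thq.
set q := \adj M *m p in Mq thq.
have q1 : q i1 0 = G * w (lift ord0 ord0) 0.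
  have := congr1 (fun v : 'cV_2 => v (lift ord0 ord0) 0) thq.
  by rewrite wE !mxE.
have q2 : q i2 0 = G * - w ord0 0.
  have := congr1 (fun v : 'cV_2 => v ord0 0) thq.
  by rewrite wE !mxE /= => E; rewrite mulrN E opprK.
have [al alE] : exists al, q i0 0 = G * al.
  apply: (@G_dvd_x _ _ _ _ (p i0 0 - M i0 i1 * w (lift ord0 ord0) 0 + M i0 i2 * w ord0 0)).
  have := congr1 (fun v : 'cV_3 => v i0 0) Mq.
  rewrite mxE sum3 (M0 : M i0 i0 = x) q1 q2 [RHS]mxE => E.
  by rewrite mulrDr mulrBr -E; ring.
pose c : 'cV[R]_3 := \col_i [:: al; w (lift ord0 ord0) 0; - w ord0 0]`_i.
exists c; apply: (imM_adj (@G_regular K T e) detM).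
by rewrite -/q; apply/colP; apply: ord3; rewrite [RHS]mxE [c _ _]mxE /= ?alE ?q1 ?q2.
Qed.

Lemma sum_psi_ev v : addm (impsi (@psi R)) (imM M^T) v <-> (v ord0 0)`_0`_0`_0 = 0.
Proof.
split=> [[_ [_ [[w ->] [u ->] ->]]]|/origin_dec[h1 [h2 [h3 vE]]]].
  have -> : (psi w + M^T *m u) ord0 0 = x * u i0 0 + y * u i1 0 + z * u i2 0.
    by rewrite mxE psi0 add0r trmul_ord0 sum3 M0 M1 M2.
  rewrite !coefD /yv /xv /zv.
  by rewrite !(coefCM, coefXM) /= !coef0 !addr0.
pose u : 'cV[R]_3 := \col_i [:: h2; h1; h3]`_i.
pose w : 'cV[R]_2 := \col_j (v - M^T *m u) (lift ord0 j) 0.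
exists (psi w), (M^T *m u); split; [by exists w|by exists u|].
apply/colP => i; case: (unliftP ord0 i) => [j|] ->.
  by rewrite [RHS]mxE psi_lift [w j 0]mxE [X in X + _]mxE [X in _ + X + _]mxE subrK.
rewrite [RHS]mxE psi0 add0r trmul_ord0 sum3 !mxE /= M0 M1 M2 vE.
by rewrite [y * _ + _]addrC.
Qed.

Lemma sum_psi_codim :
  rdim (iota3 K) (@top R 'cV[R]_3) (addm (impsi (@psi R)) (imM M^T)) 1.
Proof.
split=> //; exists (fun v : 'cV[R]_3 => \row_i (v ord0 0)`_0`_0`_0); split.
- by move=> a u v _ _; apply/rowP => i; rewrite !mxE !(coefD, coefCM).
- move=> v _; rewrite sum_psi_ev; split=> [E|->].
    by have := congr1 (fun w : 'rV_1 => w 0 0) E; rewrite !mxE.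
  by apply/rowP => i; rewrite !mxE.
- move=> w; exists (\col_i iota3 K (w 0 0)) => //.
  by apply/rowP => i; rewrite !mxE !coefC /= ord1.
Qed.

Theorem no_completion : False.
Proof.
have T0 : T != 0 by have := nsq 0; rewrite expr0n /= eq_sym.
have [k [sigma [h1 sigmaP]]] := sigma_exists e T0 two0.
(* One factor [b] more than in [beta]: the extra factor takes elements of [U] into the image of
   [psi] plus that of [M^T], since [b] vanishes at the origin. *)
have [N [s [h2 [N0 sP]]]] := s_exists k.+1 T0 two0.
have sigmaP' : exists h, sigma ^+ 2 - iota3 K T * (bv T ^+ k) ^+ 2 = h * G by exists h1.
have sP' : exists h, s ^+ 2 - iota3 K T * (y ^+ N) ^+ 2 = h * (bv T ^+ k * bv T).
  by exists h2; rewrite -exprSr.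
have detMT : \det M^T = G by rewrite det_tr.
have greg := @G_regular K T e.
have Gb := @G_dvd_beta K T e k.
have bG := @beta_dvd_G K T e k.
have Gby := @G_beta_dvd_y K T e k.
have sTop : rsub (@top R 'cV[R]_3) by apply: top_rsub.
have fin A : rsub A -> (forall u, A (G *: u)) -> (forall u, A (bv T ^+ k *: u)) ->
    exists n, rdim (iota3 K) (@top R 'cV[R]_3) (heart s (y ^+ N) A (@top R 'cV[R]_3)) n.
  move=> sA AG Ab; apply: (heart1_fdim s N (@tame_col e k 3)) => // u.
  by rewrite -scalerA; apply: Ab.
have hr M' : \det M' = G -> rsub (heart sigma (bv T ^+ k) (imM M') (@top R 'cV[R]_3)) /\
   exists n, rdim (iota3 K) (@top R 'cV[R]_3) (heart s (y ^+ N)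
     (heart sigma (bv T ^+ k) (imM M') (@top R 'cV[R]_3)) (@top R 'cV[R]_3)) n.
  move=> detM'; have sH : rsub (heart sigma (bv T ^+ k) (imM M') (@top R 'cV[R]_3)).
    by apply: heart_rsub => //; apply: imM_rsub.
  split=> //; apply: fin => // u.
    by apply: sub_heart => //; [apply: imM_rsub|apply: imM_G].
  by apply: heart2_beta; apply: imM_rsub.
have [_ [n dn]] := hr _ detM; have [_ [m dm]] := hr _ detMT.
have : odd n = odd m.
  apply: (index_transpose nsq sP' sigmaP' greg Gb bG _ Gby
    (@lam3P K T e k N) (@lam3_G K T e k N) (@lam3_beta K T e k N)
    (@lam3_t K T e k N N0) _ (@tame_col e k 3) detM dn dm).
  - exact: beta_t_dvd_G.
  - exact: lam3_nondeg.
have : odd n (+) odd m.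
  apply: (index_parity nsq sP' sigmaP' (@psiP R) (thetaP M) (@swapP R (iota3 K T))
    (@swapK R (iota3 K T)) (imM_rsub M) (imM_rsub M^T) (imM_G detMT)
    imM_psi theta_scm sum_psi_codim _ (imM_beta greg Gb detMT) _
    (imM_y bG Gby detMT) _
    (@tame_col e k 3) (@tame_col e k 2) dn dm).
  - move=> u; apply/sum_psi_ev; rewrite mxE bvE coefCM coef0M /b2 coefB coefXn coefC /=.
    by rewrite sub0r coef0M coefN coefZ coefXn /= mulr0 oppr0 mul0r.
  - move=> w [v vE]; apply: col_lift1 => i; apply: (Gb _ (v i 0)).
    by have := congr1 (fun u : 'cV_2 => u i 0) vE; rewrite !mxE.
  - move=> w [_ [_ [[a ->] [c ->] wE]]].
    have [a' [c' ->]] : exists a' c', w = G *: a' + bv T ^+ k *: c'.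
      apply: col_lift2 => i; apply: (Gby _ (a i 0) (c i 0)).
      by have := congr1 (fun u : 'cV_2 => u i 0) wE; rewrite !mxE.
    by exists (G *: a'), (bv T ^+ k *: c'); split; [exists a'|exists c'|].
by move=> H1 H2; rewrite H2 addbb in H1.
Qed.

End Completion.
End Core.

(** * Localization of a polynomial ring at one element *)

Section Localization.
Variables (F : fieldType) (n : nat) (g : {mpoly F[n]}).
Local Notation R := {mpoly F[n]}.
Local Notation Q := {fraction R}.

(* The ring [R[1/g]], inside the field of fractions (all of it when [g = 0]). *)
Definition locp : {pred Q} :=
  fun q => asb (exists m a, q * (tofrac g) ^+ m = tofrac a).

Lemma locpP q : reflect (exists m a, q * (tofrac g) ^+ m = tofrac a) (q \in locp).
Proof. exact: asbP. Qed.

Lemma locp_subring : subring_closed locp.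
Proof.
split.
- by apply/locpP; exists 0%N, 1; rewrite mul1r rmorph1.
- move=> u v /locpP[m [a ua]] /locpP[p [b vb]]; apply/locpP.
  exists (m + p)%N, (a * g ^+ p - b * g ^+ m).
  rewrite rmorphB !rmorphM !rmorphXn /= -ua -vb mulrBl exprD mulrA.
  by congr (_ - _); rewrite -mulrA [tofrac g ^+ p * _]mulrC.
- move=> u v /locpP[m [a ua]] /locpP[p [b vb]]; apply/locpP.
  exists (m + p)%N, (a * b); rewrite rmorphM /= -ua -vb exprD.
  by rewrite mulrACA.
Qed.

HB.instance Definition _ := GRing.isSubringClosed.Build Q locp locp_subring.

Record loc := Loc { lval : Q; _ : lval \in locp }.
HB.instance Definition _ := [isSub for lval].
HB.instance Definition _ := [Choice of loc by <:].
HB.instance Definition _ := [SubChoice_isSubComNzRing of loc by <:].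

Lemma locp_tofrac a : tofrac a \in locp.
Proof. by apply/locpP; exists 0%N, a; rewrite mulr1. Qed.

Definition toloc (a : R) : loc := Loc (locp_tofrac a).

Lemma toloc_zmod : zmod_morphism toloc.
Proof. by move=> a b; apply: val_inj; rewrite /= rmorphB. Qed.
Lemma toloc_monoid : monoid_morphism toloc.
Proof. by split=> [|a b]; apply: val_inj; rewrite /= ?rmorph1 ?rmorphM. Qed.
HB.instance Definition _ := GRing.isZmodMorphism.Build R loc toloc toloc_zmod.
HB.instance Definition _ := GRing.isMonoidMorphism.Build R loc toloc toloc_monoid.

Definition loc_scale (c : F) (x : loc) : loc := toloc c%:MP * x.

Lemma loc_scaleA c d x : loc_scale c (loc_scale d x) = loc_scale (c * d) x.
Proof. by rewrite /loc_scale mulrA -rmorphM -mpolyCM. Qed.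
Lemma loc_scale1 : left_id 1 loc_scale.
Proof. by move=> x; rewrite /loc_scale mpolyC1 rmorph1 mul1r. Qed.
Lemma loc_scaleDr : right_distributive loc_scale +%R.
Proof. by move=> c x y; rewrite /loc_scale mulrDr. Qed.
Lemma loc_scaleDl x : {morph loc_scale^~ x : c d / c + d}.
Proof. by move=> c d; rewrite /loc_scale mpolyCD rmorphD mulrDl. Qed.
HB.instance Definition _ := GRing.Zmodule_isLmodule.Build F loc
  loc_scaleA loc_scale1 loc_scaleDr loc_scaleDl.
Lemma loc_scaleAl (c : F) (x y : loc) : c *: (x * y) = (c *: x) * y.
Proof. exact: mulrA. Qed.
HB.instance Definition _ := GRing.Lmodule_isLalgebra.Build F loc loc_scaleAl.
Lemma loc_scaleAr (c : F) (x y : loc) : c *: (x * y) = x * (c *: y).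
Proof. exact: mulrCA. Qed.
HB.instance Definition _ := GRing.Lalgebra_isAlgebra.Build F loc loc_scaleAr.

Lemma toloc_inj : injective toloc.
Proof. by move=> a b /(congr1 lval) /= /eqP; rewrite tofrac_eq => /eqP. Qed.

Lemma locE (x : loc) : exists m a, x * toloc g ^+ m = toloc a.
Proof.
have [m [a E]] := locpP _ (valP x); exists m, a; apply: val_inj.
by rewrite /= -E; congr (_ * _); elim: m {E} => // m IH; rewrite !exprS -IH.
Qed.

Lemma loc_scaleE (c : F) (x : loc) : c *: x = toloc c%:MP * x.
Proof. by []. Qed.

Lemma loc_eq0 (x y : loc) : x * y = 0 -> x = 0 \/ y = 0.
Proof.
move=> /(congr1 lval) /= /eqP; rewrite mulf_eq0 => /orP[] /eqP E; [left|right];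
  exact: val_inj.
Qed.

Hypothesis g0 : g != 0.

Lemma ginv_in : (tofrac g)^-1 \in locp.
Proof.
by apply/locpP; exists 1%N, 1; rewrite mulVf ?rmorph1 // tofrac_eq0.
Qed.

Definition ginv : loc := Loc ginv_in.

Lemma mul_ginv : toloc g * ginv = 1.
Proof. by apply: val_inj; rewrite /= mulfV // tofrac_eq0. Qed.

Lemma mul_ginvX m : toloc g ^+ m * ginv ^+ m = 1.
Proof. by rewrite -exprMn mul_ginv expr1n. Qed.

End Localization.

Section Maps.
Variables (F : fieldType) (n : nat).
Local Notation R := {mpoly F[n]}.

Lemma toloc_lin (g : R) : scalable (@toloc F n g).
Proof. by move=> c a; rewrite loc_scaleE -mul_mpolyC rmorphM. Qed.

Lemma mpoly_eval (B : comAlgType F) (v : 'I_n -> B) :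
  exists e : {lrmorphism R -> B}, forall i, e 'X_i = v i.
Proof.
pose f : R -> B := mmap (in_alg B) v.
have fZ : scalable f by move=> c p; rewrite /f mmapZ /= mulr_algl.
have fa : zmod_morphism f by move=> p q; rewrite /f rmorphB.
have fm : monoid_morphism f by split=> [|p q]; rewrite /f ?rmorph1 ?rmorphM.
pose fl : {lrmorphism R -> B} := HB.pack f (GRing.isZmodMorphism.Build _ _ f fa)
  (GRing.isMonoidMorphism.Build _ _ f fm) (GRing.isScalable.Build _ _ _ _ f fZ).
exists fl => i; by rewrite /= /f mmapX mmap1U.
Qed.

Lemma lrmorphism_eval (B : comAlgType F) (e : {lrmorphism R -> B}) p :
  e p = \sum_(m <- msupp p) p@_m *: \prod_i e 'X_i ^+ m i.
Proof.
rewrite [p in LHS]mpolyE rmorph_sum /=; apply: eq_bigr => m _.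
rewrite linearZ /=; congr (_ *: _); rewrite mpolyXE_id rmorph_prod.
by apply: eq_bigr => i _; rewrite rmorphXn.
Qed.

Variable g : R.
Local Notation A := (loc g).

(** The value at [a / g ^ m] is [e a * u ^ m]; numerator and exponent are chosen classically, and
    [hE] shows independence of the choice. *)
Lemma loc_ext (B : comAlgType F) (u : B) (e : {lrmorphism R -> B}) :
  e g * u = 1 -> exists h : {lrmorphism A -> B}, forall a, h (toloc g a) = e a.
Proof.
move=> eu.
have euX m : e g ^+ m * u ^+ m = 1 by rewrite -exprMn eu expr1n.
pose ch (x : A) := constructive_indefinite_description _ (locE x).
pose m x := proj1_sig (ch x).
have mP x : exists a, x * toloc g g ^+ m x = toloc g a by exact: (proj2_sig (ch x)).
pose a x := proj1_sig (constructive_indefinite_description _ (mP x)).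
have aP x : x * toloc g g ^+ m x = toloc g (a x).
  exact: (proj2_sig (constructive_indefinite_description _ (mP x))).
pose h x := e (a x) * u ^+ m x.
have hE x p c : x * toloc g g ^+ p = toloc g c -> h x = e c * u ^+ p.
  move=> xE; have E : a x * g ^+ p = c * g ^+ m x.
    apply: (@toloc_inj _ _ g); rewrite !rmorphM !rmorphXn /= -aP -xE.
    by rewrite mulrAC.
  rewrite /h -[LHS]mulr1 -(euX p) mulrACA -rmorphXn -rmorphM E.
  by rewrite rmorphM rmorphXn /= -mulrA (mulrA (e g ^+ m x)) euX mul1r.
have ha : zmod_morphism h.
  move=> x y; rewrite (hE _ (m x + m y)%N (a x * g ^+ m y - a y * g ^+ m x)).
    rewrite rmorphB !rmorphM !rmorphXn mulrBl exprD /h.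
    by congr (_ - _); [|rewrite [u ^+ m x * _]mulrC]; rewrite mulrACA euX mulr1.
  rewrite rmorphB !rmorphM !rmorphXn /= -!aP mulrBl exprD.
  by congr (_ - _); rewrite ?mulrA // mulrAC -mulrA.
have hm : monoid_morphism h.
  split; first by rewrite (hE 1 0%N 1) ?rmorph1 ?mulr1.
  move=> x y; rewrite (hE _ (m x + m y)%N (a x * a y)).
    by rewrite rmorphM exprD mulrACA.
  by rewrite rmorphM /= -!aP exprD mulrACA.
have hZ : scalable h.
  move=> c x; rewrite (hE _ (m x) (c *: a x)); first by rewrite linearZ /= scalerAl.
  by rewrite -scalerAl aP toloc_lin.
pose hl : {lrmorphism A -> B} := HB.pack h (GRing.isZmodMorphism.Build _ _ h ha)
  (GRing.isMonoidMorphism.Build _ _ h hm) (GRing.isScalable.Build _ _ _ _ h hZ).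
exists hl => b /=; rewrite (hE _ 0%N b) ?mulr1 //.
Qed.

Lemma toloc_lr : exists e : {lrmorphism R -> A}, forall a, e a = toloc g a.
Proof.
pose tl : {lrmorphism R -> A} := HB.pack (toloc g)
  (GRing.isZmodMorphism.Build _ _ _ (toloc_zmod g))
  (GRing.isMonoidMorphism.Build _ _ _ (toloc_monoid g))
  (GRing.isScalable.Build _ _ _ _ _ (toloc_lin g)).
by exists tl.
Qed.

End Maps.

(** * Smoothness *)

Section Smooth.
Variables (F : fieldType) (n : nat) (g : {mpoly F[n]}).
Hypothesis g0 : g != 0.
Local Notation A := (loc g).

Lemma lrmorphism_ext m (B : comAlgType F) (e f : {lrmorphism {mpoly F[m]} -> B}) :
  (forall i, e 'X_i = f 'X_i) -> forall p, e p = f p.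
Proof.
move=> ef p; rewrite !lrmorphism_eval; apply: eq_bigr => k _; congr (_ *: _).
by apply: eq_bigr => i _; rewrite ef.
Qed.

Lemma loc_finite_type : finite_type A.
Proof.
pose v (i : 'I_n.+1) : A :=
  if unlift ord_max i is Some j then toloc g 'X_j else ginv g0.
have [e eX] := mpoly_eval v.
have [w wX] := @mpoly_eval F n {mpoly F[n.+1]} (fun j => 'X_(lift ord_max j)).
have [tl tlE] := toloc_lr g.
have ew a : e (w a) = toloc g a.
  rewrite -tlE; apply: (lrmorphism_ext (e := e \o w)) => i /=.
  by rewrite wX eX /v liftK tlE.
exists n.+1, e => x; have [m [a xE]] := locE x.
exists (w a * 'X_ord_max ^+ m).
rewrite rmorphM rmorphXn /= ew eX /v unlift_none -xE.
by rewrite -mulrA mul_ginvX mulr1.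
Qed.

Lemma loc_formally_smooth : formally_smooth A.
Proof.
move=> B C p psurj pker h.
pose lift1 c := proj1_sig (constructive_indefinite_description _ (psurj c)).
have liftP c : p (lift1 c) = c.
  exact: (proj2_sig (constructive_indefinite_description _ (psurj c))).
have [e eX] := mpoly_eval (fun i => lift1 (h (toloc g 'X_i))).
have [tl tlE] := toloc_lr g.
have pe a : p (e a) = h (toloc g a).
  rewrite -tlE; apply: (lrmorphism_ext (e := p \o e) (f := h \o tl)) => i /=.
  by rewrite eX liftP tlE.
(* Units lift along the surjection: [e g * c] is [1 + nu] with [nu ^ 2 = 0], so [c * (1 - nu)]
   inverts [e g], and the lift extends to the localization. *)
pose c := lift1 (h (ginv g0)); pose nu := e g * c - 1.
have nu0 : p nu = 0.
  by rewrite rmorphB rmorphM /= pe liftP -rmorphM mul_ginv !rmorph1 subrr.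
have unit_eg : e g * (c * (1 - nu)) = 1.
  have -> : e g * (c * (1 - nu)) = (1 + nu) * (1 - nu).
    by rewrite mulrA [1 + nu]addrC subrK.
  by rewrite mulrC -subr_sqr expr1n expr2 (pker nu nu) // subr0.
have [k kE] := loc_ext unit_eg; exists k => x.
have [m [a xE]] := locE x.
have hg : h (toloc g g) ^+ m * h (ginv g0) ^+ m = 1.
  by rewrite -exprMn -rmorphM mul_ginv rmorph1 expr1n.
rewrite -[LHS]mulr1 -[RHS]mulr1 -hg !mulrA; congr (_ * _).
transitivity (h (x * toloc g g ^+ m)); last by rewrite rmorphM rmorphXn.
have kx : k (x * toloc g g ^+ m) = k x * e g ^+ m by rewrite rmorphM rmorphXn /= kE.
by rewrite xE -(pe a) -(kE a) -xE kx rmorphM rmorphXn /= pe.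
Qed.

Lemma loc_smooth : smooth A.
Proof. by split; [exact: loc_finite_type | exact: loc_formally_smooth]. Qed.

End Smooth.

(** * Krull dimension *)

Section Dependence.
Variables (F : fieldType) (n : nat).
Local Notation R := {mpoly F[n]}.

Definition bdeg (k : nat) (p : R) := forall m, m \in msupp p -> (mdeg m <= k)%N.

Lemma bdegM k l p q : bdeg k p -> bdeg l q -> bdeg (k + l) (p * q).
Proof.
move=> bp bq m /msuppM_le /allpairsP[[m1 m2] /= [m1p m2q ->]].
by rewrite mdegD leq_add // ?bp ?bq.
Qed.

Lemma bdeg1 : bdeg 0 1.
Proof. by move=> m; rewrite msupp1 inE => /eqP ->; rewrite mdeg0. Qed.

Lemma bdegX k p i : bdeg k p -> bdeg (k * i) (p ^+ i).
Proof.
move=> bp; elim: i => [|i IH]; first by rewrite muln0; apply: bdeg1.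
by rewrite exprS mulnS; apply: bdegM.
Qed.

Lemma bdeg_le k l p : (k <= l)%N -> bdeg k p -> bdeg l p.
Proof. by move=> kl bp m /bp /leq_trans ->. Qed.

Lemma bdegZD k p q c : bdeg k p -> bdeg k q -> bdeg k (c *: p + q).
Proof.
move=> bp bq m /msuppD_le; rewrite mem_cat => /orP[/msuppZ_le|]; [exact: bp|exact: bq].
Qed.

(* Counting monomials: for large [D] there are more monomials in the [a_i]
   with exponents below [D] than monomials in the [n] variables of the degrees
   that occur. *)
Lemma algebraic_dependence (a : 'I_n.+1 -> R) :
  exists (D : nat) (c : {ffun 'I_n.+1 -> 'I_D} -> F),
    (exists mu, c mu != 0) /\
    \sum_mu c mu *: \prod_i a i ^+ (mu i) = 0.
Proof.
pose d := \max_i msize (a i).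
have ad i : bdeg d (a i).
  move=> m ma; apply: leq_trans (leq_bigmax i).
  exact/ltnW/msize_mdeg_lt.
(* The products have degree below [B], so there are at most [B ^ n = C ^ n * D ^ n] equations for
   the [D ^ n.+1] unknown coefficients, and [D] exceeds [C ^ n]. *)
pose C := (d * n.+1).+1; pose D := (C ^ n).+1; pose B := (C * D)%N.
pose I := {ffun 'I_n.+1 -> 'I_D}; pose J := {ffun 'I_n -> 'I_B}.
pose mon (j : J) : 'X_{1..n} := [multinom nat_of_ord (j i) | i < n].
pose P (mu : I) := \prod_i a i ^+ mu i.
have bP mu : bdeg B.-1 (P mu).
  have : bdeg (\sum_(i < n.+1) d * D) (P mu).
    rewrite /P; elim/big_ind2: _ => [|p k q l Hp Hq|i _]; first exact: bdeg1.
      exact: bdegM.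
    by refine (bdeg_le _ (bdegX (ad i))); rewrite leq_mul2l ltnW ?orbT.
  move=> H; refine (bdeg_le _ H); rewrite sum_nat_const card_ord.
  rewrite mulnA [(n.+1 * d)%N]mulnC /B {1}/C mulSn {2}/D addSn /=.
  exact: leq_addl.
have card : (#|J| < #|I|)%N.
  by rewrite !card_ffun !card_ord /B expnMn [(D ^ n.+1)%N]expnS ltn_pmul2r // expn_gt0.
pose M : 'M[F]_(#|I|, #|J|) := \matrix_(i, j) (P (enum_val i))@_(mon (enum_val j)).
have : kermx M != 0.
  rewrite kermx_eq0 /row_free neq_ltn (leq_ltn_trans _ card) //.
  exact: rank_leq_col.
move=> /rowV0Pn[w /sub_kermxP wM w0].
exists D, (fun mu => w 0 (enum_rank mu)); split.
  move: w0; rewrite -subr_eq0 subr0 => w0.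
  have /existsP[i wi] : [exists i, w 0 i != 0].
    apply: contraR w0; rewrite negb_exists => /forallP H; apply/eqP/rowP => i.
    by rewrite mxE; apply/eqP; rewrite -[_ == _]negbK.
  by exists (enum_val i); rewrite enum_valK.
set S := \sum_mu _.
have b0 : bdeg B.-1 0 by move=> m; rewrite mcoeff_msupp mcoeff0 eqxx.
have bS : bdeg B.-1 S.
  rewrite /S; apply: (big_ind (bdeg B.-1)).
  - exact: b0.
  - by move=> p q bp bq; rewrite -[p]scale1r; refine (bdegZD bp bq).
  - by move=> mu _; rewrite -[_ *: _]addr0; refine (bdegZD (bP mu) b0).
apply/mpolyP => m; rewrite mcoeff0.
have [lt|ge] := ltnP (mdeg m) B; last first.
  apply: memN_msupp_eq0; apply/negP => /bS.
  by rewrite leqNgt prednK ?ge // (leq_trans _ ge) // muln_gt0.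
have mi i : (m i < B)%N.
  by apply: leq_ltn_trans lt; rewrite mdegE (bigD1 i) //= leq_addr.
pose j : J := [ffun i => Ordinal (mi i)].
have -> : m = mon j by apply/mnmP => i; rewrite mnmE ffunE.
have := congr1 (fun v : 'rV_#|J| => v 0 (enum_rank j)) wM.
rewrite !mxE => E; rewrite -[RHS]E /S raddf_sum /=.
rewrite (reindex (@enum_val I xpredT)) /=; last first.
  by exists enum_rank => x _; rewrite ?enum_valK ?enum_rankK.
apply: eq_bigr => i _; rewrite !mxE enum_valK enum_rankK mcoeffZ.
by [].
Qed.

End Dependence.

Section Chain.
Variables (A : comNzRingType) (n : nat).

Lemma pid0 (p : {pred A}) : prime_ideal p -> 0 \in p.
Proof. by move=> [[]]. Qed.

Lemma pid1 (p : {pred A}) : prime_ideal p -> 1 \notin p.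
Proof. by move=> [[]]. Qed.

Lemma pidD (p : {pred A}) x y : prime_ideal p -> x \in p -> y \in p -> x + y \in p.
Proof. by move=> [[_ _ H] _] xp yp; rewrite -[x]mul1r; exact: H. Qed.

Lemma pidM (p : {pred A}) a x : prime_ideal p -> x \in p -> a * x \in p.
Proof. by move=> pp xp; rewrite -[a * x]addr0; case: (pp) => [[p0 _ H] _]; exact: H. Qed.

Lemma pidB (p : {pred A}) x y : prime_ideal p -> x \in p -> y \in p -> x - y \in p.
Proof.
by move=> pp xp yp; have := pidM (-1) pp yp; rewrite mulN1r; apply: pidD.
Qed.

Lemma pid_sum (p : {pred A}) (I : finType) (P : pred I) (f : I -> A) :
  prime_ideal p -> (forall i, P i -> f i \in p) -> \sum_(i | P i) f i \in p.
Proof.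
move=> pp fp; apply: (big_ind (fun x => x \in p)) => // [|x y].
  exact: pid0.
exact: (pidD pp).
Qed.

Lemma pid_prime (p : {pred A}) x y : prime_ideal p -> x * y \in p -> x \notin p -> y \in p.
Proof. by move=> [_ H] /H /orP[->|]. Qed.

Lemma pid_primeX (p : {pred A}) x y k : prime_ideal p -> x ^+ k * y \in p -> x \notin p ->
  y \in p.
Proof.
move=> pp; elim: k => [|k IH]; first by rewrite mul1r.
by rewrite exprS -mulrA => /(pid_prime pp) H xp; apply: IH => //; apply: H.
Qed.

(* Peel off the variables one at a time: among the terms that remain, those
   with the least exponent of [f j] survive modulo [p j.+1]. *)
Lemma chain_dependence (p : nat -> {pred A}) (f : 'I_n.+1 -> A) D
    (c : {ffun 'I_n.+1 -> 'I_D} -> A) :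
  prime_chain n.+1 p ->
  (forall i : 'I_n.+1, f i \in p i.+1) -> (forall i : 'I_n.+1, f i \notin p i) ->
  (forall mu, c mu = 0 \/ exists d, d * c mu = 1) -> (exists mu, c mu != 0) ->
  \sum_mu c mu * \prod_i f i ^+ (mu i) = 0 -> False.
Proof.
move=> [pp ps] fS fN cu [mu0 cmu0] sum0.
have key j : (j <= n.+1)%N -> exists S : {set {ffun 'I_n.+1 -> 'I_D}},
    [/\ exists mu, mu \in S, forall mu, mu \in S -> c mu != 0,
      forall mu nu, mu \in S -> nu \in S -> forall i : 'I_n.+1, (i < j)%N -> mu i = nu i
      & \sum_(mu in S) c mu * \prod_(i < n.+1 | (j <= i)%N) f i ^+ (mu i) \in p j].
  elim: j => [_|j IH lt].
    exists [set mu | c mu != 0]; split=> //.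
    - by exists mu0; rewrite inE.
    - by move=> mu; rewrite inE.
    - suff -> : \sum_(mu in [set mu | c mu != 0])
          c mu * \prod_(i < n.+1 | (0 <= i)%N) f i ^+ mu i = 0 by apply/pid0/pp.
      rewrite -[RHS]sum0 big_mkcond; apply: eq_bigr => mu _; rewrite inE.
      by case: eqVneq => [->|//]; rewrite mul0r.
  have [S [[mu1 mu1S] Sc Seq Sp]] := IH (ltnW lt).
  pose i := Ordinal lt.
  have [mu2 mu2S mu2min] := arg_minnP (fun mu : {ffun 'I_n.+1 -> 'I_D} => mu i : nat) mu1S.
  have {}mu2S : mu2 \in S by exact: mu2S.
  pose k : nat := mu2 i.
  exists [set mu in S | mu i == mu2 i]; split.
  - by exists mu2; rewrite inE mu2S eqxx.
  - by move=> mu; rewrite inE => /andP[/Sc].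
  - move=> mu nu; rewrite !inE => /andP[muS /eqP mui] /andP[nuS /eqP nui] l.
    rewrite ltnS leq_eqVlt => /orP[/eqP lj|]; last exact: Seq.
    have -> : l = i by exact: val_inj.
    by rewrite mui.
  have peel mu : \prod_(l < n.+1 | (j <= l)%N) f l ^+ mu l
     = f i ^+ mu i * \prod_(l < n.+1 | (j.+1 <= l)%N) f l ^+ mu l.
    rewrite (bigD1 i) //=; congr (_ * _); apply: eq_bigl => l.
    by rewrite [RHS]ltn_neqAle andbC eq_sym.
  have {}Sp : \sum_(mu in S) c mu * (f i ^+ (mu i - k) *
      \prod_(l < n.+1 | (j.+1 <= l)%N) f l ^+ mu l) \in p j.
    refine (@pid_primeX (p j) (f i) _ k (pp _ (ltnW lt)) _ (fN i)).
    rewrite mulr_sumr; apply: etrans Sp; congr (_ \in p j); apply: eq_bigr => mu muS.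
    rewrite peel mulrCA; congr (_ * _); rewrite mulrA -exprD subnKC //.
    exact: mu2min.
  have [sub _] := ps j lt.
  have ppj := pp _ lt.
  move/sub: Sp; rewrite (bigID (fun mu : {ffun 'I_n.+1 -> 'I_D} => mu i == mu2 i)) /= => Sp.
  have rest : \sum_(mu in S | mu i != mu2 i) c mu * (f i ^+ (mu i - k) *
      \prod_(l < n.+1 | (j.+1 <= l)%N) f l ^+ mu l) \in p j.+1.
    apply: pid_sum => // mu /andP[muS ne].
    have lk : (k < mu i)%N.
      by rewrite ltn_neqAle mu2min // andbT eq_sym; apply: contra ne => /eqP /val_inj ->.
    rewrite -(subnSK lk) exprS mulrCA -!mulrA; rewrite mulrC.
    by apply: pidM => //; apply: fS.
  have := pidB ppj Sp rest; rewrite addrK => {}Sp; apply: etrans Sp.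
  congr (_ \in p j.+1); apply: eq_big => [mu|mu]; rewrite inE // => /andP[muS /eqP mui].
  by rewrite mui subnn mul1r.
have [S [[mu muS] Sc Seq Sp]] := key _ (leqnn _).
have S1 : S = [set mu].
  apply/setP => nu; rewrite inE; apply/idP/eqP => [nuS|->//].
  by apply/ffunP => i; apply: (Seq _ _ nuS muS).
move: Sp; rewrite S1 big_set1 big1 => [|i]; last by rewrite leqNgt ltn_ord.
have pn := pp _ (leqnn _).
rewrite mulr1 => Sp; have [c0|[d dc]] := cu mu.
  by have := Sc _ muS; rewrite c0 eqxx.
by have := pid1 pn; rewrite -dc (pidM d pn Sp).
Qed.

End Chain.

Section KrullDim.
Variables (F : fieldType) (n : nat) (g : {mpoly F[n]}) (pt : 'I_n -> F).
Hypothesis gpt : mmap idfun pt g != 0.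
Local Notation A := (loc g).
Local Notation R := {mpoly F[n]}.

Lemma g_neq0 : g != 0.
Proof. by apply: contraNneq gpt => ->; rewrite mmap0. Qed.

Lemma loc_krull_le m (p : nat -> {pred A}) : prime_chain m p -> (m <= n)%N.
Proof.
move=> pc; rewrite leqNgt; apply/negP => lt.
have {m lt}pc : prime_chain n.+1 p.
  case: pc => [pp ps]; split=> i li; [apply: pp|apply: ps]; exact: leq_trans li lt.
have [pp ps] := pc.
(* An element separating consecutive primes may be multiplied by a power of the unit [g], which
   makes it a polynomial. *)
have ex (i : 'I_n.+1) : exists a : R, toloc g a \in p i.+1 /\ toloc g a \notin p i.
  have [_ [x xS xN]] := ps i (ltn_ord i).
  have [k [a xE]] := locE x; exists a; rewrite -xE; split.
    by rewrite mulrC; apply: pidM => //; apply: pp; apply: ltn_ord.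
  apply: contra xN => H.
  have -> : x = ginv g_neq0 ^+ k * (x * toloc g g ^+ k).
    by rewrite mulrC -mulrA mul_ginvX mulr1.
  by apply: pidM => //; apply: pp; apply/ltnW/ltn_ord.
have [a aP] := fin_all_exists ex.
have [D [c [[mu cmu] dep]]] := algebraic_dependence a.
apply: (@chain_dependence A n p (fun i => toloc g (a i)) D (fun nu => toloc g (c nu)%:MP) pc).
- by move=> i; case: (aP i).
- by move=> i; case: (aP i).
- move=> nu; case: (eqVneq (c nu) 0) => [->|nz]; first by left; rewrite mpolyC0 rmorph0.
  right; exists (toloc g (c nu)^-1%:MP).
  by rewrite -rmorphM -mpolyCM mulVf // mpolyC1 rmorph1.
- exists mu; rewrite -(rmorph0 (toloc g)) (inj_eq (@toloc_inj _ _ g)).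
  by rewrite mpolyC_eq0.
- rewrite -[RHS](rmorph0 (toloc g)) -[in RHS]dep rmorph_sum /=.
  apply: eq_bigr => nu _; rewrite -mul_mpolyC rmorphM rmorph_prod /=.
  by congr (_ * _); apply: eq_bigr => i _; rewrite rmorphXn.
Qed.

(* The prime ideal of functions vanishing where the first [i] coordinates are
   those of [pt]. *)
Lemma loc_krull_ge : exists p : nat -> {pred A}, prime_chain n p.
Proof.
have ex i : exists th : {lrmorphism R -> R},
    forall j : 'I_n, th 'X_j = if (j < i)%N then (pt j)%:MP else 'X_j.
  exact: mpoly_eval.
pose th i := proj1_sig (constructive_indefinite_description _ (ex i)).
have thX i j : th i 'X_j = if (j < i)%N then (pt j)%:MP else 'X_j.
  exact: (proj2_sig (constructive_indefinite_description _ (ex i))).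
(* Evaluation at [pt] factors through [th i], and [g] does not vanish at [pt]. Hence [th i] extends
   to a morphism between domains, whose kernel is prime. *)
have thg i : th i g != 0.
  have [ev evX] := @mpoly_eval F n F^o pt.
  have ev1 q : ev q = mmap idfun pt q.
    rewrite lrmorphism_eval /mmap; apply: eq_bigr => m _; rewrite /mmap1.
    by congr (_ * _); apply: eq_bigr => l _; rewrite evX.
  apply: contraNneq gpt => t0; rewrite -ev1.
  have <- : ev (th i g) = ev g.
    apply: (lrmorphism_ext (e := ev \o th i)) => j /=.
    rewrite thX; case: ifP => // _; rewrite evX ev1 mmapC.
    by [].
  by rewrite t0 rmorph0.
have exh i : exists h : {lrmorphism A -> loc (th i g)},
    forall a, h (toloc g a) = toloc (th i g) (th i a).
  have [tl tlE] := toloc_lr (th i g).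
  have [|h hE] := @loc_ext F n g _ (ginv (thg i)) (tl \o th i).
    by rewrite /= tlE mul_ginv.
  by exists h => a; rewrite hE /= tlE.
pose h i := proj1_sig (constructive_indefinite_description _ (exh i)).
have hE i a : h i (toloc g a) = toloc (th i g) (th i a).
  exact: (proj2_sig (constructive_indefinite_description _ (exh i))).
pose p i : {pred A} := fun x => h i x == 0.
have pE i x : (x \in p i) = (h i x == 0) by [].
have pR i a : (toloc g a \in p i) = (th i a == 0).
  by rewrite pE hE -(rmorph0 (toloc (th i g))) (inj_eq (@toloc_inj _ _ _)).
have pp i : prime_ideal (p i).
  split.
    split; rewrite ?pE ?rmorph0 ?rmorph1 ?eqxx ?oner_eq0 // => a u v.
    by rewrite !pE rmorphD rmorphM /= => /eqP -> /eqP ->; rewrite mulr0 addr0.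
  move=> u v; rewrite !pE rmorphM /= => /eqP /loc_eq0[] ->; rewrite eqxx ?orbT //.
exists p; split=> [i _|i lt]; first exact: pp.
(* [th i.+1] factors through [th i], so the kernels increase. *)
have thth a : th i.+1 (th i a) = th i.+1 a.
  apply: (lrmorphism_ext (e := th i.+1 \o th i)) => j /=.
  rewrite !thX; case: ifP => [ji|_]; last by rewrite thX.
  by rewrite ltnS ltnW // -[_%:MP]mulr1 mul_mpolyC linearZ /= rmorph1.
split.
  move=> x; have [k [a xE]] := locE x.
  have [ppi ppi1] := (pp i, pp i.+1).
  move=> xi; have : toloc g a \in p i by rewrite -xE mulrC; apply: pidM.
  rewrite pR => /eqP ai.
  have a1 : toloc g a \in p i.+1 by rewrite pR -thth ai rmorph0.
  have -> : x = ginv g_neq0 ^+ k * toloc g a.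
    by rewrite -xE mulrC -mulrA mul_ginvX mulr1.
  exact: pidM.
exists (toloc g ('X_(Ordinal lt) - (pt (Ordinal lt))%:MP)).
  rewrite pR rmorphB /= thX /= ltnSn -[_%:MP]mulr1 mul_mpolyC linearZ /= rmorph1.
  by rewrite subrr.
rewrite pR rmorphB /= thX /= ltnn -[_%:MP]mulr1 mul_mpolyC linearZ /= rmorph1.
apply/eqP => /(congr1 (mcoeff U_(Ordinal lt))).
rewrite mcoeffB mcoeffZ mcoeff1 mcoeffX mcoeff0 eqxx.
by rewrite mnm1_eq0 mulr0 subr0 => /eqP; rewrite oner_eq0.
Qed.

Lemma loc_krull_dim : krull_dim A n.
Proof.
move=> m; split=> [[p]|le]; first exact: loc_krull_le.
have [p [pp ps]] := loc_krull_ge; exists p; split=> i li; [apply: pp|apply: ps];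
  exact: leq_trans li le.
Qed.

End KrullDim.

(** * The kernel of a unimodular row *)

Section Kernel.
Variables (A : comNzRingType) (n : nat) (a : 'I_n.+1 -> A).

Definition dotp (v : 'rV[A]_n.+1) : A := \sum_j v 0 j * a j.

Lemma dotp_linear : linear (dotp : 'rV[A]_n.+1 -> A^o).
Proof.
move=> c u v; rewrite /dotp scaler_sumr -big_split /=; apply: eq_bigr => j _.
by rewrite !mxE mulrDl -mulrA.
Qed.

HB.instance Definition _ := GRing.isLinear.Build A 'rV[A]_n.+1 A^o *:%R dotp dotp_linear.

Definition kerp : {pred 'rV[A]_n.+1} := fun v => dotp v == 0.

Lemma kerpE v : (v \in kerp) = (dotp v == 0).
Proof. by []. Qed.

Lemma kerp_closed : submod_closed kerp.
Proof.
split; first by rewrite kerpE raddf0.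
by move=> c u v; rewrite !kerpE => /eqP u0 /eqP v0; rewrite linearP /= u0 v0 scaler0 addr0.
Qed.

HB.instance Definition _ := GRing.isSubmodClosed.Build A 'rV[A]_n.+1 kerp kerp_closed.

Record kerm := Kerm { kval : 'rV[A]_n.+1; _ : kval \in kerp }.
HB.instance Definition _ := [isSub for kval].
HB.instance Definition _ := [Choice of kerm by <:].
HB.instance Definition _ := [SubChoice_isSubLmodule of kerm by <:].

Lemma kvalP d x y : kval (d *: x + y) = d *: kval x + kval y.
Proof. exact: (linearP (val : kerm -> 'rV[A]_n.+1)). Qed.

Lemma dotp_kval (x : kerm) : dotp (kval x) = 0.
Proof. exact/eqP/(valP x). Qed.

Variable c : 'rV[A]_n.+1.
Hypothesis ac : dotp c = 1.

Lemma proj_in u : u - dotp u *: c \in kerp.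
Proof. by rewrite kerpE linearB linearZ /= ac [_ *: _]mulr1 subrr. Qed.

Definition proj u : kerm := Kerm (proj_in u).

Lemma proj_linear : linear proj.
Proof.
move=> d u v; apply: val_inj; rewrite /= linearP /= scalerDl scalerBr scalerA.
by rewrite opprD addrACA.
Qed.

HB.instance Definition _ := GRing.isLinear.Build A 'rV[A]_n.+1 kerm *:%R proj proj_linear.

Lemma kerm_stably_trivial : stably_trivial kerm.
Proof.
exists 1%N, n.+1.
pose f (x : kerm * 'rV[A]_1) : 'rV[A]_n.+1 := val x.1 + x.2 0 0 *: c.
have fl : linear f.
  move=> d [x s] [y t]; rewrite /f /= !mxE scalerDr scalerDl scalerA.
  by rewrite addrACA.
pose fL : {linear (kerm * 'rV[A]_1)%type -> 'rV[A]_n.+1} :=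
  HB.pack f (GRing.isLinear.Build _ _ _ _ f fl).
exists fL; exists (fun u => (proj u, (dotp u)%:M)) => [[x s]|u]; rewrite /fL /= /f /=.
  have D : dotp (kval x + s 0 0 *: c) = s 0 0.
    by rewrite linearD linearZ /= ac dotp_kval add0r [_ *: _]mulr1.
  congr (_, _); first by apply: val_inj; rewrite /= D addrK.
  by rewrite D -mx11_scalar.
by rewrite mxE eqxx mulr1n subrK.
Qed.

(** A trivialization of the kernel, together with the splitting [c], gives an isomorphism from
    [A ^ n.+1] to [A ^ m.+1] whose first coordinate is [dotp]. Matrices act on rows from the right,
    so [a] becomes the first column. *)
Lemma trivial_kerm_completion : trivial_bundle kerm ->
  exists C : 'M[A]_n.+1, (forall i, C i ord0 = a i) /\ exists d, \det C * d = 1.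
Proof.
case=> m [f [h fh hf]].
have hl : linear h.
  by move=> d u v; apply: (can_inj fh); rewrite linearP !hf.
pose hL : {linear 'rV[A]_m -> kerm} := HB.pack h (GRing.isLinear.Build _ _ _ _ h hl).
pose W (u : 'rV[A]_n.+1) : 'rV[A]_(1 + m) := row_mx (dotp u)%:M (f (proj u)).
pose V (w : 'rV[A]_(1 + m)) : 'rV[A]_n.+1 := kval (h (rsubmx w)) + lsubmx w 0 0 *: c.
have Wl : linear W.
  move=> d u v; rewrite /W !linearP /= scale_row_mx add_row_mx; congr row_mx.
  by apply/matrixP => i j; rewrite !mxE mulrnDl mulrnAr.
have Vl : linear V.
  move=> d u v; rewrite /V !linearP hl kvalP !mxE scalerDl scalerDr scalerA.
  by rewrite addrACA.
have VW u : V (W u) = u.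
  by rewrite /V /W row_mxKl row_mxKr fh mxE eqxx mulr1n subrK.
have WV w : W (V w) = w.
  have D : dotp (V w) = lsubmx w 0 0.
    by rewrite linearD linearZ /= ac dotp_kval add0r [_ *: _]mulr1.
  rewrite /W D -mx11_scalar -[RHS]hsubmxK; congr row_mx.
  rewrite -[RHS]hf; congr (f _); apply: val_inj.
  by rewrite /= D addrK.
pose WL : {linear 'rV[A]_n.+1 -> 'rV[A]_(1 + m)} := HB.pack W (GRing.isLinear.Build _ _ _ _ W Wl).
pose VL : {linear 'rV[A]_(1 + m) -> 'rV[A]_n.+1} := HB.pack V (GRing.isLinear.Build _ _ _ _ V Vl).
pose C := lin1_mx WL; pose B := lin1_mx VL.
have CB : C *m B = 1%:M.
  apply/row_matrixP => i.
  by rewrite row_mul rowE !mul_rV_lin1 /= VW row1.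
have BC : B *m C = 1%:M.
  apply/row_matrixP => i.
  by rewrite row_mul rowE !mul_rV_lin1 /= WV row1.
have mn : m = n.
  by apply/eqP; rewrite -eqSS -[m.+1]/(1 + m)%N eqn_leq (mulmx1_min CB) (mulmx1_min BC).
subst m; exists C; split; last first.
  by exists (\det B); rewrite -det_mulmx CB det1.
move=> i; rewrite /C mxE /= /W (_ : ord0 = lshift n (0 : 'I_1)); last exact: val_inj.
rewrite row_mxEl mxE eqxx mulr1n /dotp (bigD1 i) //= mxE !eqxx mul1r.
by rewrite big1 ?addr0 // => j ne; rewrite mxE eqxx (negPf ne) mul0r.
Qed.

End Kernel.

(** [iota] is a parameter of the type so that the [A]-module structure by restriction of scalars is
    attached to it and does not interfere with that of row vectors over [S]. *)
Definition restr (A S : comNzRingType) (iota : {rmorphism A -> S}) (n : nat) : Type :=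
  'rV[S]_n.

Section Restrict.
Variables (A S : comNzRingType) (iota : {rmorphism A -> S}) (n : nat).
Local Notation restr := (restr iota n).

HB.instance Definition _ := GRing.Zmodule.on restr.

Definition restr_scale (c : A) (x : restr) : restr := iota c *: (x : 'rV[S]_n).

Lemma restr_scaleA c d x : restr_scale c (restr_scale d x) = restr_scale (c * d) x.
Proof. by rewrite /restr_scale scalerA rmorphM. Qed.
Lemma restr_scale1 : left_id 1 restr_scale.
Proof. by move=> x; rewrite /restr_scale rmorph1 scale1r. Qed.
Lemma restr_scaleDr : right_distributive restr_scale +%R.
Proof. by move=> c x y; rewrite /restr_scale scalerDr. Qed.
Lemma restr_scaleDl x : {morph restr_scale^~ x : c d / c + d}.
Proof. by move=> c d; rewrite /restr_scale rmorphD scalerDl. Qed.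
HB.instance Definition _ := GRing.Zmodule_isLmodule.Build A restr
  restr_scaleA restr_scale1 restr_scaleDr restr_scaleDl.

Lemma restr_scaleE (c : A) (x : restr) : c *: x = iota c *: (x : 'rV[S]_n).
Proof. by []. Qed.

End Restrict.

(** * Local triviality of the kernel *)

Section LocallyFree.
Variables (A S : comNzRingType) (iota : {rmorphism A -> S}) (n : nat) (a : 'I_n.+1 -> A).
Variables (i : 'I_n.+1) (u : S).
Hypothesis iota_inj : injective iota.
Hypothesis iota_u : iota (a i) * u = 1.
Hypothesis iota_loc : forall s, exists m b, s * iota (a i) ^+ m = iota b.

Lemma common_power (y : 'rV[S]_n) : exists m (b : 'rV[A]_n),
  iota (a i) ^+ m *: y = map_mx iota b.
Proof.
have [m mP] := fin_all_exists (fun j => iota_loc (y 0 j)).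
have [b bP] := fin_all_exists mP.
exists (\sum_j m j)%N, (\row_j (b j * a i ^+ (\sum_(l | l != j) m l))).
apply/rowP => j; rewrite !mxE rmorphM -bP rmorphXn (bigD1 j) //= exprD.
by rewrite mulrC mulrA.
Qed.

Lemma restr_bij : bijective (fun y : restr iota n => a i *: y).
Proof.
exists (fun y => u *: (y : 'rV[S]_n)) => y; rewrite restr_scaleE scalerA.
  by rewrite mulrC iota_u scale1r.
by rewrite iota_u scale1r.
Qed.

Lemma free_localization : exists psi : {linear 'rV[A]_n -> restr iota n},
  is_localization (a i) psi.
Proof.
pose f (v : 'rV[A]_n) : restr iota n := map_mx iota v.
have fl : linear f.
  by move=> c v w; apply/rowP => j; rewrite !mxE rmorphD rmorphM.
pose fL : {linear 'rV[A]_n -> restr iota n} := HB.pack f (GRing.isLinear.Build _ _ _ _ f fl).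
exists fL; split; first exact: restr_bij.
  move=> x x0; exists 0%N; rewrite scale1r; apply/rowP => j.
  by apply: iota_inj; have /rowP/(_ j) := x0; rewrite !mxE rmorph0.
move=> y; have [m [b E]] := common_power y; exists m, b.
by rewrite restr_scaleE rmorphXn.
Qed.

(** Where [a i] is invertible, the coordinate [i] of a kernel vector is determined by the others,
    which are arbitrary. *)
Lemma kerm_localization : exists phi : {linear kerm a -> restr iota n},
  is_localization (a i) phi.
Proof.
pose f (x : kerm a) : restr iota n := \row_j iota (kval x 0 (lift i j)).
have fl : linear f.
  by move=> c x y; apply/rowP => j; rewrite !mxE rmorphD rmorphM.
pose fL : {linear kerm a -> restr iota n} := HB.pack f (GRing.isLinear.Build _ _ _ _ f fl).
exists fL; split; first exact: restr_bij.
  move=> x x0; exists 1%N.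
  have xj j : kval x 0 (lift i j) = 0.
    by apply: iota_inj; have /rowP/(_ j) := x0; rewrite !mxE rmorph0.
  apply: val_inj; apply/rowP => j; rewrite /= !mxE.
  have := dotp_kval x; rewrite /dotp (bigD1_ord i) //= big1 => [|l _].
    by rewrite addr0 => E; case: (unliftP i j) => [l|] ->; rewrite ?xj ?mulr0 // mulrC.
  by rewrite xj mul0r.
move=> y; have [m [b E]] := common_power y.
(* Solving for the coordinate [i] would divide by [a i]; the whole vector is multiplied by [a i]
   instead, which costs one more power below. *)
pose v : 'rV[A]_n.+1 := \row_j (if unlift i j is Some l then a i * b 0 l
                              else - \sum_l b 0 l * a (lift i l)).
have vk : v \in kerp a.
  rewrite kerpE /dotp (bigD1_ord i) //= mxE unlift_none mulNr mulr_suml addrC subr_eq0.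
  by apply/eqP/eq_bigr => l _; rewrite mxE liftK; ring.
exists m.+1, (Kerm vk); rewrite restr_scaleE rmorphXn exprS -scalerA E.
by apply/rowP => j; rewrite !mxE liftK rmorphM.
Qed.

Lemma kerm_free_on : free_on_basic_open n (kerm a) (a i).
Proof.
have [phi phiP] := kerm_localization; have [psi psiP] := free_localization.
by exists (restr iota n), phi, psi.
Qed.

End LocallyFree.

(** * The kernel over a localization *)

Section LocBundle.
Variables (F : fieldType) (n m : nat) (g : {mpoly F[n]}).
Hypothesis g0 : g != 0.
Local Notation R := {mpoly F[n]}.
Variables (r q : 'I_m.+2 -> R).
Hypothesis rq : \sum_i r i * q i = g.
Hypothesis r0 : forall i, r i != 0.
Local Notation A := (loc g).

Let a i : A := toloc g (r i).

Lemma loc_unimodular : dotp a (\row_i (toloc g (q i) * ginv g0)) = 1.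
Proof.
have gE : toloc g g = \sum_i toloc g (r i) * toloc g (q i).
  by rewrite -[X in toloc g X]rq rmorph_sum; apply: eq_bigr => i _; rewrite rmorphM.
rewrite -(mul_ginv g0) gE mulr_suml; apply: eq_bigr => i _.
by rewrite !mxE mulrC mulrA.
Qed.

Lemma loc_kerm_free_on i : free_on_basic_open m.+1 (kerm a) (a i).
Proof.
have gr0 : g * r i != 0 by rewrite mulf_neq0.
pose S := loc (g * r i).
have [tl tlE] := toloc_lr (g * r i).
have E : toloc (g * r i) g * (toloc (g * r i) (r i) * ginv gr0) = 1.
  by rewrite mulrA -rmorphM mul_ginv.
have [|iota iotaE] := @loc_ext F n g S (toloc (g * r i) (r i) * ginv gr0) tl.
  by rewrite tlE.
have {}iotaE b : iota (toloc g b) = toloc (g * r i) b by rewrite iotaE tlE.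
apply: (@kerm_free_on A S iota _ a i (toloc (g * r i) g * ginv gr0)).
- apply: raddf_inj => x x0; have [k [b xE]] := locE x.
  have b0 : b = 0.
    apply: (@toloc_inj _ _ (g * r i)).
    by rewrite -iotaE -xE rmorphM x0 mul0r rmorph0.
  by rewrite -[x]mulr1 -(mul_ginvX g0 k) mulrA xE b0 rmorph0 mul0r.
- by rewrite /a /= iotaE mulrA -rmorphM [r i * g]mulrC mul_ginv.
- move=> s; have [k [b sE]] := locE s.
  exists k, (toloc g b * ginv g0 ^+ k).
  have iu : iota (toloc g g) ^+ k * iota (ginv g0) ^+ k = 1.
    by rewrite -exprMn -rmorphM mul_ginv rmorph1 expr1n.
  rewrite /a rmorphM /= !iotaE rmorphXn -sE rmorphM exprMn -[LHS]mulr1 -iu iotaE.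
  by ring.
Qed.

Lemma loc_vector_bundle : vector_bundle m.+1 (kerm a).
Proof.
exists m.+2, a, (fun i => toloc g (q i) * ginv g0); split; last exact: loc_kerm_free_on.
by rewrite -[RHS]loc_unimodular; apply: eq_bigr => i _; rewrite !mxE.
Qed.

(** All columns but the first are multiplied by a power of [g] to clear denominators; the
    determinant then divides a power of [g]. *)
Lemma trivial_kerm_poly_completion : trivial_bundle (kerm a) ->
  exists e (M : 'M[R]_m.+2), (forall i, M i ord0 = r i) /\ \det M = g ^+ e.
Proof.
move=> /(trivial_kerm_completion loc_unimodular)[C [C0 [d Cd]]].
have ex (ij : 'I_m.+2 * 'I_m.+2) : exists k, exists b, C ij.1 ij.2 * toloc g g ^+ k = toloc g b.
  exact: locE.
have [k kP] := fin_all_exists ex.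
pose N := \sum_ij k ij.
have ex2 (ij : 'I_m.+2 * 'I_m.+2) : exists b, C ij.1 ij.2 * toloc g g ^+ N = toloc g b.
  have [b bE] := kP ij.
  exists (b * g ^+ (\sum_(l | l != ij) k l)).
  by rewrite /N (bigD1 ij) //= exprD mulrA bE rmorphM rmorphXn.
have [b bP] := fin_all_exists ex2.
pose M : 'M[R]_m.+2 := \matrix_(i, j) if j == ord0 then r i else b (i, j).
pose D : 'rV[A]_m.+2 := \row_j if j == ord0 then 1 else toloc g g ^+ N.
have ME : map_mx (toloc g) M = C *m diag_mx D.
  apply/matrixP => i j; rewrite mul_mx_diag !mxE.
  by case: eqP => [->|_]; rewrite ?C0 ?mulr1 // -(bP (i, j)).
have [p [d0 dE]] := locE d.
have [e detD] : exists e, \det (diag_mx D) = toloc g g ^+ e.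
  exists (N * m.+1)%N; rewrite det_diag big_ord_recl mxE eqxx mul1r.
  rewrite (eq_bigr (fun=> toloc g g ^+ N)) => [|j _]; last by rewrite mxE.
  by rewrite prodr_const card_ord exprM.
have detM : \det M * d0 = g ^+ (e + p).
  apply: (@toloc_inj _ _ g).
  rewrite rmorphM /= -dE -det_map_mx ME det_mulmx detD rmorphXn exprD.
  by rewrite -[RHS]mul1r -Cd; ring.
(* The complementary factor [d0] is absorbed into the second column, which leaves the first one
   unchanged and makes the determinant exactly a power of [g]. *)
pose D' : 'rV[R]_m.+2 := \row_j if j == lift ord0 ord0 then d0 else 1.
exists (e + p)%N, (M *m diag_mx D'); split.
  by move=> i; rewrite mul_mx_diag !mxE eqxx mulr1.
rewrite det_mulmx -detM; congr (_ * _); rewrite det_diag (bigD1 (lift ord0 ord0)) //=.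
by rewrite mxE eqxx big1 ?mulr1 // => j /negPf ne; rewrite mxE ne.
Qed.

End LocBundle.

(** * The bundle *)

Lemma fraction_repr (D : idomainType) (q : {fraction D}) :
  exists a b, b != 0 /\ q * tofrac b = tofrac a.
Proof.
elim/quotW: q => x; exists (frac x).1, (frac x).2; split; first exact: denom_ratioP.
unlock FracField.tofrac; rewrite -[LHS]FracField.pi_mul; apply/eqmodP => /=.
rewrite FracField.equivfE /FracField.mulf !numden_Ratio ?mulf_neq0 ?oner_neq0 ?denom_ratioP //.
by rewrite !mulr1 mulrC.
Qed.

(** After clearing denominators the two sides have degrees of different parity. *)
Lemma X_nonsquare (k : fieldType) (c : {fraction {poly k}}) : c ^+ 2 != tofrac 'X.
Proof.
have [a [b [b0 cb]]] := fraction_repr c.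
apply/eqP => E.
have {}E : a ^+ 2 = b ^+ 2 * 'X.
  by apply/eqP; rewrite -tofrac_eq tofracM !tofracXn -E -cb exprMn mulrC.
have [a0|a0] := eqVneq a 0.
  by move/eqP: E; rewrite a0 expr0n /= eq_sym mulf_eq0 polyX_eq0 expf_eq0 /= (negPf b0).
have := congr1 (fun p : {poly k} => odd (size p).-1) E.
have b2 : (0 < size (b ^+ 2))%N by rewrite size_poly_gt0 expf_neq0.
by rewrite size_mulX ?expf_neq0 //= -(prednK b2) !size_exp /= !oddM /= !andbF.
Qed.

Section Construction.
Variables (K F : fieldType) (n : nat) (T : K) (t b g : {mpoly F[n]}).
Variables (r : 'I_3 -> {mpoly F[n]}) (pt : 'I_n -> F).
Variable phi : {rmorphism {mpoly F[n]} -> {poly {poly {poly K}}}}.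
Hypotheses (nsq : forall c, c ^+ 2 != T) (two0 : (2%:R : K) != 0).
Hypotheses (bE : b = r i0 ^+ 2 - t * r i1 ^+ 2) (gE : g = r i2 ^+ 2 - t * b ^+ 2).
Hypotheses (phi_t : phi t = iota3 K T) (phi0 : phi (r i0) = xv K)
  (phi1 : phi (r i1) = yv K) (phi2 : phi (r i2) = zv K).
Hypotheses (pt0 : mmap idfun pt (r i0) = 0) (pt1 : mmap idfun pt (r i1) = 0)
  (pt2 : mmap idfun pt (r i2) = 1).

(** Covers a constant [t] over [K] as well as a variable [t] over [k]; [phi] carries a completion
    over the base to one over [K[y][x][z]]. At the point [pt] the value of [g] is 1, which supplies
    the chain of primes of full length. *)
Lemma exists_nontrivial_bundle : exists (A : comAlgType F) (P : lmodType A),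
  [/\ smooth A, krull_dim A n, vector_bundle 2 P, ~ trivial_bundle P & stably_trivial P].
Proof.
have gpt : mmap idfun pt g != 0.
  rewrite gE bE !(rmorphB, rmorphXn, rmorphM) /= pt0 pt1 pt2.
  by rewrite (_ : _ - _ = 1) ?oner_neq0 //; ring.
have g0 := g_neq0 gpt.
pose q (i : 'I_3) := if i == i0 then - t * b * r i0
  else if i == i1 then t ^+ 2 * b * r i1 else r i2.
have rq : \sum_i r i * q i = g by rewrite sum3 /q /= gE bE; ring.
have r0 i : r i != 0.
  have : phi (r i) != 0.
    by move: i; apply: ord3; rewrite ?phi0 ?phi1 ?phi2 ?polyC_eq0 polyX_eq0.
  by apply: contraNneq => ->; rewrite rmorph0.
exists (loc g), (kerm (fun i => toloc g (r i))); split.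
- exact: loc_smooth g0.
- exact: loc_krull_dim gpt.
- exact: (@loc_vector_bundle F n 1 g g0 r q rq r0).
- move=> /(trivial_kerm_poly_completion g0 rq)[e [M [M0 detM]]].
  apply: (@no_completion K T nsq two0 e (map_mx phi M)); rewrite ?mxE ?M0 //.
  rewrite det_map_mx detM rmorphXn; congr (_ ^+ _).
  by rewrite gE bE !(rmorphB, rmorphXn, rmorphM) /= phi_t phi0 phi1 phi2.
- exact: (kerm_stably_trivial (loc_unimodular g0 rq)).
Qed.

End Construction.

Theorem theorem5p3 (k : closedFieldType) (char_k : 2%N \notin [pchar k]) :
  (exists (A : comAlgType {fraction {poly k}}) (P : lmodType A),
     [/\ smooth A, krull_dim A 3, vector_bundle 2 P,
         ~ trivial_bundle P & stably_trivial P]) /\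
  (exists (A : comAlgType k) (P : lmodType A),
     [/\ smooth A, krull_dim A 4, vector_bundle 2 P,
         ~ trivial_bundle P & stably_trivial P]).
Proof.
pose K := {fraction {poly k}}.
pose T : K := tofrac 'X.
have two0 : (2%:R : K) != 0.
  have -> : 2%:R = tofrac (2%:R : {poly k}) :> K by rewrite rmorph_nat.
  rewrite tofrac_eq0 -polyC_natr polyC_eq0.
  by apply: contra char_k => two; rewrite inE.
have nsq := @X_nonsquare k.
(* The default of [nth] is used: at index 3 it sends the fourth variable of the second part to
   [T]. *)
pose w (i : nat) : {poly {poly {poly K}}} :=
  nth (iota3 K T) [:: xv K; yv K; zv K] i.
split.
- pose X (i : nat) : {mpoly K[3]} := 'X_(inord i).
  pose r (i : 'I_3) := X i.
  pose t : {mpoly K[3]} := T%:MP.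
  pose phi : {rmorphism {mpoly K[3]} -> _} := mmap (iota3 K) (fun i : 'I_3 => w i).
  have phiX i : (i < 3)%N -> phi (X i) = w i.
    by move=> lt; rewrite /phi /= mmapX mmap1U inordK.
  pose pt (i : 'I_3) : K := (i == 2%N :> nat)%:R.
  apply: (@exists_nontrivial_bundle K K 3 T t _ _ r pt phi nsq two0 (erefl _) (erefl _)).
  + by rewrite /phi /= mmapC.
  + exact: phiX.
  + exact: phiX.
  + exact: phiX.
  + by rewrite mmapX mmap1U /pt inordK.
  + by rewrite mmapX mmap1U /pt inordK.
  + by rewrite mmapX mmap1U /pt inordK.
- pose X (i : nat) : {mpoly k[4]} := 'X_(inord i).
  pose r (i : 'I_3) := X i.
  pose phi : {rmorphism {mpoly k[4]} -> _} :=
    mmap (iota3 K \o @tofrac {poly k} \o polyC) (fun i : 'I_4 => w i).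
  have phiX i : (i < 4)%N -> phi (X i) = w i.
    by move=> lt; rewrite /phi /= mmapX mmap1U inordK.
  pose pt (i : 'I_4) : k := (i == 2%N :> nat)%:R.
  apply: (@exists_nontrivial_bundle K k 4 T (X 3%N) _ _ r pt phi nsq two0 (erefl _) (erefl _)).
  + exact: phiX.
  + exact: phiX.
  + exact: phiX.
  + exact: phiX.
  + by rewrite mmapX mmap1U /pt inordK.
  + by rewrite mmapX mmap1U /pt inordK.
  + by rewrite mmapX mmap1U /pt inordK.
Qed.
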